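(* Let $T$ be a bounded rank-one transformation, that is, a rank-one transformation described by a fixed pair of cutting and spacer parameters $(q_n)$, $(a_{n,i})$ which are both bounded. Then $T$ has trivial centralizer if and only if $T$ is canonically bounded.
   Context: $\mathbb{N}=\{0,1,2,\dots\}$. **Rank-one transformations.** Let $q_n>1$ ($n\in\mathbb{N}$) be integers and $a_{n,i}\ge 0$ ($n\in\mathbb{N}$, $0<i<q_n$) integers. Define $h_0=1$, $h_{n+1}=q_nh_n+\sum_{0<i<q_n}a_{n,i}$. An invertible measure preserving transformation $T$ of $[0,1]$ with Lebesgue measure is rank-one with cutting parameter $(q_n)$ and spacer parameter $(a_{n,i})$ if $\sum_n (h_{n+1}-q_nh_n)/h_{n+1}<\infty$ and there are measurable sets $B_n$, $B_{n,i}$ ($0<i\le q_n$), $C_{n,i,j}$ ($0<i<q_n$, $0<j\le a_{n,i}$) such that for all $n$: $\{B_{n,i}:0<i\le q_n\}$ is a partition of $B_n$; the sets $T^k(B_n)$, $0\le k<h_n$, are disjoint; for $0<i<q_n$, $T^{h_n}(B_{n,i})=C_{n,i,1}$ if $a_{n,i}\ne0$ and $T^{h_n}(B_{n,i})=B_{n,i+1}$ if $a_{n,i}=0$; $T(C_{n,i,j})=C_{n,i,j+1}$ if $j<a_{n,i}$; $T(C_{n,i,a_{n,i}})=B_{n,i+1}$ if $i<q_n$ and $a_{n,i}\neq 0$; $B_{n+1}=B_{n,1}$; and the finite unions of levels $T^k(B_n)$ ($n\in\mathbb{N}$, $0\le k<h_n$) are dense in the measure algebra. A measure preserving transformation of a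 Lebesgue space is rank-one, described by these parameters, if it is isomorphic to such a $T$. **Words and canonical parameters.** $\mathcal{F}$ is the set of finite words over $\{0,1\}$ that start and end with $0$. For $u,v\in\mathcal{F}$, $v\prec u$ (''$u$ is built from $v$'') means $u=v1^{a_1}v\cdots v1^{a_{q-1}}v$ for some $q>1$ and integers $a_i\ge0$; $v\prec_s u$ (''built simply'') means moreover $a_1=\dots=a_{q-1}$. The generating sequence of the parameters $(q_n),(a_{n,i})$ is $v_0=0$, $v_{n+1}=v_n1^{a_{n,1}}v_n\cdots v_n1^{a_{n,q_n-1}}v_n$; conversely a sequence with $v_0=0$ and $v_n\prec v_{n+1}$ for all $n$ determines its parameters. Its limit is the infinite word $V$ having every $v_n$ as an initial segment. The parameters are trivial if $V$ is periodic and nontrivial otherwise. An infinite word $V$ is built from $v\in\mathcal{F}$ if $V=v1^{a_1}v1^{a_2}v\cdots$ with integers $a_i\ge0$. A generating sequence $(v_n)$ with limit $V$ is canonical if it enumerates, in increasing order of length, all $v\in\mathcal{F}$ from which $V$ is built such that there are no $u,w\in\mathcal{F}$ with $V$ built from both $u$ and $w$, $u\prec v\prec w$ and $u\prec_s w$. A pair of parameters is canonical if its generating sequence is canonical. It is known that every aperiodic $V$ arising as the limit of a generating sequence is the limit of a unique canonical generating sequence; hence to each nontrivial pair of parameters corresponds a unique canonical pair (the one whose generating sequence is the canonical one with the same limit $V$). **Canonically bounded.** A bounded rank-one transformation with given bounded parameters is canonically bounded if the given pair is nontrivial (so the corresponding canonical pair is defined) and the corresponding canonical cutting and spacer parameters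 are both bounded. **Trivial centralizer.** For an invertible measure preserving $T$ on a Lebesgue space $(X,\mu)$, $C(T)=\{S\in\mathrm{Aut}(X,\mu): TS=ST\}$, where $\mathrm{Aut}(X,\mu)$ is the group of invertible measure preserving transformations modulo null sets. $T$ has trivial centralizer if $C(T)=\{T^n:n\in\mathbb{Z}\}$. *)

(* Defs.v *)
From mathcomp Require Import all_boot all_order all_algebra.
From mathcomp Require Import all_classical all_reals all_analysis.

Set Implicit Arguments.
Unset Strict Implicit.
Unset Printing Implicit Defensive.

Import Order.TTheory GRing.Theory Num.Theory.

Local Open Scope classical_set_scope.
Local Open Scope ring_scope.

(* Finite words over {0,1}: [false] is the letter 0 and [true] is the letter 1. *)

Definition word := seq bool.
Definition infinite_word := nat -> bool.

(* For the empty word both sides default to the letter 1, so it is excluded. *)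
Definition inF (u : word) : bool := ~~ head true u && ~~ last true u.

(* concat v [:: a_1; ...; a_r] = v 1^{a_1} v ... 1^{a_r} v *)
Definition concat (v : word) (s : seq nat) : word :=
  v ++ flatten [seq nseq k true ++ v | k <- s].

Definition built (v u : word) : Prop :=
  exists2 s : seq nat, (0 < size s)%N & u = concat v s.

Definition built_simply (v u : word) : Prop :=
  exists s : seq nat, [/\ (0 < size s)%N, constant s & u = concat v s].

Definition initial_segment (u : word) (V : infinite_word) : Prop :=
  u = mkseq V (size u).

(* V = v 1^{a_1} v 1^{a_2} v ..., stated on all finite truncations; for v
   nonempty their lengths are unbounded, so they determine V. *)
Definition built_inf (v : word) (V : infinite_word) : Prop :=
  exists a : nat -> nat, forall n, initial_segment (concat v (mkseq a n)) V.

Definition periodic_word (V : infinite_word) : Prop :=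
  exists2 p, (0 < p)%N & forall k, V (k + p)%N = V k.

Definition limit_of (v : nat -> word) (V : infinite_word) : Prop :=
  forall n, initial_segment (v n) V.

Definition canonical_word (V : infinite_word) (v : word) : Prop :=
  [/\ inF v, built_inf v V &
   ~ exists u w : word, [/\ inF u && inF w, built_inf u V, built_inf w V,
       built u v /\ built v w & built_simply u w]].

Definition canonical_generating (v : nat -> word) (V : infinite_word) : Prop :=
  [/\ limit_of v V,
      forall n, canonical_word V (v n),
      forall w, canonical_word V w -> exists n, v n = w &
      forall n, (size (v n) < size (v n.+1))%N].

(* A cutting parameter is q : nat -> nat and a spacer parameter is
   a : nat -> nat -> nat; only the values a n i with 0 < i < q n are used. *)

Definition cutting (q : nat -> nat) : Prop := forall n, (1 < q n)%N.

Definition bounded_parameters (q : nat -> nat) (a : nat -> nat -> nat) : Prop :=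
  (exists M, forall n, (q n <= M)%N) /\
  (exists M, forall n i, (0 < i < q n)%N -> (a n i <= M)%N).

Fixpoint height (q : nat -> nat) (a : nat -> nat -> nat) (n : nat) : nat :=
  if n is m.+1 then (q m * height q a m + \sum_(1 <= i < q m) a m i)%N else 1%N.

Fixpoint generating (q : nat -> nat) (a : nat -> nat -> nat) (n : nat) : word :=
  if n is m.+1 then concat (generating q a m) [seq a m i | i <- index_iota 1 (q m)]
  else [:: false].

Definition nontrivial_parameters (q : nat -> nat) (a : nat -> nat -> nat) : Prop :=
  exists2 V, limit_of (generating q a) V & ~ periodic_word V.

Definition corresponding_canonical (q : nat -> nat) (a : nat -> nat -> nat)
    (q' : nat -> nat) (a' : nat -> nat -> nat) : Prop :=
  cutting q' /\
  exists2 V, limit_of (generating q a) V & canonical_generating (generating q' a') V.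

Definition canonically_bounded (q : nat -> nat) (a : nat -> nat -> nat) : Prop :=
  nontrivial_parameters q a /\
  exists q' a', corresponding_canonical q a q' a' /\ bounded_parameters q' a'.

(* The condition says that f is measurable and measure preserving with respect
   to the completions of mu and nu; it does not distinguish a Lebesgue space
   given by its Borel sets from its completion. *)
Definition measure_preserving d1 d2 (X : measurableType d1) (Y : measurableType d2)
    (R : realType) (mu : {measure set X -> \bar R}) (nu : {measure set Y -> \bar R})
    (f : X -> Y) : Prop :=
  forall A : set Y, measurable A ->
    exists B : set X, [/\ measurable B, mu B = nu A & mu.-negligible (f @^-1` A `+` B)].

Definition mod0_inverses d1 d2 (X : measurableType d1) (Y : measurableType d2)
    (R : realType) (mu : {measure set X -> \bar R}) (nu : {measure set Y -> \bar R})
    (f : X -> Y) (g : Y -> X) : Prop :=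
  [/\ measure_preserving mu nu f, measure_preserving nu mu g,
      {ae mu, forall x, g (f x) = x} & {ae nu, forall y, f (g y) = y}].

(* Representatives of elements of Aut(X, mu); two of them define the same
   element when their underlying functions agree almost everywhere. *)
Record aut d (X : measurableType d) (R : realType) (mu : {measure set X -> \bar R}) :=
  Aut {
    aut_fun :> X -> X;
    aut_inv : X -> X;
    autP : mod0_inverses mu mu aut_fun aut_inv
  }.

Section Transformations.
Context d (X : measurableType d) (R : realType) (mu : {measure set X -> \bar R}).

Definition aut_pow (T : aut mu) (n : int) : X -> X :=
  match n with
  | Posz k => iter k T
  | Negz k => iter k.+1 (aut_inv T)
  end.

Definition centralizer (T : aut mu) : set (aut mu) :=
  [set S | {ae mu, forall x, T (S x) = S (T x)}].

Definition trivial_centralizer (T : aut mu) : Prop :=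
  centralizer T = [set S | exists n : int, {ae mu, forall x, S x = aut_pow T n x}].

(* T^k(A), as the preimage of A under the k-th iterate of the inverse: T is
   only injective almost everywhere, so the direct image of a null set need
   not be null. *)
Definition aut_image (T : aut mu) (k : nat) (A : set X) : set X :=
  iter k (aut_inv T) @^-1` A.

Definition eq_mod0 (A B : set X) : Prop := mu.-negligible (A `+` B).

Definition disjoint_mod0 (A B : set X) : Prop := mu.-negligible (A `&` B).

(* In [dense_levels] the symmetric difference is measurable only for the
   completion of mu, hence the measurable cover N. *)
Definition dense_levels (T : aut mu) (h : nat -> nat) (B : nat -> set X) : Prop :=
  forall (A : set X) (e : R), measurable A -> 0 < e ->
    exists s : seq (nat * nat),
      (forall l, l \in s -> (l.2 < h l.1)%N) /\
      exists N : set X, [/\ measurable N, (mu N < e%:E)%E &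
        A `+` \bigcup_(l in [set` s]) aut_image T l.2 (B l.1) `<=` N].

Definition rank_one_with (T : aut mu) (q : nat -> nat) (a : nat -> nat -> nat) : Prop :=
  let h := height q a in
  (\sum_(0 <= n <oo) (((h n.+1)%:R - (q n * h n)%:R) / (h n.+1)%:R : R)%:E < +oo)%E /\
  exists (B : nat -> set X) (Bi : nat -> nat -> set X) (C : nat -> nat -> nat -> set X),
    [/\ forall n, measurable (B n),
        forall n i, (0 < i <= q n)%N -> measurable (Bi n i),
        forall n i j, (0 < i < q n)%N -> (0 < j <= a n i)%N -> measurable (C n i j) &
        dense_levels T h B] /\
    forall n,
      [/\ forall i j, (0 < i <= q n)%N -> (0 < j <= q n)%N -> i != j ->
            disjoint_mod0 (Bi n i) (Bi n j),
          eq_mod0 (\bigcup_(i in [set i | (0 < i <= q n)%N]) Bi n i) (B n),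
          forall k l, (k < h n)%N -> (l < h n)%N -> k != l ->
            disjoint_mod0 (aut_image T k (B n)) (aut_image T l (B n)),
          forall i, (0 < i < q n)%N ->
            eq_mod0 (aut_image T (h n) (Bi n i))
                    (if a n i == 0%N then Bi n i.+1 else C n i 1%N) &
          [/\ forall i j, (0 < i < q n)%N -> (0 < j < a n i)%N ->
                eq_mod0 (aut_image T 1 (C n i j)) (C n i j.+1),
              forall i, (0 < i < q n)%N -> a n i != 0%N ->
                eq_mod0 (aut_image T 1 (C n i (a n i))) (Bi n i.+1) &
              eq_mod0 (B n.+1) (Bi n 1%N)]].

End Transformations.

(* Lebesgue measure on [0,1], carried by the Borel space R: the complement of
   [0,1] is null, and all notions above ignore null sets. *)
Definition unit_lebesgue (R : realType) : {measure set measurableTypeR R -> \bar R} :=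
  mrestr (@lebesgue_measure R) (measurable_itv `[0%R, 1%R]).

Definition lebesgue_space d (X : measurableType d) (R : realType)
    (mu : {measure set X -> \bar R}) : Prop :=
  exists f g, mod0_inverses mu (unit_lebesgue R) f g.

Definition isomorphic d1 d2 (X : measurableType d1) (Y : measurableType d2)
    (R : realType) (mu : {measure set X -> \bar R}) (nu : {measure set Y -> \bar R})
    (T : aut mu) (S : aut nu) : Prop :=
  exists f g, mod0_inverses mu nu f g /\ {ae mu, forall x, f (T x) = S (f x)}.

Definition rank_one_described d (X : measurableType d) (R : realType)
    (mu : {measure set X -> \bar R}) (T : aut mu)
    (q : nat -> nat) (a : nat -> nat -> nat) : Prop :=
  exists S : aut (unit_lebesgue R), rank_one_with S q a /\ isomorphic T S.

(* Main.v *)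
(** Let [c i] be the number of ones after the [i]-th zero of the limit word [V].
The words from which [V] is built are its prefixes with [d] zeros for which [c i]
depends only on [i] modulo [d] unless [d] divides [i] ([toeplitz]), and "built
from" is divisibility. Such moduli are closed under gcd and lcm, and on the gcd
of two incomparable ones [c] is constant up to their lcm; hence canonical words
are comparable with all others. It follows that canonical boundedness says that
no run [v_n 1^b v_n 1^b ... v_n] with constant [b] fills a [v_(n+m)], for some
fixed [m] and all large [n] ([no_long_stretch]).

If long constant runs occur, the differences between consecutive copies of
[v_n] in them give times [g_k] with [T^(g_k)] close to the identity; along a
fast subsequence the powers [T^(g_0 + ... + g_(k-1))] converge to an element of
the centralizer, which differs from each power of [T] because these exponents
are eventually distinct but small compared with the next tower.

If no long constant runs occur, [V] contains no high powers, even
approximately. A map [S] commuting with [T] carries most [n]-blocks of most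
orbits to nearly the same name. The absence of powers synchronizes these names
with the blocks of [V], so that [S] maps most of [B m] into a translate of
[B m] by [T^j]; the offset [j] is unique, so it does not depend on the point
nor on [m], and [S] is a power of [T]. *)

Require Import Defs.
From mathcomp Require Import all_boot all_order all_algebra.
From mathcomp Require Import all_classical all_reals all_analysis.
From mathcomp Require Import measurable_realfun zify ring lra.

Set Implicit Arguments.
Unset Strict Implicit.
Unset Printing Implicit Defensive.

(** * The limit word and its spacer sequence *)

(** The given words v_n need not be canonical, so canonical boundedness must be read off from runs
    in the given ones. This works because a run through a noncanonical modulus, once extended as far
    as possible, ends at a canonical one: overlapping runs merge into a longer run. For a commuting
    S, the typical name W of the image of [B n] is known only up to a small proportion of wrong
    letters, and it is not known to be a factor of V. Hence W is never located in V directly; two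
    places of V that both resemble W are compared instead. A wrong spacer or a wrong offset would
    bring V close to a shift of itself, whereas absence of powers forces a fixed proportion of
    mismatches. The tolerances [12 * K * M] and [8 * Cd] quantify this, and [mism_shift] must
    therefore be uniform in the shift. All dynamical data hold only almost everywhere. The null sets
    are removed once, on an invariant set, so that orbits can be followed point by point. The limit
    of powers is built on [0,1], where rational half-lines separate points, and the result is
    carried over by the isomorphism. *)

Section SpacerSequence.

Variables (q : nat -> nat) (a : nat -> nat -> nat).
Hypothesis q_gt1 : cutting q.

Definition Qn n := \prod_(i < n) q i.

Lemma Qn0 : Qn 0 = 1.
Proof. by rewrite /Qn big_ord0. Qed.

Lemma QnS n : Qn n.+1 = Qn n * q n.
Proof. by rewrite /Qn big_ord_recr. Qed.

Lemma Qn_gt0 n : 0 < Qn n.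
Proof. by rewrite prodn_gt0 // => i; have := q_gt1 i; lia. Qed.

Lemma dvdn_Qn m n : m <= n -> Qn m %| Qn n.
Proof.
elim: n => [|n IH]; first by rewrite leqn0 => /eqP ->.
by rewrite leq_eqVlt ltnS => /predU1P[->//|/IH h]; rewrite QnS dvdn_mulr.
Qed.

Lemma leq_Qn m n : m <= n -> Qn m <= Qn n.
Proof. by move/dvdn_Qn => d; apply: dvdn_leq; rewrite ?Qn_gt0. Qed.

Lemma Qn_div_gt0 m n : m <= n -> 0 < Qn n %/ Qn m.
Proof. by move=> h; rewrite divn_gt0 ?Qn_gt0 // leq_Qn. Qed.

Lemma leq_Qn_add n m : Qn n * 2 ^ m <= Qn (n + m).
Proof.
elim: m => [|m IH]; first by rewrite addn0 muln1.
by rewrite addnS QnS expnSr mulnA leq_mul.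
Qed.

Lemma leq_exp2_Qn n : 2 ^ n <= Qn n.
Proof. by have := leq_Qn_add 0 n; rewrite Qn0 mul1n. Qed.

Lemma ltn_Qn n : n < Qn n.
Proof. exact: leq_trans (ltn_expl n (ltnSn 1)) (leq_exp2_Qn n). Qed.

(* The largest [n] with [Qn n] dividing [i]; the junk value [spacer 0] is never
   used by [tau]. *)
Definition slevel i := find (fun n => ~~ (Qn n.+1 %| i)) (iota 0 i).

(** Writing i = [Qn n] k with n the level of i, the i-th run of ones of V separates two copies of
    v_n inside one copy of v_(n+1), so its length is the parameter of stage n with index k mod
    [q n]. *)
Definition spacer i := a (slevel i) ((i %/ Qn (slevel i)) %% q (slevel i)).

Lemma slevelE i n : Qn n %| i -> ~~ (Qn n.+1 %| i) -> slevel i = n.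
Proof.
move=> d nd.
have i0 : 0 < i by case: i nd {d} => [|//]; rewrite dvdn0.
have ni : n < i by have := dvdn_leq i0 d; have := ltn_Qn n; lia.
have hs : has (fun n => ~~ (Qn n.+1 %| i)) (iota 0 i).
  by apply/hasP; exists n; rewrite ?mem_iota.
have := nth_find 0 hs; rewrite -/(slevel i).
have ls : slevel i < i by rewrite -[X in _ < X](size_iota 0) -has_find.
rewrite nth_iota // add0n => h1.
case: (ltngtP (slevel i) n) => // h.
  by rewrite (dvdn_trans (dvdn_Qn h) d) in h1.
have := @before_find _ 0 (fun n => ~~ (Qn n.+1 %| i)) (iota 0 i) n h.
by rewrite nth_iota // add0n nd.
Qed.

Lemma slevelP i : 0 < i -> Qn (slevel i) %| i /\ ~~ (Qn (slevel i).+1 %| i).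
Proof.
move=> i0.
have ex : exists n, ~~ (Qn n.+1 %| i).
  exists i; apply/negP => /(dvdn_leq i0); have := ltn_Qn i.+1; lia.
case: (ex_minnP ex) => n nd mn.
have d : Qn n %| i.
  case: n nd mn => [|n] nd mn; first by rewrite Qn0 dvd1n.
  by apply/negPn/negP => /mn; rewrite ltnn.
by rewrite (slevelE d nd).
Qed.

Lemma spacer_Qn n j : 0 < j < q n -> spacer (Qn n * j) = a n j.
Proof.
move=> /andP[j0 jq].
have lv : slevel (Qn n * j) = n.
  apply: slevelE; first exact: dvdn_mulr.
  by rewrite QnS dvdn_pmul2l ?Qn_gt0 // gtnNdvd.
by rewrite /spacer lv mulKn ?Qn_gt0 // modn_small.
Qed.

(** An index not divisible by [Qn n] has level below n, and reduction modulo [Qn n] changes neither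
    this level nor the digit there. Sections with an abstract [c] assume this property as
    [c_mod]. *)
Lemma spacer_mod n i : ~~ (Qn n %| i) -> spacer i = spacer (i %% Qn n).
Proof.
move=> nd.
have i0 : 0 < i by case: i nd => [|//]; rewrite dvdn0.
have [d1 d2] := slevelP i0.
set l := slevel i in d1 d2 *.
have ln : l < n.
  rewrite ltnNge; apply/negP => h.
  by rewrite (dvdn_trans (dvdn_Qn h) d1) in nd.
have dl : Qn l.+1 %| Qn n by exact: dvdn_Qn.
have dl' : Qn l %| Qn n by apply: dvdn_Qn; lia.
have lv : slevel (i %% Qn n) = l.
  apply: slevelE.
    by rewrite /dvdn modn_dvdm.
  by rewrite /dvdn modn_dvdm.
rewrite /spacer lv -/l; congr (a l _).
case/dvdnP: d1 => k ->.
case/dvdnP: dl' => r Er; rewrite Er -muln_modl !mulnK ?Qn_gt0 //.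
have: q l %| r.
  have := dl; rewrite QnS Er mulnC dvdn_pmul2r ?Qn_gt0 //.
by move=> h; rewrite modn_dvdm.
Qed.

End SpacerSequence.

Section ZeroPositions.

Variable c : nat -> nat.

(* Position of the [m]-th zero, zeros being numbered from [0]. *)
Definition tau m := \sum_(i < m) (c i.+1).+1.

(** The m-th zero is at position at least m, so testing the indices up to k decides whether position
    k carries a zero. *)
Definition limit_word : infinite_word := fun k => [forall m : 'I_k.+1, tau m != k].

Lemma tau0 : tau 0 = 0.
Proof. by rewrite /tau big_ord0. Qed.

Lemma tauS m : tau m.+1 = tau m + (c m.+1).+1.
Proof. by rewrite /tau big_ord_recr. Qed.

Lemma tau_addn m k : tau m + k <= tau (m + k).
Proof.
elim: k => [|k IH]; first by rewrite !addn0.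
by rewrite !addnS tauS; lia.
Qed.

Lemma leq_tau m : m <= tau m.
Proof. by have := tau_addn 0 m; rewrite tau0. Qed.

Lemma tau_leq m k : m <= k -> tau m <= tau k.
Proof. by move=> h; have := tau_addn m (k - m); rewrite subnKC //; lia. Qed.

Lemma tau_ltn m k : m < k -> tau m < tau k.
Proof. by move=> h; have := tau_leq h; rewrite tauS; lia. Qed.

Lemma ltn_tauE m k : (tau m < tau k) = (m < k).
Proof.
case: (ltnP m k) => [/tau_ltn //|/tau_leq h].
by apply/negbTE; rewrite -leqNgt.
Qed.

Lemma leq_tauE m k : (tau m <= tau k) = (m <= k).
Proof. by rewrite leqNgt ltn_tauE -leqNgt. Qed.

Lemma tau_inj : injective tau.
Proof. by move=> m k e; apply/eqP; rewrite eqn_leq -leq_tauE -[X in _ && X]leq_tauE e leqnn. Qed.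

Lemma limit_wordP k : reflect (exists m, k = tau m) (~~ limit_word k).
Proof.
apply: (iffP idP) => [/forallPn [m]|[m ->]].
  by rewrite negbK => /eqP <-; exists m.
have h : m < (tau m).+1 by rewrite ltnS leq_tau.
by apply/forallPn; exists (Ordinal h); rewrite negbK.
Qed.

Lemma limit_word_tau m : limit_word (tau m) = false.
Proof. by apply/negbTE/limit_wordP; exists m. Qed.

Lemma limit_word_gap m z : tau m < z < tau m.+1 -> limit_word z.
Proof.
move=> h; apply/negPn/negP => /limit_wordP [k e].
by move: h; rewrite e !ltn_tauE; lia.
Qed.

(** Equality of the two words spanned by I consecutive zeros, starting at the zeros A and B. The
    runs of ones just before and just after these words are left free, hence the strict bounds on
    i. *)
Definition agree A B I := forall i, 0 < i < I -> c (A + i) = c (B + i).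

Lemma agreeC A B I : agree A B I -> agree B A I.
Proof. by move=> h i /h ->. Qed.

Lemma tau_agree A B I i : agree A B I -> i < I ->
  tau (A + i) + tau B = tau (B + i) + tau A.
Proof.
move=> h; elim: i => [|i IH] li; first by rewrite !addn0 addnC.
have := IH (ltnW li); rewrite !addnS !tauS -!addnS (h i.+1); lia.
Qed.

Lemma limit_word_agree A B I z : agree A B I -> tau A + z <= tau (A + I.-1) ->
  limit_word (tau A + z) = limit_word (tau B + z).
Proof.
suff H A' B' : agree A' B' I -> tau A' + z <= tau (A' + I.-1) ->
    ~~ limit_word (tau A' + z) -> ~~ limit_word (tau B' + z).
  move=> h l; apply: negb_inj; apply/idP/idP; first exact: H.
  apply: H; first exact: agreeC.
  case: I h l => [|I] h l; first by move: l; rewrite !addn0; lia.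
  by have := @tau_agree A B I.+1 I h (ltnSn I); move: l => /=; lia.
move=> h l /limit_wordP [m e]; apply/limit_wordP.
have Am : A' <= m by rewrite -leq_tauE; lia.
have mI : m <= A' + I.-1 by rewrite -leq_tauE; lia.
exists (B' + (m - A')).
case: I h l mI => [|I] h l /= mI.
  have E : m - A' = 0 by lia.
  by move: l; rewrite E !addn0; lia.
have := @tau_agree A' B' I.+1 (m - A') h; rewrite subnKC //; lia.
Qed.

End ZeroPositions.

(** * Copies of v_n in the limit word *)

Section Blocks.

Variables (q : nat -> nat) (c : nat -> nat).
Hypothesis q_gt1 : cutting q.
Hypothesis c_mod : forall n i, ~~ (Qn q n %| i) -> c i = c (i %% Qn q n).

Local Notation Q := (Qn q).
Local Notation V := (limit_word c).

(* [block_start n t] is the position of the [t]-th copy of [v_n] in [V]. *)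
Definition block_start n t := tau c (Q n * t).
(** The length of v_n, which ends with its zero number [(Q n).-1]; [height_bheight] identifies it
    with the height of the n-th tower. *)
Definition bheight n := (tau c (Q n).-1).+1.

Lemma blk0 n : block_start n 0 = 0. Proof. by rewrite /block_start muln0 tau0. Qed.

Lemma bheight_gt0 n : 0 < bheight n. Proof. by []. Qed.

Lemma bheight0 : bheight 0 = 1. Proof. by rewrite /bheight Qn0 tau0. Qed.

Lemma agree_blocks n s t : agree c (Q n * s) (Q n * t) (Q n).
Proof.
move=> i hi.
have nd u : ~~ (Q n %| Q n * u + i) by rewrite dvdn_addr ?dvdn_mulr // gtnNdvd; lia.
by rewrite (c_mod (nd s)) (c_mod (nd t)) ![Q n * _]mulnC !modnMDl.
Qed.

Lemma tau_block n t i : i < Q n -> tau c (Q n * t + i) = block_start n t + tau c i.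
Proof.
move=> li; have := tau_agree (@agree_blocks n t 0) li.
by rewrite muln0 add0n tau0 addn0 /block_start addnC addnC => ->; rewrite addnC.
Qed.

Lemma blkS n t : block_start n t.+1 = block_start n t + bheight n + c (Q n * t.+1).
Proof.
have Q0 := Qn_gt0 q_gt1 n.
have E : Q n * t.+1 = (Q n * t + (Q n).-1).+1 by rewrite mulnS; lia.
by rewrite [LHS]/block_start {1}E tauS -E tau_block ?prednK // /bheight; lia.
Qed.

Lemma bheight_blk n m : n <= m ->
  bheight m = block_start n (Q m %/ Q n).-1 + bheight n.
Proof.
move=> nm; have d := dvdn_Qn q nm.
have Q0 := Qn_gt0 q_gt1 n; have Qm0 := Qn_gt0 q_gt1 m.
have k0 : 0 < Q m %/ Q n by exact: Qn_div_gt0.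
have E : (Q m).-1 = Q n * (Q m %/ Q n).-1 + (Q n).-1.
  rewrite -{1}(divnK d); case: (Q m %/ Q n) k0 => // k _ /=.
  by rewrite mulSn; lia.
by rewrite /bheight E tau_block ?prednK // addnS.
Qed.

Lemma blk_mul n m t s : n <= m -> s < Q m %/ Q n ->
  block_start m t + block_start n s = block_start n (t * (Q m %/ Q n) + s).
Proof.
move=> nm ls; have d := dvdn_Qn q nm.
have Q0 := Qn_gt0 q_gt1 n.
have E : Q n * (t * (Q m %/ Q n) + s) = Q m * t + Q n * s.
  by rewrite mulnDr mulnCA [Q n * _]mulnC divnK // mulnC.
by rewrite [RHS]/block_start E tau_block // mulnC -ltn_divRL.
Qed.

Lemma bheightS n : bheight n.+1 = q n * bheight n + \sum_(1 <= i < q n) c (Q n * i).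
Proof.
have Q0 := Qn_gt0 q_gt1 n.
rewrite (bheight_blk (leqnSn n)) QnS mulKn //.
have := q_gt1 n; case: (q n) => // k _ /=.
elim: k => [|k IH]; first by rewrite blk0 mul1n big_geq // addn0.
by rewrite blkS big_nat_recr //= mulSn; lia.
Qed.

Lemma limit_word_block n t z : z < bheight n -> V (block_start n t + z) = V z.
Proof.
move=> lz; have := @limit_word_agree c _ _ (Q n) z (@agree_blocks n t 0).
rewrite muln0 tau0 add0n; apply.
rewrite tau_block ?prednK ?Qn_gt0 //; move: lz; rewrite /bheight ltnS.
by rewrite /block_start; lia.
Qed.

Lemma limit_word_spacer n t z : z < c (Q n * t.+1) -> V (block_start n t + bheight n + z).
Proof.
move=> lz; have Q0 := Qn_gt0 q_gt1 n.
have E : Q n * t.+1 = (Q n * t + (Q n).-1).+1 by rewrite mulnS; lia.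
apply: (@limit_word_gap c (Q n * t + (Q n).-1)).
by rewrite tauS -E tau_block ?prednK // /bheight; lia.
Qed.

Lemma limit_word_blk n t : V (block_start n t) = false.
Proof. exact: limit_word_tau. Qed.

Lemma leq_blkE n s t : (block_start n s <= block_start n t) = (s <= t).
Proof. by rewrite leq_tauE leq_pmul2l // Qn_gt0. Qed.

Lemma leq_bheight_add n r : bheight n * 2 ^ r <= bheight (n + r).
Proof.
elim: r => [|r IH]; first by rewrite muln1 addn0.
rewrite addnS bheightS expnSr mulnA.
apply: leq_trans (leq_addr _ _); rewrite mulnC; apply: leq_mul => //.
Qed.

Lemma leq_bheight n m : n <= m -> bheight n <= bheight m.
Proof. by move=> h; rewrite ltnS tau_leq // -!subn1 leq_sub2r // leq_Qn. Qed.

Lemma ltn_bheight n : n < bheight n.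
Proof.
have := leq_bheight_add 0 n; rewrite bheight0 mul1n add0n.
exact: leq_trans (ltn_expl n (ltnSn 1)).
Qed.

End Blocks.

(** * Power-free words and synchronization of blocks *)

Definition wshift (f : nat -> bool) i : nat -> bool := fun k => f (i + k).

Definition mism L (f g : nat -> bool) := \sum_(k < L) (f k != g k).

Lemma eq_mism L f g f' g' : (forall k, k < L -> f k = f' k) ->
  (forall k, k < L -> g k = g' k) -> mism L f g = mism L f' g'.
Proof. by move=> hf hg; apply: eq_bigr => i _; rewrite hf // hg. Qed.

Lemma mismC L f g : mism L f g = mism L g f.
Proof. by apply: eq_bigr => i _; rewrite eq_sym. Qed.

Lemma mism_triangle L g f h : mism L f h <= mism L f g + mism L g h.
Proof.
rewrite /mism -big_split leq_sum // => i _ /=.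
by case: (f i) (g i) (h i) => [] [] [].
Qed.

Lemma mism_cat L1 L2 f g :
  mism (L1 + L2) f g = mism L1 f g + mism L2 (wshift f L1) (wshift g L1).
Proof. by rewrite /mism big_split_ord. Qed.

Lemma mism_sub L i L' f g : i + L' <= L ->
  mism L' (wshift f i) (wshift g i) <= mism L f g.
Proof. by move/subnKC => <-; rewrite !mism_cat; lia. Qed.

Lemma mism0P L f g : reflect (forall k, k < L -> f k = g k) (mism L f g == 0).
Proof.
rewrite /mism sum_nat_eq0; apply: (iffP forallP) => [h k lk|h [k lk]] /=.
  by have := h (Ordinal lk); rewrite /= eqb0 negbK => /eqP.
by rewrite h // eqxx.
Qed.

Lemma mism_blocks b k x f g : (forall t, t < k -> b t <= b t.+1) ->
  (forall t, t < k -> x <= mism (b t.+1 - b t) (wshift f (b t)) (wshift g (b t))) ->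
  b 0 <= b k /\ k * x <= mism (b k - b 0) (wshift f (b 0)) (wshift g (b 0)).
Proof.
elim: k => [|k IH] hb hx //.
have [l1 l2] := IH (fun t h => hb t (ltnW h)) (fun t h => hx t (ltnW h)).
have l3 := hb k (ltnSn k); split; first exact: leq_trans l1 l3.
have -> : b k.+1 - b 0 = (b k - b 0) + (b k.+1 - b k) by lia.
rewrite mism_cat mulSn addnC leq_add //.
apply: leq_trans (hx k (ltnSn k)) _; apply: eq_leq.
by apply: eq_mism => z _; rewrite /wshift addnA subnKC.
Qed.

(** Equality for all k < K p would give a factor of length (K + 1) p with period p, that is, a (K +
    1)-st power. *)
Definition power_free K (V : infinite_word) :=
  forall p i, 0 < p -> exists2 k, k < K * p & V (i + k) != V (i + k + p).

(** Each piece of length K S contains a letter that differs from its shift by s, because K s <= K S.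
    The density 1 / (K S) deteriorates as shifts grow; [mism_shift] replaces it by a uniform one. *)
Lemma power_free_mism K V S s i L : power_free K V -> 0 < s <= S ->
  L %/ (K * S) <= mism L (wshift V i) (wshift V (i + s)).
Proof.
move=> pf /andP[s0 sS]; set X := K * S.
have := @mism_blocks (fun t => t * X) (L %/ X) 1 (wshift V i) (wshift V (i + s)).
case=> [t _|t _|_]; first by rewrite leq_mul2r leqnSn orbT.
  rewrite mulSn addnK lt0n; apply/negP => /mism0P h.
  have [k lk] := pf s (i + t * X) s0.
  have := h k (leq_trans lk (leq_mul (leqnn K) sS)).
  rewrite /wshift => e /eqP; apply; rewrite -addnA e; congr V; lia.
rewrite muln1 mul0n subn0 => l; apply: leq_trans l _.
have := @mism_sub L 0 (L %/ X * X) (wshift V i) (wshift V (i + s)).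
rewrite add0n leq_trunc_div => /(_ isT); apply: leq_trans.
by apply: eq_leq; apply: eq_mism => k _; rewrite /wshift.
Qed.

Section Synchronization.

Variables (q : nat -> nat) (c : nat -> nat).
Hypothesis q_gt1 : cutting q.
Hypothesis c_mod : forall n i, ~~ (Qn q n %| i) -> c i = c (i %% Qn q n).
Variables (K M : nat).
Hypothesis c_le : forall i, c i <= M.
Hypothesis M_gt0 : 0 < M.
Hypothesis K_gt0 : 0 < K.
Hypothesis pf : power_free K (limit_word c).

Local Notation Q := (Qn q).
Local Notation V := (limit_word c).
Local Notation blk := (block_start q c).
Local Notation h := (bheight q c).

Local Notation Y := (12 * K * M).

(* [J + z0 = blk n u + y] aligns the window starting at [J + z0] with the inside
   of the block starting at [blk n u], with a margin of [M] on both sides. *)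
Definition overlap n len u J := exists z0 y,
  [/\ J + z0 = blk n u + y, M <= y, y + M + len <= h n & z0 + len <= h n].

(** The last block starting at or before j, or else the next one, covers nearly half of the window
    of length [h n] at j, since at most M ones lie between them. *)
Lemma overlap_exists n len j : 2 * len + 6 * M <= h n ->
  exists2 u, overlap n len u j & blk n u <= j + h n /\ j <= blk n u + h n.
Proof.
move=> hl; have [t l1 l2] : exists2 t, blk n t <= j & j < blk n t.+1.
  have ex : exists t, j < blk n t.
    exists j.+1; rewrite /blk; apply: leq_trans (leq_tau _ _).
    by apply: leq_pmull; apply: Qn_gt0.
  case: (ex_minnP ex) => -[|t] lt mt; first by move: lt; rewrite blk0.
  by exists t => //; rewrite leqNgt; apply/negP => /mt; rewrite ltnn.
move: l2; rewrite blkS // => l2; have := c_le (Q n * t.+1) => lc.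
case: (leqP (j - blk n t) (h n - len - 2 * M)) => l3.
  by exists t; [exists M, (M + (j - blk n t)); split; lia | lia].
exists t.+1; last by rewrite blkS //; lia.
by exists (M + (blk n t + h n + c (Q n * t.+1) - j)), M; rewrite blkS //; split; lia.
Qed.

(** The parts of V at J and at the next place both resemble W; in block coordinates they are V read
    at y and at y + c2 - c1. If the spacers c1 and c2 differed, V would be within 2 [eta] of a shift
    of itself by at most M, which is too few mismatches on a window of length [len]. *)
Lemma overlap_step n len eta W u t J : 2 * eta < len %/ (K * M) ->
  overlap n len u J ->
  mism (h n) (wshift V J) W <= eta ->
  mism (h n) (wshift V (J + h n + c (Q n * t.+1))) W <= eta ->
  c (Q n * u.+1) = c (Q n * t.+1) /\ overlap n len u.+1 (J + h n + c (Q n * t.+1)).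
Proof.
move=> le [z0 [y [e ly lyh lzh]]] m1 m2.
set c1 := c (Q n * u.+1); set c2 := c (Q n * t.+1); rewrite -/c2 in m2.
have := c_le (Q n * u.+1); have := c_le (Q n * t.+1); rewrite -/c1 -/c2 => l2 l1.
suff ec : c1 = c2.
  by split=> //; exists z0, y; split=> //; rewrite blkS // -/c1 ec; lia.
have sub f : mism len (wshift f z0) (wshift W z0) <= mism (h n) f W by exact: mism_sub.
have := sub (wshift V J); have := sub (wshift V (J + h n + c2)).
rewrite (@eq_mism len _ _ (wshift V (y + c2 - c1)) (wshift W z0)) //; last first.
  move=> k lk; rewrite /wshift.
  rewrite -(@limit_word_block q c q_gt1 c_mod n u.+1 (y + c2 - c1 + k)); last by lia.
  by rewrite blkS // -/c1; congr V; lia.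
rewrite [X in _ -> X <= _ -> _](@eq_mism len _ _ (wshift V y) (wshift W z0)) //; last first.
  move=> k lk; rewrite /wshift.
  rewrite -(@limit_word_block q c q_gt1 c_mod n u (y + k)); last by lia.
  by congr V; lia.
move=> s2 s1; have := mism_triangle len (wshift W z0) (wshift V y) (wshift V (y + c2 - c1)).
rewrite [X in _ <= _ + X]mismC.
case: (ltngtP c1 c2) => // lc tr.
  have sM : 0 < c2 - c1 <= M by lia.
  have := @power_free_mism K V M _ y len pf sM.
  by rewrite addnBA //; [lia | exact: ltnW].
have sM : 0 < c1 - c2 <= M by lia.
have := @power_free_mism K V M _ (y + c2 - c1) len pf sM.
have -> : y + c2 - c1 + (c1 - c2) = y by lia.
rewrite mismC; lia.
Qed.

(** W is an unknown word that V resembles at places spaced like the blocks t0, ..., t0 + k. A block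
    near j overlapping the first place is found, and [overlap_step] carries the overlap to the next
    place and block, so that the blocks near j must be spaced in the same way. *)
Lemma sync n W t0 k j : Y <= h n ->
  (forall t, t <= k ->
    mism (h n) (wshift V (j + blk n (t0 + t) - blk n t0)) W <= h n %/ Y) ->
  exists u, [/\ blk n u <= j + h n, j <= blk n u + h n &
    agree c (Q n * t0) (Q n * u) (Q n * k.+1)].
Proof.
(* A window of a quarter block leaves room for the margins because 12 M <= [h n], and 3 [eta] <=
   [h n] / (4 K M) makes 2 [eta] smaller than the number of mismatches forced on it. This is the
   origin of Y = 12 K M. *)
move=> hY hm; set len := h n %/ 4; set eta := h n %/ Y.
have Y0 : 0 < Y by rewrite !muln_gt0 K_gt0 M_gt0.
have hlen : 2 * len + 6 * M <= h n.
  have : 12 * M <= Y by rewrite leq_mul2r leq_pmulr ?orbT.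
  by have := leq_trunc_div (h n) 4; rewrite -/len; lia.
have heta : 2 * eta < len %/ (K * M).
  have e0 : 0 < eta by rewrite divn_gt0.
  apply: (@leq_trans (3 * eta)); first by lia.
  rewrite leq_divRL ?muln_gt0 ?K_gt0 // /len leq_divRL //.
  apply: leq_trans (leq_trunc_div (h n) Y); rewrite -/eta; nia.
have [u ou [l1 l2]] := overlap_exists j hlen.
have J_S t : j + blk n (t0 + t.+1) - blk n t0 =
    j + blk n (t0 + t) - blk n t0 + h n + c (Q n * (t0 + t).+1).
  have : blk n t0 <= blk n (t0 + t) by rewrite leq_blkE // leq_addr.
  by rewrite addnS blkS //; lia.
have main t : t <= k -> overlap n len (u + t) (j + blk n (t0 + t) - blk n t0) /\
    (forall s, 0 < s <= t -> c (Q n * (t0 + s)) = c (Q n * (u + s))).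
  elim: t => [|t IH] lt; first by rewrite !addn0 addnK; split=> // s; lia.
  have [ov cs] := IH (ltnW lt).
  have := hm t.+1 lt; rewrite J_S => m2.
  have [ec ov'] := overlap_step heta ov (hm t (ltnW lt)) m2.
  rewrite [u + _]addnS; split=> // s ls.
  case: (leqP s t) => ls'; first by apply: cs; lia.
  by have -> : s = t.+1 by [lia]; rewrite !addnS.
have [_ cs] := main k (leqnn k).
exists u; split=> // i li.
case: (boolP (Q n %| i)) => [/dvdnP [s es]|nd].
  rewrite es [s * _]mulnC -!mulnDr; apply: cs.
  by move: li; rewrite es mulnC ltn_pmul2l ?Qn_gt0 // muln_gt0; lia.
rewrite (@c_mod n (Q n * t0 + i)) ?dvdn_addr ?dvdn_mulr //.
by rewrite (@c_mod n (Q n * u + i)) ?dvdn_addr ?dvdn_mulr // ![Q n * _]mulnC !modnMDl.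
Qed.

Lemma power_free_shift a d L : 0 < d -> K * d <= L ->
  ~ (forall z, z < L -> V (a + z) = V (a + d + z)).
Proof.
move=> d0 hL e; have [k lk] := pf a d0.
by rewrite e; [rewrite addnAC eqxx | exact: leq_trans lk hL].
Qed.

Lemma limit_word_agree_block n A u z : agree c A (Q n * u) (Q n) -> z < h n ->
  V (tau c A + z) = V z.
Proof.
move=> ag lz; rewrite -(@limit_word_block q c q_gt1 c_mod n u z) //.
have ag' := agreeC ag.
rewrite (@limit_word_agree c _ _ (Q n) z ag') //.
rewrite tau_block ?prednK ?Qn_gt0 //; move: lz; rewrite /bheight /block_start; lia.
Qed.

(** At level n, [sync] finds a copy of v_N near j, but possibly not at the start of an m-block.
    Applied again at level m, with V itself in the role of W, it finds a copy that starts with an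
    m-block at distance at most [h m]. Two distinct copies of v_N so close to each other would
    create a forbidden power, as [K.+1 * h m <= h N]; hence they coincide. *)
Lemma align n m N W j : n <= m <= N -> Y <= h n -> K.+1 * h m <= h N ->
  (forall t, t < Q N %/ Q n -> mism (h n) (wshift V (j + blk n t)) W <= h n %/ Y) ->
  exists u, [/\ blk m u <= j + h n, j <= blk m u + h n & agree c 0 (Q m * u) (Q N)].
Proof.
move=> /andP[nm mN] hY hK hm.
have nN := leq_trans nm mN.
have dn := dvdn_Qn q nN; have dm := dvdn_Qn q mN.
have Qk l (ll : l <= N) : Q l * (Q N %/ Q l).-1.+1 = Q N.
  by rewrite prednK ?Qn_div_gt0 // mulnC divnK // dvdn_Qn.
have k0 l (ll : l <= N) : 0 < Q N %/ Q l by exact: Qn_div_gt0.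
have h1 t : t <= (Q N %/ Q n).-1 ->
    mism (h n) (wshift V (j + blk n (0 + t) - blk n 0)) W <= h n %/ Y.
  by move=> lt; rewrite blk0 subn0 add0n; apply: hm; have := k0 n nN; lia.
have [u [l1 l2 ag]] := sync hY h1; rewrite Qk // muln0 in ag.
have Ve z : z < h N -> V (blk n u + z) = V z.
  have ag0 : agree c (Q n * u) (Q N * 0) (Q N) by rewrite muln0; apply: agreeC.
  by move=> lz; exact: (limit_word_agree_block ag0 lz).
have h2 t : t <= (Q N %/ Q m).-1 ->
    mism (h m) (wshift V (blk n u + blk m (0 + t) - blk m 0)) V <= h m %/ Y.
  move=> lt; rewrite blk0 subn0 add0n; apply: leq_trans (leq0n _); rewrite leqn0.
  apply/mism0P => z lz; rewrite /wshift -addnA Ve ?limit_word_block //.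
  apply: (@leq_trans (blk m t + h m)); first by rewrite ltn_add2l.
  by rewrite (bheight_blk q_gt1 c_mod mN) leq_add2r leq_blkE.
have hYm : Y <= h m by apply: leq_trans hY _; apply: leq_bheight.
have [v [l3 l4 ag2]] := sync hYm h2; rewrite Qk // muln0 in ag2.
have Ve2 z : z < h N -> V (blk m v + z) = V z.
  have ag0 : agree c (Q m * v) (Q N * 0) (Q N) by rewrite muln0; apply: agreeC.
  by move=> lz; exact: (limit_word_agree_block ag0 lz).
suff E : blk m v = blk n u by exists v; split=> //; rewrite E.
move: hK; rewrite mulSn => hK.
case: (ltngtP (blk m v) (blk n u)) => // lv; exfalso.
  apply: (@power_free_shift 0 (blk n u - blk m v) (h N - h m)); first by lia.
    by have : K * (blk n u - blk m v) <= K * h m by [rewrite leq_mul2l; lia]; lia.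
  move=> z lz; rewrite add0n -(Ve z); last by lia.
  by rewrite add0n -(Ve2 (blk n u - blk m v + z)); [congr V; lia | lia].
apply: (@power_free_shift 0 (blk m v - blk n u) (h N - h m)); first by lia.
  by have : K * (blk m v - blk n u) <= K * h m by [rewrite leq_mul2l; lia]; lia.
move=> z lz; rewrite add0n -(Ve2 z); last by lia.
by rewrite add0n -(Ve (blk m v - blk n u + z)); [congr V; lia | lia].
Qed.

End Synchronization.

(** If [g] is a modulus dividing [l], this says that the spacers between the copies of the prefix
    with [g] zeros in the prefix with [l] zeros are all equal. *)
Definition simple_stretch (c : nat -> nat) g l :=
  forall s t, 0 < s < l %/ g -> 0 < t < l %/ g -> c (g * s) = c (g * t).

Definition no_long_stretch q c := exists n0 m, forall n, n0 <= n ->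
  ~ simple_stretch c (Qn q n) (Qn q (n + m)).

(** * Powers and approximate powers in the limit word *)

Section BoundedPowers.

Variables (q : nat -> nat) (c : nat -> nat).
Hypothesis q_gt1 : cutting q.
Hypothesis c_mod : forall n i, ~~ (Qn q n %| i) -> c i = c (i %% Qn q n).
Variables (qM M : nat).
Hypothesis q_le : forall n, q n <= qM.
Hypothesis c_le : forall i, c i <= M.
Hypothesis M_gt0 : 0 < M.

Local Notation Q := (Qn q).
Local Notation V := (limit_word c).
Local Notation blk := (block_start q c).
Local Notation h := (bheight q c).
Local Notation M2 := (qM * M.+1).

Lemma qM_gt1 : 1 < qM.
Proof. exact: leq_trans (q_gt1 0) (q_le 0). Qed.

Lemma bheightS_le n : h n.+1 <= M2 * h n.
Proof.
rewrite bheightS // -mulnA mulSn mulnDr leq_add ?leq_mul //.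
apply: (@leq_trans (\sum_(1 <= i < q n) M)); first by apply: leq_sum => i _.
rewrite sum_nat_const_nat; have := q_le n => lq.
by apply: leq_mul; [lia | rewrite leq_pmulr].
Qed.

Lemma bheight_add_le n m : h (n + m) <= M2 ^ m * h n.
Proof.
elim: m => [|m IH]; first by rewrite addn0 mul1n.
rewrite addnS expnS; apply: leq_trans (bheightS_le _) _.
by rewrite -[X in _ <= X]mulnA leq_mul2l IH orbT.
Qed.

Lemma block_after n a : exists2 t, a <= blk n t & blk n t <= a + h n + M.
Proof.
have ex : exists t, a <= blk n t.
  by exists a; apply: leq_trans (leq_tau _ _); apply: leq_pmull; apply: Qn_gt0.
case: (ex_minnP ex) => t lt mt; exists t => //.
case: t lt mt => [|t] lt mt; first by rewrite blk0.
have : blk n t < a by rewrite ltnNge; apply/negP => /mt; rewrite ltnn.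
rewrite blkS //; have := c_le (Q n * t.+1); lia.
Qed.

(* In a [p]-periodic window the letters following a block of length at least [p]
   are determined by that block, so all spacers between blocks agree. *)
Lemma periodic_stretch n m p b : p <= h n -> 0 < p ->
  (forall z, z + p < h m -> V (blk m b + z) = V (blk m b + z + p)) -> n <= m ->
  simple_stretch c (Q n) (Q m).
Proof.
move=> ph p0 per nm.
have E u : 0 < u < Q m %/ Q n -> c (Q n * (b * (Q m %/ Q n) + u)) = c (Q n * u).
  move=> hu; have d := dvdn_Qn q nm.
  have E1 : Q n * (b * (Q m %/ Q n) + u) = b * Q m + Q n * u.
    by rewrite mulnDr mulnCA [Q n * (_ %/ _)]mulnC divnK.
  have lQ : Q n * u < Q m by rewrite mulnC -ltn_divRL //; lia.
  have g0 : 0 < Q n * u by rewrite muln_gt0 Qn_gt0 //; lia.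
  have nd : ~~ (Q m %| Q n * u) by rewrite gtnNdvd.
  rewrite E1 (@c_mod m (b * Q m + Q n * u)); first by rewrite modnMDl modn_small.
  by rewrite dvdn_addr ?nd // dvdn_mull.
have main s t : 0 < s < Q m %/ Q n -> 0 < t < Q m %/ Q n ->
    ~ c (Q n * s) < c (Q n * t).
  move=> hs ht lc.
  pose f s z := V (blk m b + blk n s.-1 + z).
  have fb s' z : 0 < s' < Q m %/ Q n -> z < h n -> f s' z = V z.
    move=> hs' lz; rewrite /f blk_mul //; last by lia.
    exact: limit_word_block.
  have inwin s' z : 0 < s' < Q m %/ Q n -> z <= h n + c (Q n * s') ->
      blk n s'.-1 + z < h m.
    move=> hs' lz; rewrite (bheight_blk q_gt1 c_mod nm).
    have : blk n s' <= blk n (Q m %/ Q n).-1 by rewrite leq_blkE //; lia.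
    case: s' hs' lz => // s' _ /= lz; rewrite blkS //.
    have := bheight_gt0 q c n; lia.
  have eqf z : z <= h n + c (Q n * s) -> f s z = f t z.
    elim/ltn_ind: z => z IH lz.
    case: (ltnP z (h n)) => lzh; first by rewrite !fb.
    have prev s' : 0 < s' < Q m %/ Q n -> z <= h n + c (Q n * s') -> f s' z = f s' (z - p).
      move=> hs' lz'; have := inwin s' z hs' lz' => lw.
      have := per (blk n s'.-1 + (z - p)); rewrite /f -!addnA subnK; last by lia.
      by move=> ->; lia.
    by rewrite !prev // ?IH //; lia.
  (* Just after the shorter spacer one run shows the zero that starts the next block, while the
     other is still inside its longer spacer. *)
  have := eqf (h n + c (Q n * s)) (leqnn _).
  have -> : f t (h n + c (Q n * s)).
    rewrite /f addnA blk_mul //; last by lia.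
    rewrite -addnA.
    rewrite addnA; apply: limit_word_spacer => //.
    by rewrite -addnS prednK ?E //; lia.
  rewrite /f blk_mul //; last by lia.
  have := blkS q_gt1 c_mod n (b * (Q m %/ Q n) + s.-1).
  rewrite -addnS prednK ?E //; last by lia.
  by rewrite -!addnA => <-; rewrite limit_word_blk.
move=> s t hs ht; have := main s t hs ht; have := main t s ht hs.
by case: ltngtP.
Qed.

(** Let n be the least stage from [n0] on with [p <= h n], so that [h n] is at most C p. A long
    factor of period p contains a whole copy of v_(n+m), and [periodic_stretch] then gives a
    forbidden run. *)
Lemma no_long_stretch_power_free : no_long_stretch q c ->
  exists2 K, 0 < K & power_free K V.
Proof.
move=> [n0 [m ns]]; pose C := M2 + h n0.
(* The first (n+m)-block after i starts within [h (n + m) + M] letters and ends [h (n + m)] later,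
   with [h (n + m)] at most [M2 ^ m * (C * p)]. In C, the summand [h n0] covers the case n = [n0]
   and [M2] the other ones. *)
exists (3 * M2 ^ m * C + M).
  by rewrite addn_gt0 M_gt0 orbT.
move=> p i p0.
have ex : exists n, (n0 <= n) && (p <= h n).
  exists (n0 + p); rewrite leq_addr /=; apply: leq_trans (ltnW (ltn_bheight q_gt1 c_mod _)).
  exact: leq_addl.
case: (ex_minnP ex) => n /andP[ln lp] mn.
have hC : h n <= C * p.
  case: (eqVneq n n0) => [->|ne].
    by rewrite /C mulnDl; have : h n0 <= h n0 * p by [rewrite leq_pmulr]; lia.
  have n1 : n0 <= n.-1 by lia.
  have : h n.-1 < p by rewrite ltnNge; apply/negP => l; have := mn n.-1; rewrite n1 l => /(_ isT); lia.
  have := bheightS_le n.-1; rewrite prednK; last by lia.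
  move=> l1 l2; apply: leq_trans l1 _; rewrite /C mulnDl.
  by apply: leq_trans (leq_addr _ _); rewrite leq_mul2l ltnW // orbT.
apply: contrapT => nex; apply: (ns n ln).
have per z : z < (3 * M2 ^ m * C + M) * p -> V (i + z) = V (i + z + p).
  by move=> lz; apply: contrapT => /eqP ne; apply: nex; exists z.
have [t l1 l2] := block_after (n + m) i.
have hnm := bheight_add_le n m.
apply: (@periodic_stretch n (n + m) p t) => //; last by rewrite leq_addr.
move=> z lz; have -> : blk (n + m) t + z = i + (blk (n + m) t - i + z) by lia.
apply: per; rewrite mulnDl -!mulnA.
have lM : M <= M * p by rewrite leq_pmulr.
have : h (n + m) <= M2 ^ m * (C * p) by apply: leq_trans hnm _; rewrite leq_mul2l hC orbT.
lia.
Qed.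

Variable K : nat.
Hypothesis K_gt0 : 0 < K.
Hypothesis pf : power_free K V.

Local Notation Y := (12 * K * M).

(* A small shift [d] is compared with blocks of height about [d/4]: were there
   few mismatches, some long run of such blocks would be copied exactly at a
   distance comparable to [d], which is a large power. *)
Lemma mism_shift : exists2 C, 0 < C & forall a d L : nat, 0 < d -> C * d <= L ->
  L <= C * mism L (wshift V a) (wshift V (a + d)).
Proof.
have Y0 : 0 < Y by rewrite !muln_gt0 K_gt0 M_gt0.
have M20 : 0 < M2 by rewrite muln_gt0 andbT; have := qM_gt1; lia.
have hS := bheightS_le; have hA := bheight_add_le.
move: hS hA M20; move: (qM * M.+1) => m2 hS hA m20.
(* Blocks of level n + r are more than r times as high as those of level n, hence longer than 2 K d
   as soon as d < 4 m2 [h n]. Shifts up to D0 are left to [power_free_mism]; beyond D0 the level n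
   chosen below satisfies [Y <= h n], as [sync] requires. *)
pose r := 8 * K * m2; pose D0 := 4 * m2 * Y.
have D00 : 0 < D0 by rewrite muln_gt0 Y0 muln_gt0 m20.
have Mr0 : 0 < m2 ^ r by rewrite expn_gt0 m20.
exists (6 * m2 ^ r * Y + 2 * K * D0); first by rewrite addn_gt0 !muln_gt0 Mr0 K_gt0 M_gt0.
move=> a d L d0 hL; set mm := mism _ _ _.
case: (leqP d D0) => hd.
  have sS : 0 < d <= D0 by rewrite d0.
  have := power_free_mism a L pf sS; rewrite -/mm => le.
  have KD0 : 0 < K * D0 by rewrite muln_gt0 K_gt0.
  have hKL : K * D0 <= L.
    apply: leq_trans hL; apply: (@leq_trans (2 * K * D0 * d)); last by rewrite leq_mul2r leq_addl orbT.
    have -> : 2 * K * D0 * d = K * D0 * (2 * d) by nia.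
    by rewrite leq_pmulr // muln_gt0.
  have l1 : 0 < L %/ (K * D0) by rewrite divn_gt0.
  have l2 := ltn_ceil L KD0.
  rewrite mulnDl; apply: leq_trans (leq_addl _ _).
  apply: (@leq_trans (2 * K * D0 * (L %/ (K * D0)))); last by rewrite leq_mul2l le orbT.
  by apply: leq_trans (ltnW l2) _; nia.
have ex : exists n, 4 * h n <= d.
  exists 0; rewrite bheight0 muln1; apply: leq_trans hd.
  by rewrite /D0 -mulnA; have : 0 < m2 * Y by [rewrite muln_gt0 m20 Y0]; lia.
have bnd n : 4 * h n <= d -> n <= d by have := ltn_bheight q_gt1 c_mod n; lia.
case: (ex_maxnP ex bnd) => n ln mn.
have ld : d < 4 * m2 * h n.
  have : d < 4 * h n.+1 by rewrite ltnNge; apply/negP => /mn; rewrite ltnn.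
  by have := hS n; rewrite -mulnA; lia.
have hY : Y <= h n.
  have : 4 * m2 * Y <= 4 * m2 * h n by apply: ltnW; apply: ltn_trans hd ld.
  by rewrite leq_pmul2l // muln_gt0.
pose N := n + r; have nN : n <= N by exact: leq_addr.
have hN1 : 8 * K * m2 * h n <= h N.
  apply: leq_trans (leq_bheight_add q_gt1 c_mod n r); rewrite mulnC leq_mul2l.
  by rewrite (ltnW (ltn_expl _ _)) ?orbT.
have hN2 : h N <= m2 ^ r * h n := hA n r.
have hMN : M <= h N.
  apply: leq_trans (leq_bheight c q_gt1 nN); apply: leq_trans hY.
  by rewrite leq_pmull // muln_gt0.
have Lbig : 4 * h N <= L.
  apply: leq_trans hL; rewrite mulnDl; apply: leq_trans (leq_addr _ _).
  apply: (@leq_trans (4 * (m2 ^ r * h n))); first by rewrite leq_mul2l hN2.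
  rewrite mulnCA; apply: (@leq_trans (m2 ^ r * d)); first by rewrite leq_mul2l ln orbT.
  have -> : 6 * m2 ^ r * Y = m2 ^ r * (6 * Y) by nia.
  by rewrite leq_mul2r leq_pmulr ?orbT // muln_gt0 Y0.
have [t0 l1 l2] := block_after N a.
pose k := (L %/ (2 * h N)).-1; pose b i := blk N (t0 + i).
have bk i : b i <= b 0 + i * (2 * h N).
  elim: i => [|i IH]; first by rewrite mul0n addn0.
  by rewrite /b addnS blkS //; have := c_le (Q N * (t0 + i).+1); move: IH; rewrite /b mulSn; lia.
have hN0 := bheight_gt0 q c N.
have hk1 : 0 < L %/ (2 * h N) by rewrite divn_gt0; lia.
have hk2 : k.+1 * (2 * h N) <= L by rewrite prednK // leq_trunc_div.
have hk3 : L < k.+2 * (2 * h N) by rewrite /k prednK // ltn_ceil //; lia.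
have k0 : 0 < k by rewrite /k -subn1 subn_gt0 leq_divRL; lia.
pose x := (h n %/ Y).+1.
have lx : h n <= x * Y by apply: ltnW; apply: ltn_ceil.
suff blocks i : i < k -> x <= mism (b i.+1 - b i) (wshift V (b i)) (wshift (wshift V d) (b i)).
  have bS i : i < k -> b i <= b i.+1 by rewrite /b leq_blkE // leq_add2l.
  have [_ le] := mism_blocks bS blocks.
  have le2 : k * x <= mm.
    apply: leq_trans le _; have := @mism_sub L (b 0 - a) (b k - b 0) (wshift V a) (wshift V (a + d)).
    have := bk k; rewrite {1 2}/b addn0 => lbk.
    have l3 : b 0 <= b k by rewrite /b leq_blkE //; lia.
    have -> : b 0 - a + (b k - b 0) <= L.
      by move: lbk l3 hk2; rewrite /b addn0 mulSn; lia.
    move/(_ isT).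
    apply: leq_trans; apply: eq_leq; apply: eq_mism => z _; rewrite /wshift; congr V.
      by rewrite /b addn0; move: l1; clear; lia.
    by rewrite /b addn0; move: l1; clear; lia.
  rewrite mulnDl; apply: leq_trans (leq_addr _ _).
  apply: (@leq_trans (6 * m2 ^ r * Y * (k * x))); last by rewrite leq_mul2l le2 orbT.
  apply: leq_trans (ltnW hk3) _.
  apply: (@leq_trans (6 * k * h N)); first by nia.
  apply: (@leq_trans (6 * k * (m2 ^ r * (x * Y)))).
    by rewrite leq_mul2l (leq_trans hN2) ?orbT // leq_mul2l lx orbT.
  by apply: eq_leq; rewrite -!mulnA; congr (6 * _); nia.
(* If this N-block had few mismatches, [sync] would copy it exactly to a place within [h n] <= d / 4
   of its shift by d. The distance to that copy is positive and at most 2 d, so K times the distance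
   fits into the block, against the absence of powers. *)
move=> li; rewrite /x ltnNge; apply/negP => few.
pose w := (t0 + i) * (Q N %/ Q n).
have bw t : t < Q N %/ Q n -> blk n (w + t) = b i + blk n t by move=> lt; rewrite -blk_mul.
have kk0 : 0 < Q N %/ Q n by exact: Qn_div_gt0.
have bw0 : blk n w = b i by have := bw 0 kk0; rewrite addn0 blk0 addn0.
have hm t : t <= (Q N %/ Q n).-1 ->
    mism (h n) (wshift V (b i + d + blk n (w + t) - blk n w)) V <= h n %/ Y.
  move=> lt; have lt' : t < Q N %/ Q n by lia.
  apply: leq_trans few; rewrite mismC bw // bw0.
  have sub : blk n t + h n <= b i.+1 - b i.
    rewrite /b addnS blkS // (bheight_blk q_gt1 c_mod nN).
    have : blk n t <= blk n (Q N %/ Q n).-1 by rewrite leq_blkE //; lia.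
    lia.
  apply: leq_trans (mism_sub _ _ sub); apply: eq_leq; apply: eq_mism => z lz; rewrite /wshift.
    by rewrite addnA -bw // limit_word_block.
  by congr V; move: d0; clear; lia.
have [u [l3 l4]] := sync q_gt1 c_mod c_le M_gt0 K_gt0 pf hY hm.
rewrite prednK // [Q n * (_ %/ _)]mulnC divnK ?dvdn_Qn // => ag.
have Ve z : z < h N -> V (b i + z) = V (blk n u + z).
  move=> lz; rewrite -bw0; apply: (limit_word_agree ag); rewrite -/(blk n w) bw0.
  have -> : Q n * w = Q N * (t0 + i) by rewrite /w mulnCA [Q n * (_ %/ _)]mulnC divnK ?dvdn_Qn // mulnC.
  by rewrite tau_block ?prednK ?Qn_gt0 // leq_add2l.
apply: (@power_free_shift c K pf (b i) (blk n u - b i) (h N)); first by lia.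
  apply: leq_trans hN1; apply: (@leq_trans (K * (2 * d))); first by rewrite leq_mul2l; lia.
  have -> : 8 * K * m2 * h n = K * (2 * (4 * m2 * h n)) by clear; nia.
  by rewrite !leq_mul2l (ltnW ld) !orbT.
by move=> z lz; rewrite Ve //; congr V; move: l3 l4 ln d0; clear; lia.
Qed.

End BoundedPowers.

(** * Canonical words as moduli *)

Section Toeplitz.

Variable c : nat -> nat.

Definition toeplitz d := forall i, ~~ (d %| i) -> c i = c (i %% d).

(* [canonical_word] for the prefix of [V] with [d] zeros. *)
Definition canonical_index d := [/\ 0 < d, toeplitz d & ~ exists g l,
  [/\ [/\ 0 < g, toeplitz g & g %| d], g < d, toeplitz l, d %| l /\ d < l &
    simple_stretch c g l]].

Lemma toeplitz_mod d i j : toeplitz d -> ~~ (d %| i) -> i = j %[mod d] -> c i = c j.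
Proof.
move=> td nd e; rewrite (td i) // (td j) ?e //.
by move: nd; rewrite /dvdn e.
Qed.

(** By Bezout, a step by g is a multiple of d minus a multiple of e. Indices off the multiples of g
    are divisible by neither d nor e, so c does not change along either part of the step. *)
Lemma toeplitz_gcd d e : 0 < d -> toeplitz d -> toeplitz e -> toeplitz (gcdn d e).
Proof.
move=> d0 td te; set g := gcdn d e.
have step i : ~~ (g %| i) -> c (i + g) = c i.
  move=> ni; have nd : ~~ (d %| i) by apply: contra ni; apply: dvdn_trans; apply: dvdn_gcdl.
  have ne : ~~ (e %| i + g).
    by apply: contra ni => h; rewrite -(@dvdn_addl g _ i) // (dvdn_trans (dvdn_gcdr d e)).
  case: (egcdnP e d0) => km kn ek _.
  rewrite (@toeplitz_mod e (i + g) (i + km * d)) //; last first.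
    by rewrite ek addnCA modnMDl.
  by rewrite -(@toeplitz_mod d i) // addnC modnMDl.
move=> i ni; rewrite {1}(divn_eq i g); elim: (i %/ g) => [|k IH]; first by rewrite mul0n.
by rewrite mulSn -addnA addnC step // dvdn_addr ?dvdn_mull // /dvdn modn_mod.
Qed.

Lemma toeplitz_lcm d e : toeplitz d -> toeplitz e -> toeplitz (lcmn d e).
Proof.
move=> td te i; rewrite dvdn_lcm negb_and => /orP [nd|ne].
  by apply: (toeplitz_mod td nd); rewrite modn_dvdm // dvdn_lcml.
by apply: (toeplitz_mod te ne); rewrite modn_dvdm // dvdn_lcmr.
Qed.

(* By the Chinese remainder theorem any index avoiding one of the two moduli can
   be moved to [g] by changing its two residues in turn. *)
Lemma toeplitz_pair_const g x y s : 0 < g -> coprime x y -> 1 < x -> 1 < y ->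
  toeplitz (g * x) -> toeplitz (g * y) -> ~~ (x * y %| s) -> c (g * s) = c g.
Proof.
have half x' y' s' : 0 < g -> coprime x' y' -> 1 < y' ->
    toeplitz (g * x') -> toeplitz (g * y') -> ~~ (x' %| s') -> c (g * s') = c g.
  move=> g0 co y1 tx ty ns; pose u := chinese x' y' s' 1.
  rewrite (@toeplitz_mod _ (g * s') (g * u) tx) ?dvdn_pmul2l //; last first.
    by rewrite -!muln_modr chinese_modl.
  rewrite -{2}[g]muln1; apply: (toeplitz_mod ty); last by rewrite -!muln_modr chinese_modr.
  by rewrite dvdn_pmul2l // /dvdn chinese_modr // modn_small.
move=> g0 co x1 y1 tx ty; rewrite Gauss_dvd // negb_and => /orP [] ns.
  exact: (half x y).
by apply: (half y x); rewrite // coprime_sym.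
Qed.

(** Division by the gcd makes the moduli coprime, and incomparability makes both quotients exceed 1,
    as [toeplitz_pair_const] requires. *)
Lemma toeplitz_straddle d e s : 0 < d -> 0 < e -> toeplitz d -> toeplitz e ->
  ~~ (d %| e) -> ~~ (e %| d) -> ~~ (lcmn d e %| gcdn d e * s) ->
  c (gcdn d e * s) = c (gcdn d e).
Proof.
move=> d0 e0 td te nde ned; set g := gcdn d e.
have g0 : 0 < g by rewrite gcdn_gt0 d0.
have dg : g %| d by apply: dvdn_gcdl.
have eg : g %| e by apply: dvdn_gcdr.
have Ed : g * (d %/ g) = d by rewrite mulnC divnK.
have Ee : g * (e %/ g) = e by rewrite mulnC divnK.
have co : coprime (d %/ g) (e %/ g).
  rewrite /coprime -(eqn_pmul2l g0) muln_gcdr Ed Ee muln1 //.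
have x1 : 1 < d %/ g.
  rewrite ltn_neqAle eq_sym divn_gt0 // dvdn_leq // andbT.
  by apply: contra nde => /eqP E; rewrite -Ed E muln1.
have y1 : 1 < e %/ g.
  rewrite ltn_neqAle eq_sym divn_gt0 // dvdn_leq // andbT.
  by apply: contra ned => /eqP E; rewrite -Ee E muln1.
move=> ns; apply: (toeplitz_pair_const g0 co x1 y1); rewrite ?Ed ?Ee //.
apply: contra ns => h.
have -> : lcmn d e = g * lcmn (d %/ g) (e %/ g) by rewrite muln_lcmr Ed Ee.
rewrite dvdn_pmul2l //; apply: dvdn_trans h.
by rewrite dvdn_lcm dvdn_mulr // dvdn_mull.
Qed.

Lemma canonical_index_comparable d e : canonical_index d -> 0 < e -> toeplitz e ->
  (d %| e) \/ (e %| d).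
Proof.
move=> [d0 td nc] e0 te.
case: (boolP (d %| e)) => nde; first by left.
case: (boolP (e %| d)) => ned; first by right.
have g0 : 0 < gcdn d e by rewrite gcdn_gt0 d0.
exfalso; apply: nc; exists (gcdn d e), (lcmn d e).
have dg := dvdn_gcdl d e; have dl := dvdn_lcml d e.
have l0 : 0 < lcmn d e by rewrite lcmn_gt0 d0.
split; [split=> // |  | exact: toeplitz_lcm | split=> // | ].
- exact: toeplitz_gcd.
- rewrite ltn_neqAle dvdn_leq // andbT; apply: contra nde => /eqP <-; exact: dvdn_gcdr.
- rewrite ltn_neqAle dvdn_leq // andbT; apply: contra ned => /eqP ->; exact: dvdn_lcmr.
have key t : 0 < t < lcmn d e %/ gcdn d e -> c (gcdn d e * t) = c (gcdn d e).
  move=> /andP[t0 lt]; apply: toeplitz_straddle => //.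
  rewrite gtnNdvd ?muln_gt0 ?g0 // mulnC -ltn_divRL //.
  exact: dvdn_trans dl.
by move=> s t hs ht; rewrite !key.
Qed.

Lemma simple_stretchP g l s : simple_stretch c g l -> 0 < g -> 0 < s -> g * s < l ->
  g %| l -> c (g * s) = c g.
Proof.
move=> st g0 s0 lt d; rewrite -{2}[g]muln1; apply: st; rewrite ltn_divRL //.
  by rewrite s0 mulnC.
by rewrite mul1n andTb (leq_ltn_trans _ lt) // leq_pmulr.
Qed.

(** Let h be the gcd. Below l, unless g divides g', an index h s outside the common multiples of g
    and g' has value [c h] by [toeplitz_straddle]; a common multiple can be lowered by g along the
    first stretch, after which g' no longer divides it. Beyond l, multiples of g' follow the second
    stretch, and the other indices reduce modulo g' to the first case because g' < l. This is what
    forces a maximal stretch to end at a canonical index. *)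
Lemma merge_stretches g l g' l' : 0 < g -> 0 < g' ->
  toeplitz g -> toeplitz g' -> g %| l -> simple_stretch c g l ->
  ~~ (g' %| g) -> g' %| l -> g' < l -> l %| l' -> simple_stretch c g' l' ->
  simple_stretch c (gcdn g g') l'.
Proof.
move=> g0 g0' tg tg' dgl st ngg dgl' lgl dll st'; set h := gcdn g g'.
have h0 : 0 < h by rewrite gcdn_gt0 g0.
have hg : h %| g := dvdn_gcdl g g'; have hg' : h %| g' := dvdn_gcdr g g'.
have low s : 0 < s -> h * s < l -> c (h * s) = c h.
  move=> s0 ls; case: (boolP (g %| g')) => dg.
    have E : h = g by apply/gcdn_idPl.
    by rewrite E in ls *; apply: simple_stretchP st _ _ _ _.
  case: (boolP (lcmn g g' %| h * s)) => ds; last exact: toeplitz_straddle.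
  have dg1 : g %| h * s by apply: dvdn_trans ds; apply: dvdn_lcml.
  have dg2 : g' %| h * s by apply: dvdn_trans ds; apply: dvdn_lcmr.
  have lt : g < h * s.
    rewrite ltn_neqAle dvdn_leq ?muln_gt0 ?h0 // andbT.
    by apply: contra ngg => /eqP ->.
  have E : h * (s - g %/ h) = h * s - g by rewrite mulnBr [h * (_ %/ _)]mulnC divnK.
  have nd : ~~ (lcmn g g' %| h * (s - g %/ h)).
    rewrite E; apply: contra ngg => d; have := dvdn_trans (dvdn_lcmr g g') d.
    by rewrite dvdn_subr // ltnW.
  rewrite -(toeplitz_straddle g0 g0' tg tg' dg ngg nd) -/h E.
  case/dvdnP: dg1 => k Ek; rewrite Ek -[X in _ - X]mul1n -mulnBl.
  have k1 : 1 < k by move: lt; rewrite Ek -{1}[g]mul1n ltn_pmul2r.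
  have lk : g * k < l by rewrite mulnC -Ek.
  rewrite [k * g]mulnC [_ * g]mulnC (@simple_stretchP g l k) //; last by lia.
  rewrite (@simple_stretchP g l (k - 1)) //; first by rewrite subn_gt0.
  by apply: leq_ltn_trans lk; rewrite leq_mul2l leq_subr orbT.
have y0 : 0 < g' %/ h by rewrite divn_gt0 // dvdn_leq.
have key s : 0 < s < l' %/ h -> c (h * s) = c h.
  move=> /andP[s0]; rewrite ltn_divRL; last by apply: dvdn_trans dll; exact: dvdn_trans dgl'.
  rewrite mulnC => ls; case: (boolP (g' %| h * s)) => d.
    case/dvdnP: d => k Ek; rewrite Ek mulnC.
    have k0 : 0 < k by case: k Ek => //; have := muln_gt0 h s; rewrite h0 s0 mul0n; case: (h * s).
    rewrite (@simple_stretchP g' l' k) //; last exact: dvdn_trans dll.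
      by rewrite -(divnK hg') mulnC; apply: low => //; rewrite mulnC divnK.
    by rewrite mulnC -Ek.
  have E : (h * s) %% g' = h * (s %% (g' %/ h)).
    by rewrite muln_modr [h * (_ %/ _)]mulnC divnK.
  rewrite tg' // E; apply: low.
    by rewrite lt0n; apply: contra d => /eqP E'; rewrite /dvdn E E' muln0.
  by rewrite -E (leq_trans _ (ltnW lgl)) // ltn_mod.
by move=> s t hs ht; rewrite !key.
Qed.

Variables (q : nat -> nat) (qM : nat).
Hypothesis q_gt1 : cutting q.
Hypothesis q_le : forall n, q n <= qM.
Hypothesis Qn_toeplitz : forall n, toeplitz (Qn q n).

Local Notation Q := (Qn q).

Lemma Qn_add_le n m : Q (n + m) <= qM ^ m * Q n.
Proof.
elim: m => [|m IH]; first by rewrite addn0 mul1n.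
by rewrite addnS QnS expnS mulnC -mulnA leq_mul.
Qed.

Lemma Qn_just_above n0 x : 0 < x ->
  exists n, [/\ n0 <= n, x < Q n & Q n <= (2 * qM + Q n0) * x].
Proof.
move=> x0; have ex : exists n, (n0 <= n) && (x < Q n).
  exists (n0 + x); rewrite leq_addr /=; apply: leq_ltn_trans (ltn_Qn q_gt1 _).
  exact: leq_addl.
case: (ex_minnP ex) => n /andP[ln lx] mn; exists n; split=> //.
rewrite mulnDl; case: (eqVneq n n0) => [->|ne].
  by apply: leq_trans (leq_addl _ _); rewrite leq_pmulr.
apply: leq_trans (leq_addr _ _).
have n1 : n0 <= n.-1 by lia.
have l : Q n.-1 <= x.
  by rewrite leqNgt; apply/negP => l; have := mn n.-1; rewrite n1 l => /(_ isT); lia.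
have E : n = n.-1.+1 by lia.
rewrite E QnS [2 * _ * _]mulnAC mulnC; apply: (@leq_trans (qM * x)).
  exact: leq_mul.
by rewrite mulnC leq_mul2r leq_pmull ?orbT.
Qed.

Hypothesis ns : no_long_stretch q c.

(** The hypothesis concerns the given moduli only. Let [Q n] be just above g. If the stretch from g
    reached beyond [Q (n + m)], subtracting g would not change c at the multiples of [Q n]; the
    indices so obtained are congruent to -g modulo [Q n], so c would be constant on these multiples,
    which is a forbidden stretch. *)
Lemma stretch_ratio : exists C, forall g l, 0 < g -> toeplitz g -> g %| l ->
  simple_stretch c g l -> l <= C * g.
Proof.
case: ns => n0 [m nst]; exists (qM ^ m * (2 * qM + Q n0)) => g l g0 tg dgl st.
have [n [ln lg hn]] := Qn_just_above n0 g0.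
apply: (@leq_trans (Q (n + m))); last first.
  by apply: leq_trans (Qn_add_le _ _) _; rewrite -mulnA leq_mul2l hn orbT.
rewrite leqNgt; apply/negP => ll; apply: (nst n ln).
have dQ : Q n %| Q (n + m) by apply: dvdn_Qn; apply: leq_addr.
have key s : 0 < s < Q (n + m) %/ Q n -> c (Q n * s) = c (Q n - g).
  move=> /andP[s0]; rewrite ltn_divRL // mulnC => ls.
  have lx : g < Q n * s by apply: leq_trans lg _; rewrite leq_pmulr.
  have E : c (Q n * s) = c (Q n * s - g).
    case: (boolP (g %| Q n * s)) => [/dvdnP [k Ek]|nd].
      rewrite Ek -[X in _ - X]mul1n -mulnBl; rewrite Ek in ls lx.
      have k1 : 1 < k by move: lx; rewrite -{1}[g]mul1n ltn_pmul2r.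
      have lk : g * k < l by rewrite mulnC; apply: ltn_trans ls ll.
      rewrite [k * g]mulnC [_ * g]mulnC (@simple_stretchP g l k) //; last by lia.
      rewrite (@simple_stretchP g l (k - 1)) //; first by rewrite subn_gt0.
      by apply: leq_ltn_trans lk; rewrite leq_mul2l leq_subr orbT.
    by apply: (toeplitz_mod tg nd); rewrite -{1}(subnK (ltnW lx)) modnDr.
  rewrite E; apply: (toeplitz_mod (@Qn_toeplitz n)).
    by rewrite dvdn_subr ?dvdn_mulr 1?ltnW // gtnNdvd.
  rewrite -(prednK s0) mulnS addnC -addnBA 1?ltnW //.
  by rewrite mulnC modnMDl.
by move=> s t hs ht; rewrite !key.
Qed.

(** If d is not canonical, take the largest end l of a stretch from a proper divisor of d to a
    proper multiple of d; [stretch_ratio] bounds l. A stretch showing that l is not canonical would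
    yield, directly or after merging, a stretch of the same kind ending beyond l. *)
Lemma canonical_index_near : exists C, forall d, 0 < d -> toeplitz d ->
  exists d', [/\ canonical_index d', d <= d' & d' <= C * d].
Proof.
have [C hC] := stretch_ratio; exists C.+1 => d d0 td.
case: (pselect (canonical_index d)) => [cd|ncd].
  by exists d; split=> //; rewrite leq_pmull.
pose P l := [/\ toeplitz l, d %| l, d < l &
  exists g, [/\ [/\ 0 < g, toeplitz g & g %| d], g < d & simple_stretch c g l]].
have ex : exists l, `[< P l >].
  apply: contrapT => nex; apply: ncd; split=> // -[g [l [hg lg tl [dl ll] st]]].
  by apply: nex; exists l; apply/asboolP; split=> //; exists g.
have bd l : `[< P l >] -> l <= C * d.
  move=> /asboolP [tl dl ll [g [[g0 tg dg] lg st]]].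
  apply: leq_trans (hC g l g0 tg (dvdn_trans dg dl) st) _.
  by rewrite leq_mul2l ltnW ?orbT.
case: (ex_maxnP ex bd) => l Pl ml; have lb := bd l Pl.
move/asboolP: Pl => [tl dl ll [g [[g0 tg dg] lg st]]].
exists l; split; [split=> // | exact: ltnW | by rewrite mulSn; lia]; first by lia.
move=> [g' [l' [[g0' tg' dg'] lg' tl' [dl' ll'] st']]].
have dd : d %| l' := dvdn_trans dl dl'.
suff H h : 0 < h -> toeplitz h -> h %| g -> simple_stretch c h l' -> False.
  case: (boolP (g' %| g)) => dgg; first exact: (H g').
  have hd : gcdn g g' %| g by apply: dvdn_gcdl.
  apply: (H (gcdn g g')) => //.
  - by rewrite gcdn_gt0 g0.
  - exact: toeplitz_gcd.
  - by apply: (@merge_stretches g l g' l') => //; apply: dvdn_trans dl.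
move=> h0 th hg sh; have : `[< P l' >].
  apply/asboolP; split=> //; first exact: ltn_trans ll'.
  exists h; split=> //; first by split=> //; exact: dvdn_trans dg.
  by apply: leq_ltn_trans lg; apply: dvdn_leq.
by move/ml; lia.
Qed.

(** The next canonical index after x costs two bounded factors: [Qn_just_above] reaches a modulus
    above x, and [canonical_index_near] a canonical index from there. *)
Lemma canonical_index_enum : exists e : nat -> nat, [/\ e 0 = 1,
  forall n, canonical_index (e n), forall n, e n < e n.+1,
  forall d, canonical_index d -> exists n, e n = d &
  exists C, forall n, e n.+1 <= C * e n].
Proof.
have [C hC] := canonical_index_near.
pose C' := C * (2 * qM + Q 0).
have next x : exists y, 0 < x ->
    [/\ canonical_index y, x < y, y <= C' * x &
      forall z, canonical_index z -> x < z -> y <= z].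
  case: (posnP x) => [->|x0]; first by exists 0.
  have [n [_ lx hn]] := Qn_just_above 0 x0.
  have [d [cd l1 l2]] := hC _ (Qn_gt0 q_gt1 n) (@Qn_toeplitz n).
  have ex : exists y, `[< canonical_index y >] && (x < y).
    by exists d; rewrite (leq_trans lx l1) andbT; apply/asboolP.
  case: (ex_minnP ex) => y /andP[/asboolP cy lxy] my; exists y => _; split=> //.
    apply: (@leq_trans d).
      by apply: my; rewrite (leq_trans lx l1) andbT; apply/asboolP.
    by apply: leq_trans l2 _; rewrite /C' -mulnA leq_mul2l hn orbT.
  by move=> z cz lz; apply: my; rewrite lz andbT; apply/asboolP.
have [f hf] := choice next.
have can1 : canonical_index 1.
  split=> // [i|[g [l [[g0 _ _] lg _ _ _]]]]; [by rewrite dvd1n | by lia].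
have e0 n : 0 < iter n f 1 /\ canonical_index (iter n f 1).
  by elim: n => [|n [l IH]] //=; have [cy _ _ _] := hf _ l; split=> //; case: cy.
have inc n : iter n f 1 < iter n.+1 f 1 by have [] := hf _ (e0 n).1.
exists (fun n => iter n f 1); split=> //.
- by move=> n; have [] := e0 n.
- move=> d cd; have d0 : 0 < d by case: cd.
  have ge n : n < iter n f 1 by elim: n => [|n IH] //; exact: leq_ltn_trans IH (inc n).
  have ex : exists n, d <= iter n f 1 by exists d; exact: ltnW.
  case: (ex_minnP ex) => -[|n] ln mn.
    by exists 0; apply/eqP; rewrite eqn_leq ln d0.
  exists n.+1; apply/eqP; rewrite eqn_leq ln andbT.
  have [_ _ _ hm] := hf _ (e0 n).1; apply: hm => //.
  by rewrite ltnNge; apply/negP => /mn; rewrite ltnn.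
- by exists C' => n; have [] := hf _ (e0 n).1.
Qed.

End Toeplitz.

(** A word of F is encoded by the list of its runs of ones between consecutive zeros. If v has list
    s, the word built from v with spacers r has list [separated s r]. *)
Definition separated (s r : seq nat) := s ++ flatten [seq k :: s | k <- r].

Lemma concat_cat v s k r : concat v (s ++ k :: r) = concat v s ++ nseq k true ++ concat v r.
Proof. by rewrite /concat map_cat flatten_cat /= -!catA. Qed.

Lemma concat_cons v k r : concat v (k :: r) = v ++ nseq k true ++ concat v r.
Proof. by rewrite /concat /= -catA. Qed.

Lemma inF_concat v r : inF v -> inF (concat v r).
Proof.
case: v => // b v /andP[hb lv]; apply/andP; split=> //.
elim/last_ind: r => [|r x _]; first by rewrite /concat /= cats0.
by rewrite -cats1 concat_cat /concat /= cats0 !last_cat.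
Qed.

Lemma concat_separated s r : concat (concat [:: false] s) r = concat [:: false] (separated s r).
Proof.
rewrite /separated; elim: r s => [|k r IH] s; first by rewrite /= cats0 {1}/concat /= cats0.
have -> : s ++ flatten [seq k0 :: s | k0 <- k :: r] = s ++ k :: separated s r by [].
by rewrite concat_cat concat_cons /separated -IH.
Qed.

Lemma size_separated s r : (size (separated s r)).+1 = (size s).+1 * (size r).+1.
Proof.
rewrite /separated size_cat; elim: r => [|k r IH] /=; first by lia.
by rewrite size_cat mulnS -IH; lia.
Qed.

Lemma concat_false_inj : injective (concat [:: false]).
Proof.
move=> s s'; rewrite /concat /= => -[]; elim: s s' => [|k s IH] [|k' s'] //=.
- by case: k'.
- by case: k.
rewrite -!catA !cat1s => e; suff [-> e'] : k = k' /\
    flatten [seq nseq k true ++ [:: false] | k <- s] =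
    flatten [seq nseq k true ++ [:: false] | k <- s'] by rewrite (IH _ e').
elim: k k' e => [|k IHk] [|k'] //= []; first by move=> ->.
by move/IHk => [-> ->].
Qed.

Lemma separated_inj s r r' : size r = size r' -> separated s r = separated s r' -> r = r'.
Proof.
move=> + /eqP; rewrite /separated eqseq_cat // eqxx /= => + /eqP.
elim: r r' => [|k r IH] [|k' r'] //= [sz] [-> /eqP].
by rewrite eqseq_cat // eqxx /= => /eqP /(IH _ sz) ->.
Qed.

Lemma count_false_concat v r :
  count negb (concat v r) = count negb v * (size r).+1.
Proof.
rewrite /concat count_cat mulnS; congr (_ + _).
elim: r => [|k r IH] /=; first by rewrite muln0.
by rewrite !count_cat count_nseq /= mul0n add0n IH mulnS.
Qed.

Lemma mkseq_cat (T : Type) (f : nat -> T) m k :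
  mkseq f (m + k) = mkseq f m ++ mkseq (fun i => f (m + i)) k.
Proof. by rewrite /mkseq iotaD map_cat -[in iota (0 + m) k](addn0 m) add0n iotaDl -map_comp. Qed.

(** * Dictionary between prefixes of the limit word and moduli *)

Section IndexWords.

Variable c : nat -> nat.

Local Notation V := (limit_word c).

(** For d > 0 this is the prefix of V with d zeros. The predecessor is truncated at d = 0, which is
    why the lemmas speak of [m.+1]. *)
Definition index_word d := concat [:: false] (mkseq (fun i => c i.+1) d.-1).

Lemma index_word_prefix m : index_word m.+1 = mkseq V (tau c m).+1.
Proof.
rewrite /index_word /=; elim: m => [|m IH].
  by rewrite tau0 /= {1}/concat /= /mkseq /= -{1}(tau0 c) limit_word_tau.
rewrite mkseqS -cats1 concat_cat IH tauS addnS -addnS -addSn.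
rewrite mkseq_cat; congr (_ ++ _).
rewrite -[(c m.+1).+1]addn1 mkseq_cat; congr (_ ++ _); last first.
  by rewrite /mkseq /= {1}/concat /= addn0 addSn -addnS -tauS limit_word_tau.
apply: (@eq_from_nth _ true) => [|i]; first by rewrite size_mkseq size_nseq.
rewrite size_nseq => li; rewrite nth_nseq li nth_mkseq //.
by apply/esym; apply: (@limit_word_gap c m); rewrite tauS; lia.
Qed.

Lemma size_index_word m : size (index_word m.+1) = (tau c m).+1.
Proof. by rewrite index_word_prefix size_mkseq. Qed.

Lemma initial_index_word m : initial_segment (index_word m.+1) V.
Proof. by rewrite /initial_segment size_index_word index_word_prefix. Qed.

Lemma inF_index_word m : inF (index_word m.+1).
Proof.
rewrite /inF index_word_prefix -{2}addn1 mkseq_cat /= last_cat /mkseq /= addn0.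
by rewrite -{1}(tau0 c) !limit_word_tau.
Qed.

Lemma inF_initial u : inF u -> initial_segment u V -> exists m, u = index_word m.+1.
Proof.
move=> /andP[hu lu] iu; case es: (size u) => [|n]; first by rewrite (size0nil es) in hu.
rewrite /initial_segment es in iu.
have lv : ~~ V n by move: lu; rewrite iu -addn1 mkseq_cat last_cat /mkseq /= addn0.
by have /limit_wordP [m em] := lv; exists m; rewrite index_word_prefix -em.
Qed.

Lemma count_index_word m : count negb (index_word m.+1) = m.+1.
Proof. by rewrite /index_word count_false_concat mul1n size_mkseq. Qed.

Lemma mkseq_separated d k : toeplitz c d.+1 ->
  mkseq (fun i => c i.+1) (d.+1 * k.+1).-1 =
  separated (mkseq (fun i => c i.+1) d) (mkseq (fun i => c (d.+1 * i.+1)) k).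
Proof.
move=> td; rewrite /separated; elim: k => [|k IH]; first by rewrite muln1 /= cats0.
rewrite mkseqS map_rcons flatten_rcons catA -IH.
have -> : (d.+1 * k.+2).-1 = (d.+1 * k.+1).-1 + d.+1 by have : 0 < d.+1 * k.+1 by []; rewrite [_ * k.+2]mulnS; lia.
rewrite mkseq_cat; congr (_ ++ _).
have E i : ((d.+1 * k.+1).-1 + i).+1 = d.+1 * k.+1 + i by rewrite -addSn prednK.
rewrite -[d.+1 in LHS]add1n mkseq_cat /= E addn0; congr cons.
apply/eq_in_map => i; rewrite mem_iota => /= li.
have nd : ~~ (d.+1 %| d.+1 * k.+1 + i.+1) by rewrite dvdn_addr ?dvdn_mulr // gtnNdvd.
by rewrite E add1n td // mulnC modnMDl modn_small.
Qed.

Lemma concat_index_word d k : toeplitz c d.+1 ->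
  concat (index_word d.+1) (mkseq (fun i => c (d.+1 * i.+1)) k) = index_word (d.+1 * k.+1).
Proof. by move=> td; rewrite /index_word concat_separated mkseq_separated. Qed.

Lemma separated_toeplitz d m r :
  mkseq (fun i => c i.+1) m = separated (mkseq (fun i => c i.+1) d) r ->
  forall k i, k <= size r -> 0 < i <= d -> c (d.+1 * k + i) = c i.
Proof.
elim/last_ind: r m => [|r x IH] m e k i.
  by rewrite leqn0 => /eqP ->; rewrite muln0.
have sz : m.+1 = d.+1 * (size r).+2.
  by have := congr1 size e; rewrite size_mkseq => ->; rewrite size_separated size_mkseq size_rcons.
have Em : m = (d.+1 * (size r).+1).-1 + d.+1 by have : 0 < d.+1 * (size r).+1 by []; move: sz; rewrite [_ * _.+2]mulnS; lia.
move: e; rewrite {1}Em mkseq_cat {1}/separated map_rcons flatten_rcons catA => /eqP.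
rewrite eqseq_cat; last first.
  rewrite size_mkseq -[_ ++ flatten _]/(separated _ r) -[size (separated _ _)]/(_.+1.-1).
  by rewrite size_separated size_mkseq.
move=> /andP[/eqP e1 /eqP e2]; rewrite size_rcons leq_eqVlt ltnS => /predU1P [->|lk] hi.
  have := congr1 (fun s => nth 0 s i) e2.
  rewrite nth_mkseq; last by lia.
  have -> : nth 0 (x :: mkseq (fun i0 => c i0.+1) d) i = c i.
    by case: i hi => // i hi /=; rewrite nth_mkseq.
  by move=> <-; congr c; lia.
exact: IH e1 _ _ lk hi.
Qed.

(** A truncation of the factorization is a prefix of V in F, hence itself an index word. Cutting
    after i / (m + 1) spacers is enough to compare the spacer lists at index i. *)
Lemma built_infP m : built_inf (index_word m.+1) V <-> toeplitz c m.+1.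
Proof.
split=> [[f hf] i nd|tm]; last first.
  exists (fun i => c (m.+1 * i.+1)) => n; rewrite concat_index_word //.
  by rewrite mulnS addSn; apply: initial_index_word.
have := hf (i %/ m.+1); set w := concat _ _ => iw.
have inw : inF w by apply/inF_concat/inF_index_word.
have [n en] := inF_initial inw iw.
have := separated_toeplitz (d := m) (m := n) (r := mkseq f (i %/ m.+1)).
have -> : mkseq (fun i => c i.+1) n = separated (mkseq (fun i => c i.+1) m) (mkseq f (i %/ m.+1)).
  by apply: concat_false_inj; rewrite -concat_separated -[LHS]/(index_word n.+1) -en.
move=> /(_ erefl (i %/ m.+1) (i %% m.+1)); rewrite size_mkseq leqnn => H.
rewrite {1}(divn_eq i m.+1) mulnC H // lt0n -ltnS ltn_mod /= andbT.
exact: nd.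
Qed.

Lemma inF_built_inf u : inF u -> built_inf u V ->
  exists2 m, u = index_word m.+1 & toeplitz c m.+1.
Proof.
move=> iu bu; have iv : initial_segment u V.
  by case: bu => f /(_ 0); rewrite /concat /= cats0.
by have [m em] := inF_initial iu iv; exists m => //; apply/built_infP; rewrite -em.
Qed.

Lemma index_word_mul m k r : toeplitz c m.+1 -> index_word k.+1 = concat (index_word m.+1) r ->
  k.+1 = m.+1 * (size r).+1 /\ r = mkseq (fun i => c (m.+1 * i.+1)) (size r).
Proof.
move=> tm e; have := congr1 (count negb) e.
rewrite count_false_concat !count_index_word => ek; split=> //.
apply: (@separated_inj (mkseq (fun i => c i.+1) m)); first by rewrite size_mkseq.
by apply: concat_false_inj; rewrite -!concat_separated -/(index_word m.+1) -e concat_index_word // -ek.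
Qed.

Lemma simple_stretch_constant g k : 0 < g ->
  constant (mkseq (fun i => c (g * i.+1)) k) <-> simple_stretch c g (g * k.+1).
Proof.
move=> g0; rewrite /simple_stretch mulKn //; split=> [|h].
  case: k => [|k] h s t; first by lia.
  have H i : i < k.+1 -> c (g * i.+1) = c (g * 1).
    case: i => // i li; move/constantP: h => /(_ 0) [x ex].
    have N j : j < k.+1 -> c (g * j.+1) = x.
      move=> lj; have := congr1 (fun s => nth 0 s j) ex.
      by rewrite size_mkseq nth_nseq lj nth_mkseq.
    by rewrite !N.
  by case: s t => [|s] [|t] //= ls lt; rewrite !H //; lia.
case: k h => [|k] h //; rewrite /mkseq /=; apply/(all_nthP 0) => i.
rewrite size_map size_iota => li; rewrite (nth_map 0) ?size_iota // nth_iota //=.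
by apply/eqP; apply: h; lia.
Qed.

End IndexWords.

Lemma canonical_word_index c m :
  canonical_word (limit_word c) (index_word c m.+1) <-> canonical_index c m.+1.
Proof.
split=> [[_ bv nex]|[_ tm nex]].
  split=> //; first by apply/built_infP.
  move=> [g [l [[g0 tg dg] lg tl [dl ll] st]]]; apply: nex.
  case: g g0 tg dg lg st => // g _ tg dg lg st.
  case/dvdnP: dg => k ek; case: k ek => // k ek.
  case/dvdnP: dl => k' ek'; case: k' ek' => [|k'] ek'; first by lia.
  have hm : m.+1 = g.+1 * k.+1 by rewrite ek mulnC.
  have hl : l = m.+1 * k'.+1 by rewrite ek' mulnC.
  have hl' : l = g.+1 * (k'.+1 * k.+1).-1.+1.
    by rewrite hl hm prednK // -mulnA [k.+1 * _]mulnC.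
  have l0 : 0 < l by lia.
  exists (index_word c g.+1), (index_word c l); split.
  - by rewrite inF_index_word -(prednK l0) inF_index_word.
  - by apply/built_infP.
  - by rewrite -(prednK l0); apply/built_infP; rewrite prednK.
  - split.
      exists (mkseq (fun i => c (g.+1 * i.+1)) k); last by rewrite concat_index_word // -hm.
      by rewrite size_mkseq; move: lg; rewrite hm; case: k {ek hm hl'} => //; lia.
    exists (mkseq (fun i => c (m.+1 * i.+1)) k'); last first.
      by rewrite concat_index_word -?hl //; apply/(built_infP c m).
    by rewrite size_mkseq; move: ll; rewrite hl; case: k' {ek' hl hl'} => //; lia.
  - exists (mkseq (fun i => c (g.+1 * i.+1)) (k'.+1 * k.+1).-1); split.
    + rewrite size_mkseq; have : 1 < k'.+1 * k.+1; last by lia.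
    by move: ll; rewrite hl; case: k' {ek' hl hl'} => [|k']; lia.
    + by apply/simple_stretch_constant => //; rewrite -hl'.
    + by rewrite concat_index_word // -hl'.
split; [exact: inF_index_word | by apply/built_infP |].
move=> [u [w [/andP[iu iw] bu bw [[r sr er] [r' sr' er']] [r2 [sr2 cr2 er2]]]]]; apply: nex.
have [g eg tg] := inF_built_inf iu bu; have [l el tl] := inF_built_inf iw bw.
rewrite {}eg in er er2; rewrite {}el in er' er2.
have [Em _] := index_word_mul tg er; have [El _] := index_word_mul tm er'.
have [El2 Er2] := index_word_mul tg er2.
exists g.+1, l.+1; split.
- by split=> //; rewrite Em dvdn_mulr.
- by rewrite Em ltn_Pmulr.
- by [].
- by rewrite {1}El dvdn_mulr // El ltn_Pmulr.
- by rewrite El2; apply/simple_stretch_constant => //; rewrite -Er2.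
Qed.

Lemma canonical_wordP c v : canonical_word (limit_word c) v ->
  exists2 d, v = index_word c d & canonical_index c d.
Proof.
move=> cv; have [iv bv _] := cv; have [m em tm] := inF_built_inf iv bv.
by exists m.+1 => //; apply/canonical_word_index; rewrite -em.
Qed.

(** Stated for an arbitrary chain of moduli [e], so as to serve both the given parameters and the
    canonical ones. *)
Lemma generating_index_word c e q a : e 0 = 1 -> (forall n, e n.+1 = e n * q n) ->
  (forall n, 0 < q n) -> (forall n, toeplitz c (e n)) ->
  (forall n i, 0 < i < q n -> a n i = c (e n * i)) ->
  forall n, generating q a n = index_word c (e n).
Proof.
move=> e0 eS q0 te ha; elim=> [|n IH]; first by rewrite e0.
have en0 : 0 < e n by elim: n {IH} => [|n IHn]; rewrite ?e0 // eS muln_gt0 IHn q0.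
rewrite /= IH eS -(prednK en0) -{2}(prednK (q0 n)) -concat_index_word ?prednK //; congr concat.
rewrite /index_iota subn1 /mkseq -[in iota 1 _](addn0 1) iotaDl -map_comp.
apply/eq_in_map => i; rewrite mem_iota => /= li; rewrite add1n ha //.
by have := q0 n; lia.
Qed.

(** * Canonical boundedness in terms of constant runs *)

Section GivenParameters.

Variables (q : nat -> nat) (a : nat -> nat -> nat).
Hypothesis q_gt1 : cutting q.

Local Notation c := (spacer q a).
Local Notation V := (limit_word c).

Lemma spacer_toeplitz n : toeplitz c (Qn q n).
Proof. by move=> i; apply: spacer_mod. Qed.

(** The value at index 0 is not a spacer of V; adding it to M gives a bound valid at every index. *)
Lemma spacer_le M i : (forall n j, 0 < j < q n -> a n j <= M) -> c i <= M + c 0.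
Proof.
move=> hM; case: (posnP i) => [->|i0]; first exact: leq_addl.
apply: leq_trans (leq_addr _ _); have [d nd] := slevelP q_gt1 i0.
rewrite /spacer; move: (slevel q i) d nd => l /dvdnP [k ->] nd; apply: hM.
rewrite mulnK ?Qn_gt0 // ltn_mod (ltnW (q_gt1 _)) andbT lt0n.
by apply: contra nd => /eqP Ek; rewrite QnS mulnC dvdn_pmul2r ?Qn_gt0 // /dvdn Ek.
Qed.

Lemma generating_spacer n : generating q a n = index_word c (Qn q n).
Proof.
apply: generating_index_word => //; first exact: Qn0.
- by move=> m; rewrite QnS.
- by move=> m; apply: ltnW.
- exact: spacer_toeplitz.
by move=> m i hi; rewrite spacer_Qn.
Qed.

Lemma height_bheight n : height q a n = bheight q c n.
Proof.
elim: n => [|n IH]; first by rewrite bheight0.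
rewrite bheightS //; last by move=> m i; apply: spacer_toeplitz.
rewrite /= IH; congr (_ + _); apply: eq_big_nat => i hi.
by rewrite spacer_Qn.
Qed.

Lemma limit_of_spacer : limit_of (generating q a) V.
Proof.
move=> n; rewrite generating_spacer -(prednK (Qn_gt0 q_gt1 n)).
exact: initial_index_word.
Qed.

Lemma limit_of_unique V' : limit_of (generating q a) V' -> V' = V.
Proof.
move=> lV; apply/funext => k; have := lV k; have := limit_of_spacer k.
rewrite /initial_segment => -> /(congr1 (fun s => nth false s k)).
have lk : k < size (generating q a k).
  rewrite generating_spacer -(prednK (Qn_gt0 q_gt1 k)) size_index_word.
  exact: (ltn_bheight q_gt1 spacer_toeplitz).
by rewrite size_mkseq !nth_mkseq.
Qed.

(** The canonical numbers of zeros grow by factors at most B < 2 ^ B, whereas [Qn q (n + B)] is at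
    least 2 ^ B times [Qn q n]. So some canonical index lies strictly between these two moduli, is
    comparable with both and is straddled by any stretch from one to the other. *)
Lemma canonically_bounded_no_long_stretch :
  canonically_bounded q a -> no_long_stretch q c.
Proof.
move=> [_ [q' [a' [[cq' [V' lV cg]] [[B hB] _]]]]].
rewrite {}(limit_of_unique lV) in cg; case: cg => _ can _ _.
have /choice [d hd] n : exists d, generating q' a' n = index_word c d /\ canonical_index c d.
  by have [d ed cd] := canonical_wordP (can n); exists d.
have dpos n : 0 < d n by have [_ []] := hd n.
have cd n : count negb (generating q' a' n) = d n.
  by rewrite (hd n).1 -(prednK (dpos n)) count_index_word.
have dS n : d n.+1 = d n * q' n.
  rewrite -!cd /= count_false_concat size_map size_iota; congr (_ * _).
  by have := cq' n; lia.
have d0 : d 0 = 1 by rewrite -cd.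
exists 0, B => n _ st.
have dge k : k < d k.
  by elim: k => [|k IH]; rewrite ?d0 // dS; have := cq' k; have := dpos k; nia.
have ex : exists k, Qn q n < d k by exists (Qn q n).
case: (ex_minnP ex) => -[|k] lk mk; first by move: lk; rewrite d0; have := Qn_gt0 q_gt1 n; lia.
have lk' : d k <= Qn q n by rewrite leqNgt; apply/negP => /mk; rewrite ltnn.
have up : d k.+1 < Qn q (n + B).
  apply: leq_trans (leq_Qn_add q_gt1 n B); rewrite dS.
  have : q' k < 2 ^ B by apply: leq_ltn_trans (hB k) _; exact: ltn_expl.
  by have := cq' k; have := dpos k; nia.
have [_ [d0' td nc]] := hd k.+1.
have cand : canonical_index c (d k.+1) by [].
have div m : (d k.+1 %| Qn q m) \/ (Qn q m %| d k.+1).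
  exact: (canonical_index_comparable cand (Qn_gt0 q_gt1 m) (@spacer_toeplitz m)).
apply: nc; exists (Qn q n), (Qn q (n + B)); split=> //.
- split; [exact: Qn_gt0 | exact: spacer_toeplitz |].
  by case: (div n) => // /(dvdn_leq (Qn_gt0 q_gt1 n)); lia.
- exact: spacer_toeplitz.
- split=> //; case: (div (n + B)) => // /(dvdn_leq d0'); lia.
Qed.

(** Comparability turns the increasing enumeration of canonical indices into a chain for
    divisibility, whose quotients are the canonical cutting parameter. Absence of powers rules out a
    periodic V. *)
Lemma no_long_stretch_canonically_bounded : bounded_parameters q a ->
  no_long_stretch q c -> canonically_bounded q a.
Proof.
move=> [[qM hq] [M hM]] ns.
have cmod : forall n i, ~~ (Qn q n %| i) -> c i = c (i %% Qn q n) := spacer_toeplitz.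
(* The successor keeps the bound positive, as [no_long_stretch_power_free] requires. *)
have cle i : c i <= (M + c 0).+1 by apply: leqW; apply: spacer_le.
split.
  exists V; first exact: limit_of_spacer.
  have [K K0 pf] := no_long_stretch_power_free q_gt1 cmod hq cle (ltn0Sn _) ns.
  move=> [p p0 per]; have [k _] := pf p 0 p0.
  by rewrite add0n per eqxx.
have [e [e0 can inc enum [C hC]]] := canonical_index_enum q_gt1 hq spacer_toeplitz ns.
have epos n : 0 < e n by case: (can n).
have te n : toeplitz c (e n) by case: (can n).
have ediv n : e n %| e n.+1.
  case: (canonical_index_comparable (can n) (epos n.+1) (te n.+1)) => //.
  by move/(dvdn_leq (epos n)); have := inc n; lia.
pose q' n := e n.+1 %/ e n; pose a' n i := c (e n * i).
have eS n : e n.+1 = e n * q' n by rewrite mulnC divnK.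
have q'1 : cutting q'.
  by move=> n; have := inc n; rewrite eS; have := epos n; nia.
have gen n : generating q' a' n = index_word c (e n).
  by apply: generating_index_word => // m; apply: ltnW; apply: q'1.
exists q', a'; split; last first.
  split; last by exists (M + c 0) => n i _; apply: spacer_le.
  by exists C => n; have := hC n; rewrite eS; have := epos n; nia.
split=> //; exists V; first exact: limit_of_spacer.
split.
- by move=> n; rewrite gen -(prednK (epos n)); apply: initial_index_word.
- by move=> n; rewrite gen -(prednK (epos n)); apply/canonical_word_index; rewrite prednK.
- move=> w /canonical_wordP [d ew cd]; have [n en] := enum d cd.
  by exists n; rewrite gen en.
move=> n; rewrite !gen -(prednK (epos n)) -(prednK (epos n.+1)) !size_index_word ltnS.
by apply: tau_ltn; have := inc n; have := epos n; lia.
Qed.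

End GivenParameters.

Import Order.TTheory GRing.Theory Num.Theory numFieldNormedType.Exports.

(** * Exact symmetries and exact towers *)

Section OuterProbability.
Local Open Scope classical_set_scope.
Local Open Scope ring_scope.

Lemma sum_half_le (R : realType) k p : \sum_(i < p) ((1 / 2) ^+ (k + i) : R) <= (1 / 2) ^+ k *+ 2.
Proof.
suff -> : \sum_(i < p) ((1 / 2) ^+ (k + i) : R) = (1 / 2) ^+ k *+ 2 - (1 / 2) ^+ (k + p) *+ 2.
  by rewrite gerBl mulrn_wge0 // exprn_ge0 // divr_ge0.
elim: p => [|p IH]; first by rewrite big_ord0 addn0 subrr.
rewrite big_ord_recr /= IH addnS exprS; lra.
Qed.

Context d (X : measurableType d) (R : realType) (mu : {measure set X -> \bar R}).

(* Measurable for the completed measure. *)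
Definition nm (A : set X) := exists2 B, measurable B & mu.-negligible (A `+` B).

(* Outer probability, so that it is subadditive without measurability side
   conditions. *)
Definition pr (A : set X) : R :=
  inf [set fine (mu B) | B in [set B | measurable B /\ A `<=` B]].

Lemma nm_measurable A : measurable A -> nm A.
Proof. by move=> mA; exists A; rewrite // setYK; exact: negligible_set0. Qed.

Lemma nm_null A : mu.-negligible A -> nm A.
Proof. by move=> nA; exists set0; rewrite // setY0. Qed.

Lemma nmC A : nm A -> nm (~` A).
Proof.
move=> [B mB nB]; exists (~` B); first exact: measurableC.
apply: negligibleS nB => x /=; rewrite /setY /=.
by case: (pselect (A x)); case: (pselect (B x)); tauto.
Qed.

Lemma nm_bigcup (F : nat -> set X) : (forall k, nm (F k)) -> nm (\bigcup_k F k).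
Proof.
move=> h; have /choice [G hG] k : exists B, measurable B /\ mu.-negligible (F k `+` B).
  by have [B] := h k; exists B.
exists (\bigcup_k G k); first by apply: bigcupT_measurable => k; case: (hG k).
apply: (@negligibleS _ _ _ _ (\bigcup_k (F k `+` G k))).
  move=> x [[[k _ Fk] nG]|[[k _ Gk] nF]]; exists k => //; [left|right]; split => //.
    by move=> Gk; apply: nG; exists k.
  by move=> Fk; apply: nF; exists k.
by apply: negligible_bigcup => k; case: (hG k).
Qed.

Lemma nmU A B : nm A -> nm B -> nm (A `|` B).
Proof.
move=> hA hB; rewrite -bigcup2E; apply: nm_bigcup => -[|[|k]] //=.
by apply: nm_measurable.
Qed.

Lemma nmI A B : nm A -> nm B -> nm (A `&` B).
Proof. by move=> hA hB; rewrite -[_ `&` _]setCK setCI; apply/nmC/nmU; apply: nmC. Qed.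

Lemma nmD A B : nm A -> nm B -> nm (A `\` B).
Proof. by move=> hA hB; rewrite setDE; apply: nmI => //; apply: nmC. Qed.

Lemma nmY A B : nm A -> nm B -> nm (A `+` B).
Proof. by move=> hA hB; apply: nmU; apply: nmD. Qed.

Lemma nm_bigcup_cond (P : nat -> Prop) (F : nat -> set X) :
  (forall k, P k -> nm (F k)) -> nm (\bigcup_(k in [set k | P k]) F k).
Proof.
move=> h; rewrite bigcup_mkcond; apply: nm_bigcup => k; case: ifPn.
  by rewrite inE => /h.
by move=> _; apply: nm_measurable.
Qed.

Hypothesis mu1 : mu setT = 1%E.

Lemma mu_fin_num B : measurable B -> mu B \is a fin_num.
Proof.
move=> mB; rewrite ge0_fin_numE //; apply: (@le_lt_trans _ _ 1%E); last exact: ltry.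
by rewrite -mu1 le_measure ?inE.
Qed.

Lemma pr_le_mu A B : measurable B -> A `<=` B -> pr A <= fine (mu B).
Proof.
move=> mB AB; apply: inf_lbound; last by exists B.
by exists 0 => _ [C _ <-]; rewrite fine_ge0.
Qed.

(** Intersecting a minimizing sequence of measurable covers attains the infimum. *)
Lemma hullP A : exists H, [/\ measurable H, A `<=` H & pr A = fine (mu H)].
Proof.
have hi : has_inf [set fine (mu B) | B in [set B | measurable B /\ A `<=` B]].
  split; first by exists (fine (mu setT)), setT.
  by exists 0 => _ [C _ <-]; rewrite fine_ge0.
have /choice [G hG] (k : nat) : exists B, [/\ measurable B, A `<=` B &
    fine (mu B) < pr A + k.+1%:R^-1].
  have [|_ [B [mB AB] <-] h] := @inf_adherent R _ k.+1%:R^-1 _ hi; first by rewrite invr_gt0.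
  by exists B.
have mH : measurable (\bigcap_k G k) by apply: bigcapT_measurable => k; case: (hG k).
exists (\bigcap_k G k); split=> //; first by move=> x Ax k _; case: (hG k) => _ + _; apply.
apply/eqP; rewrite eq_le; apply/andP; split.
  by apply: pr_le_mu => // x Ax k _; case: (hG k) => _ + _; apply.
apply/ler_addgt0Pr => e e0.
have [k hk] := ltr_add_invr (y := 0) (x := e) e0.
have [mG AG lG] := hG k.
apply: (@le_trans _ _ (fine (mu (G k)))); last first.
  by apply/ltW/(lt_trans lG); rewrite ltrD2l -[ltLHS]add0r.
apply: fine_le; rewrite ?mu_fin_num // le_measure ?inE // => x; exact.
Qed.

Lemma prE A : measurable A -> pr A = fine (mu A).
Proof.
move=> mA; apply/eqP; rewrite eq_le pr_le_mu //=.
have [H [mH AH ->]] := hullP A.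
by apply: fine_le; rewrite ?mu_fin_num // le_measure ?inE.
Qed.

Lemma pr_ge0 A : 0 <= pr A.
Proof. by have [H [_ _ ->]] := hullP A; rewrite fine_ge0. Qed.

Lemma pr_setT : pr setT = 1.
Proof. by rewrite prE // mu1. Qed.

Lemma pr_set0 : pr set0 = 0.
Proof. by rewrite prE // measure0. Qed.

Lemma le_pr A B : A `<=` B -> pr A <= pr B.
Proof.
by move=> AB; have [H [mH BH ->]] := hullP B; apply: pr_le_mu => //; exact: subset_trans BH.
Qed.

Lemma pr_le1 A : pr A <= 1.
Proof. by rewrite -pr_setT le_pr. Qed.

Lemma pr_null A : mu.-negligible A <-> pr A = 0.
Proof.
split=> [[B [mB B0 AB]]|h].
  by apply/eqP; rewrite eq_le pr_ge0 andbT (le_trans (pr_le_mu mB AB)) // B0.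
have [H [mH AH]] := hullP A; rewrite h => e; exists H; split=> //.
by rewrite -(fineK (mu_fin_num mH)) -e.
Qed.

Lemma pr_le_bigcup (F : nat -> set X) (e : R) :
  (forall n, \sum_(i < n) pr (F i) <= e) -> pr (\bigcup_k F k) <= e.
Proof.
move=> h; have /choice [G hG] k := hullP (F k).
have mG k : measurable (G k) by case: (hG k).
apply: le_trans (pr_le_mu (bigcupT_measurable _ mG) _) _.
  by apply: subset_bigcup => k _; case: (hG k).
rewrite -lee_fin fineK ?mu_fin_num //; last exact: bigcupT_measurable.
apply: le_trans (measure_sigma_subadditive mu mG (bigcupT_measurable _ mG) (@subset_refl _ _)) _.
apply: lime_le; first by apply: is_cvg_nneseries.
apply: nearW => n; rewrite big_mkord.
rewrite (eq_bigr (fun i : 'I_n => (pr (F i))%:E)); last first.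
  by move=> i _; case: (hG i) => _ _ ->; rewrite fineK ?mu_fin_num.
by rewrite sumEFin lee_fin h.
Qed.

Lemma pr_leU A B : pr (A `|` B) <= pr A + pr B.
Proof.
have [G [mG AG ->]] := hullP A; have [H [mH BH ->]] := hullP B.
apply: le_trans (pr_le_mu (measurableU _ _ mG mH) (setUSS AG BH)) _.
rewrite -lee_fin EFinD !fineK ?mu_fin_num //; last exact: measurableU.
exact: measureU2.
Qed.

Lemma pr_le_bigU n (F : nat -> set X) :
  pr (\bigcup_(i in [set i | (i < n)%N]) F i) <= \sum_(i < n) pr (F i).
Proof.
elim: n => [|n IH].
  by rewrite big_ord0 (_ : bigcup _ _ = set0) ?pr_set0 // -subset0 => x [].
rewrite big_ord_recr /=; apply: le_trans (lerD IH (lexx _)).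
apply: le_trans (pr_leU _ _); apply: le_pr => x [i /=].
by rewrite ltnS leq_eqVlt => /predU1P [-> Fx|li Fx]; [right | left; exists i].
Qed.

Lemma pr_eq A B : mu.-negligible (A `+` B) -> pr A = pr B.
Proof.
have half A' B' : mu.-negligible (A' `+` B') -> pr A' <= pr B'.
  move=> /pr_null h; rewrite -[leRHS]addr0 -h; apply: le_trans (pr_leU _ _).
  by apply: le_pr => x A'x; rewrite /setY /=; case: (pselect (B' x)); tauto.
move=> h; apply/eqP; rewrite eq_le !half //; by rewrite setYC.
Qed.

Lemma nm_pr A : nm A -> exists B, [/\ measurable B, mu.-negligible (A `+` B) & pr A = fine (mu B)].
Proof. by move=> [B mB nB]; exists B; split=> //; rewrite -prE //; apply: pr_eq. Qed.

Lemma pr_split A B : nm B -> pr A = pr (A `&` B) + pr (A `\` B).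
Proof.
move=> [C mC nC]; apply/eqP; rewrite eq_le; apply/andP; split.
  apply: le_trans (pr_leU _ _); apply: le_pr => x Ax.
  by case: (pselect (B x)) => Bx; [left|right].
have -> : pr (A `&` B) = pr (A `&` C).
  apply: pr_eq; apply: negligibleS nC => x; rewrite /setY /=.
  by case: (pselect (B x)); case: (pselect (C x)); tauto.
have -> : pr (A `\` B) = pr (A `\` C).
  apply: pr_eq; apply: negligibleS nC => x; rewrite /setY /=.
  by case: (pselect (B x)); case: (pselect (C x)); tauto.
have [H [mH AH ->]] := hullP A.
apply: (@le_trans _ _ (fine (mu (H `&` C)) + fine (mu (H `\` C)))).
  apply: lerD; apply: pr_le_mu.
  - exact: measurableI.
  - exact: setSI.
  - exact: measurableD.
  - exact: setSD.
rewrite -lee_fin EFinD !fineK ?mu_fin_num //; [|exact: measurableD|exact: measurableI].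
by rewrite addeC -measureDI.
Qed.

Lemma prC A : nm A -> pr (~` A) = 1 - pr A.
Proof. by move=> nA; rewrite -pr_setT (pr_split setT nA) setTI setTD addrC addKr. Qed.

Lemma pr_setU A B : nm B -> A `&` B = set0 -> pr (A `|` B) = pr A + pr B.
Proof.
move=> nB AB; rewrite (pr_split _ nB) setIUl AB set0U setIid setDUl setDv setU0 addrC.
by congr (pr _ + _); apply/setDidPl.
Qed.

Lemma pr_bigU n (F : nat -> set X) : (forall i, (i < n)%N -> nm (F i)) ->
  (forall i j x, (i < n)%N -> (j < n)%N -> F i x -> F j x -> i = j) ->
  pr (\bigcup_(i in [set i | (i < n)%N]) F i) = \sum_(i < n) pr (F i).
Proof.
elim: n => [|n IH] hn hd.
  by rewrite big_ord0 (_ : bigcup _ _ = set0) ?pr_set0 // -subset0 => x [].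
rewrite big_ord_recr /= -IH; last first.
- by move=> i j x li lj; apply: hd; apply: ltnW.
- by move=> i li; apply/hn/ltnW.
rewrite -pr_setU; last first.
- rewrite -subset0 => x [[i /= li Fi] Fn]; have := hd i n x (ltnW li) (ltnSn n) Fi Fn.
  by move=> e; rewrite e ltnn in li.
- exact: hn.
congr pr; apply/seteqP; split=> x [] => [i /=|[i li Fi]|Fn].
- by rewrite ltnS leq_eqVlt => /predU1P [-> Fx|li Fx]; [right | left; exists i].
- by exists i => //=; apply: ltnW.
- by exists n => /=.
Qed.

(** Markov's inequality for the number of sets [F i] containing a point. Since E may fail to be
    measurable, there is no integration; E is split along the last [F i] by induction. *)
Lemma pr_markov n t (F : nat -> set X) E : (forall i, (i < n)%N -> nm (F i)) ->
  (forall x, E x -> (t <= \sum_(i < n) `[< F i x >])%N) ->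
  t%:R * pr E <= \sum_(i < n) pr (F i `&` E).
Proof.
elim: n t E => [|n IH] t E hn ht.
  rewrite big_ord0; case: (pselect (exists x, E x)) => [[x Ex]|nE].
    by have := ht x Ex; rewrite big_ord0 leqn0 => /eqP ->; rewrite mul0r.
  by rewrite (_ : E = set0) ?pr_set0 ?mulr0 // -subset0 => x Ex; apply: nE; exists x.
have hn' i : (i < n)%N -> nm (F i) by move=> li; apply/hn/ltnW.
have nn := hn n (ltnSn n).
have h1 : t%:R * pr (E `\` F n) <= \sum_(i < n) pr (F i `&` (E `\` F n)).
  apply: IH => // x [Ex nFx]; have := ht x Ex; rewrite big_ord_recr /=.
  by case: asboolP => //; rewrite addn0.
have h2 : t.-1%:R * pr (E `&` F n) <= \sum_(i < n) pr (F i `&` (E `&` F n)).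
  apply: IH => // x [Ex Fx]; have := ht x Ex; rewrite big_ord_recr /=.
  by case: asboolP => // _; rewrite addn1 => h; case: t h {ht h1}.
have h3 : t%:R <= t.-1%:R + 1 :> R by rewrite natr1 ler_nat leqSpred.
rewrite big_ord_recr /= [F n `&` E]setIC (pr_split E nn) mulrDr.
have -> : \sum_(i < n) pr (F i `&` E) =
    \sum_(i < n) pr (F i `&` (E `&` F n)) + \sum_(i < n) pr (F i `&` (E `\` F n)).
  rewrite -big_split; apply: eq_bigr => i _ /=.
  by rewrite (pr_split (F i `&` E) nn) setIA setIDA.
have := ler_wpM2r (pr_ge0 (E `&` F n)) h3; rewrite mulrDl mul1r; lra.
Qed.

Lemma pr_bigcup_tail (F : nat -> set X) (e : R) : (forall k, measurable (F k)) -> 0 < e ->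
  exists n, pr (\bigcup_k F k `\` \bigcup_(k in [set k | (k < n)%N]) F k) <= e.
Proof.
move=> mF e0; pose G n := \bigcup_(k in [set k | (k < n)%N]) F k.
have mG n : measurable (G n).
  by rewrite /G bigcup_mkcond; apply: bigcupT_measurable => k; case: ifP.
have E : \bigcup_k F k = \bigcup_n G n.
  apply/seteqP; split=> x [k _ Fk]; first by exists k.+1 => //; exists k => /=.
  by case: Fk => i _ Fi; exists i.
have mU : measurable (\bigcup_n G n) by apply: bigcupT_measurable.
have cv : mu (G n) @[n --> \oo] --> mu (\bigcup_n G n).
  apply: nondecreasing_cvg_mu => // m n mn; apply/subsetPset => x [k /= lk Fk].
  by exists k => //=; apply: leq_trans mn.
have cvr : fine (mu (G n)) @[n --> \oo] --> fine (mu (\bigcup_n G n)).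
  by apply: fine_cvg; rewrite fineK ?mu_fin_num.
have /cvgrPdist_lt /(_ e e0) [N _ hN] := cvr; exists N; rewrite -/(G N) E.
have := hN N (leqnn N).
rewrite prE; last exact: measurableD.
have -> : fine (mu (\bigcup_n G n `\` G N)) = fine (mu (\bigcup_n G n)) - fine (mu (G N)).
  rewrite measureD //; last by rewrite ltey_eq mu_fin_num.
  rewrite fineB ?mu_fin_num //; last exact: measurableI.
  by congr (_ - fine (mu _)); apply/setIidPr => x Gx; exists N.
by move/ltW/(le_trans (ler_norm _)).
Qed.

End OuterProbability.

Section IntegerIterates.
Local Open Scope ring_scope.

Variables (X : Type) (T Ti : X -> X).

Definition ziter (n : int) : X -> X :=
  match n with Posz k => iter k T | Negz k => iter k.+1 Ti end.

Hypotheses (TK : cancel T Ti) (TiK : cancel Ti T).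

Lemma ziterS n x : ziter (n + 1) x = T (ziter n x).
Proof.
case: n => [k|[|k]]; first by rewrite -PoszD addn1.
  by rewrite /= TiK.
have -> : Negz k.+1 + 1 = Negz k by rewrite !NegzE -[k.+2]addn1 PoszD; ring.
by rewrite /= TiK.
Qed.

Lemma ziterB1 n x : ziter (n - 1) x = Ti (ziter n x).
Proof. by rewrite -[ziter n x](TK) -[in RHS](subrK 1 n) ziterS TK. Qed.

Lemma ziterD m n x : ziter (m + n) x = ziter m (ziter n x).
Proof.
elim/int_rect: m => [|m IH|m IH]; first by rewrite add0r.
  by rewrite -[m.+1]addn1 PoszD addrAC !ziterS IH.
by rewrite -[m.+1]addn1 PoszD opprD addrAC !ziterB1 IH.
Qed.

Lemma ziterK n : cancel (ziter n) (ziter (- n)).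
Proof. by move=> x; rewrite -ziterD addNr. Qed.

Lemma iter_ziterN k x : iter k Ti x = ziter (- k%:Z) x.
Proof. by case: k => [|k] //; rewrite -NegzE. Qed.

Lemma ziter_pos k x : ziter k%:Z x = iter k T x. Proof. by []. Qed.

End IntegerIterates.

(** * Measure preserving maps between completed spaces *)

Section MeasurePreserving.
Local Open Scope classical_set_scope.
Local Open Scope ring_scope.

(** Equivalent to [measure_preserving] for probability measures, but phrased with [nm] and [pr], so
    that it composes and iterates without choosing measurable representatives. *)
Definition mp d1 d2 (X : measurableType d1) (Y : measurableType d2) (R : realType)
    (mu : {measure set X -> \bar R}) (nu : {measure set Y -> \bar R}) (f : X -> Y) :=
  forall A, nm nu A -> nm mu (f @^-1` A) /\ pr mu (f @^-1` A) = pr nu A.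

Lemma mp_id d (X : measurableType d) (R : realType) (mu : {measure set X -> \bar R}) :
  mp mu mu id.
Proof. by []. Qed.

Lemma mp_comp d1 d2 d3 (X : measurableType d1) (Y : measurableType d2)
    (Z : measurableType d3) (R : realType) (mu : {measure set X -> \bar R})
    (nu : {measure set Y -> \bar R}) (la : {measure set Z -> \bar R}) f g :
  mp mu nu f -> mp nu la g -> mp mu la (g \o f).
Proof.
move=> hf hg A nA; have [n1 e1] := hg A nA; have [n2 e2] := hf _ n1.
by split; [exact: n2 | rewrite comp_preimage e2].
Qed.

Context d1 d2 (X : measurableType d1) (Y : measurableType d2) (R : realType)
  (mu : {measure set X -> \bar R}) (nu : {measure set Y -> \bar R}).
Hypotheses (mu1 : mu setT = 1%E) (nu1 : nu setT = 1%E).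

Lemma mp_null f N : mp mu nu f -> nu.-negligible N -> mu.-negligible (f @^-1` N).
Proof.
move=> hf nN; have [_ e] := hf N (nm_null nN).
by apply/(pr_null mu1); rewrite e; apply/(pr_null nu1).
Qed.

Lemma measure_preserving_mp f : measure_preserving mu nu f <-> mp mu nu f.
Proof.
split=> [hf A|hf A mA]; last first.
  have [nA e] := hf A (nm_measurable nu mA); have [B [mB nB eB]] := nm_pr mu1 nA.
  exists B; split=> //; rewrite -(fineK (mu_fin_num mu1 mB)) -eB e (prE nu1) //.
  by rewrite fineK // (mu_fin_num nu1).
have fnull N : nu.-negligible N -> mu.-negligible (f @^-1` N).
  move=> [M [mM M0 NM]]; have [B [mB eB nB]] := hf M mM.
  apply: (@negligibleS _ _ _ _ (B `|` (f @^-1` M `+` B))).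
    move=> x Nx; have Mx := NM _ Nx; case: (pselect (B x)); first by left.
    by move=> nBx; right; left; split.
  by apply: negligibleU => //; exists B; split; [| exact: (etrans eB M0) | exact: subset_refl].
move=> nA; have [C mC nC] := nA; have [B [mB eB nB]] := hf C mC.
have nAB : mu.-negligible (f @^-1` A `+` B).
  apply: (@negligibleS _ _ _ _ (f @^-1` (A `+` C) `|` (f @^-1` C `+` B))).
    by move=> x; rewrite /setY /=; case: (pselect (C (f x))); tauto.
  by apply: negligibleU => //; apply: fnull.
split; first by exists B.
by rewrite (pr_eq mu1 nAB) (prE mu1) // eB -(prE nu1) //; apply/esym/pr_eq.
Qed.

Lemma mp_le f A : mp mu nu f -> pr mu (f @^-1` A) <= pr nu A.
Proof.
move=> hf; have [H [mH AH ->]] := hullP nu1 A; rewrite -(prE nu1) //.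
have [_ <-] := hf H (nm_measurable nu mH).
by apply: le_pr => // x; apply: AH.
Qed.

Lemma mp_ae f g : mp mu nu f -> mu.-negligible [set x | f x <> g x] -> mp mu nu g.
Proof.
move=> hf ne A nA; have [[B mB nB] e] := hf A nA.
have ns : mu.-negligible (g @^-1` A `+` f @^-1` A).
  apply: negligibleS ne => x [[Ag nf]|[Af ng]] /= E; first by rewrite /= E in nf.
  by rewrite /= -E in ng.
split; last by rewrite -e; apply: pr_eq.
exists B => //; apply: (@negligibleS _ _ _ _ ((g @^-1` A `+` f @^-1` A) `|` (f @^-1` A `+` B))).
  by move=> x; rewrite /setY /=; case: (pselect (A (f x))); tauto.
exact: negligibleU.
Qed.

End MeasurePreserving.

Section Exactification.
Local Open Scope classical_set_scope.
Local Open Scope ring_scope.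

Context d (X : measurableType d) (R : realType) (mu : {measure set X -> \bar R}).
Hypothesis mu1 : mu setT = 1%E.

Lemma mp_iter f k : mp mu mu f -> mp mu mu (iter k f).
Proof. by move=> hf; elim: k => [|k IH]; [exact: mp_id | exact: (mp_comp IH hf)]. Qed.

Lemma mp_ziter (T Ti : X -> X) n : mp mu mu T -> mp mu mu Ti -> mp mu mu (ziter T Ti n).
Proof. by move=> hT hTi; case: n => k; apply: mp_iter. Qed.

Lemma negligible_ex (I : countType) (A : I -> set X) :
  (forall i, mu.-negligible (A i)) -> mu.-negligible [set x | exists i, A i x].
Proof.
move=> h; apply: (@negligibleS _ _ _ _
    (\bigcup_n if unpickle n is Some i then A i else set0)).
  by move=> x [i Ai]; exists (pickle i) => //; rewrite pickleK.
by apply: negligible_bigcup => n; case: unpickle => // ; apply: negligible_set0.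
Qed.

Lemma negligible_if (P : Prop) (A : set X) :
  (P -> mu.-negligible A) -> mu.-negligible [set x | P /\ A x].
Proof.
move=> h; case: (pselect P) => p; first by apply: negligibleS (h p) => x [].
by apply: (@negligibleS _ _ _ _ set0); [move=> x [] | exact: negligible_set0].
Qed.

(* Replacing [T] by the identity off an invariant set of full measure makes it an
   exact bijection. *)
Lemma exactify (T : aut mu) (N : set X) : mu.-negligible N ->
  exists (T' Ti' : X -> X) (X0 : set X),
    [/\ cancel T' Ti', cancel Ti' T', mp mu mu T' & mp mu mu Ti'] /\
    [/\ mu.-negligible (~` X0), forall x, X0 x -> X0 (T' x) /\ X0 (Ti' x),
      forall x, X0 x -> T' x = T x, forall x, X0 x -> Ti' x = aut_inv T x &
      forall x, X0 x -> ~ N x].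
Proof.
move=> nN; have [mT mTi aT aTi] := autP T; set Ti := aut_inv T in mTi aT aTi *.
have {}mT : mp mu mu T by apply/measure_preserving_mp.
have {}mTi : mp mu mu Ti by apply/measure_preserving_mp.
pose N1 := N `|` ([set x | Ti (T x) <> x] `|` [set x | T (Ti x) <> x]).
have nN1 : mu.-negligible N1.
  by apply: negligibleU => //; apply: negligibleU.
pose act (w : seq bool) x := foldr (fun (b : bool) z => if b then T z else Ti z) x w.
pose X0 := [set x | forall w, ~ N1 (act w x)].
have mact w : mp mu mu (act w).
  elim: w => [|b w IH]; first exact: mp_id.
  by case: b; [exact: (mp_comp IH mT) | exact: (mp_comp IH mTi)].
have nX0 : mu.-negligible (~` X0).
  apply: (@negligibleS _ _ _ _ [set x | exists w, (act w @^-1` N1) x]).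
    move=> x /= h; apply: contrapT => nex; apply: h => w Nw; apply: nex.
    by exists w.
  by apply: negligible_ex => w; apply: mp_null (mact w) nN1.
have XT x : X0 x -> X0 (T x).
  by move=> h w; have := h (rcons w true); rewrite /act -cats1 foldr_cat.
have XTi x : X0 x -> X0 (Ti x).
  by move=> h w; have := h (rcons w false); rewrite /act -cats1 foldr_cat.
have TK x : X0 x -> Ti (T x) = x.
  by move=> h; apply: contrapT => ne; apply: (h [::]); right; left.
have TiK x : X0 x -> T (Ti x) = x.
  by move=> h; apply: contrapT => ne; apply: (h [::]); right; right.
pose T' x := if pselect (X0 x) then T x else x.
pose Ti' x := if pselect (X0 x) then Ti x else x.
have ET x : X0 x -> T' x = T x by rewrite /T'; case: pselect.
have ETi x : X0 x -> Ti' x = Ti x by rewrite /Ti'; case: pselect.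
have NT x : ~ X0 x -> T' x = x by rewrite /T'; case: pselect.
have NTi x : ~ X0 x -> Ti' x = x by rewrite /Ti'; case: pselect.
exists T', Ti', X0; split; split.
- move=> x; case: (pselect (X0 x)) => h; last by rewrite NT // NTi.
  by rewrite ET // ETi ?TK //; apply: XT.
- move=> x; case: (pselect (X0 x)) => h; last by rewrite NTi // NT.
  by rewrite ETi // ET ?TiK //; apply: XTi.
- apply: (mp_ae mu1 mT); apply: negligibleS nX0 => x /= h X0x.
  by apply: h; rewrite ET.
- apply: (mp_ae mu1 mTi); apply: negligibleS nX0 => x /= h X0x.
  by apply: h; rewrite ETi.
- exact: nX0.
- by move=> x h; rewrite ET // ETi //; split; [exact: XT | exact: XTi].
- exact: ET.
- exact: ETi.
- by move=> x h Nx; apply: (h [::]); left.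
Qed.

End Exactification.

Section ExactTowers.
Local Open Scope classical_set_scope.
Local Open Scope ring_scope.

Context d (X : measurableType d) (R : realType) (mu : {measure set X -> \bar R}).

(* [block_start q c n i] is the time from a point of [B n.+1] to its visit to the
   [i.+1]-st piece of [B n]. *)
Definition towers (T Ti : X -> X) q c (B : nat -> set X) :=
  [/\ forall n, nm mu (B n),
    forall n x k, B n x -> (0 < k < bheight q c n)%N -> ~ B n (iter k T x),
    forall n x i, (i < q n)%N -> B n.+1 x -> B n (iter (block_start q c n i) T x),
    forall n x, B n x -> exists2 i, (i < q n)%N & B n.+1 (iter (block_start q c n i) Ti x) &
    forall (A : set X) (e : R), measurable A -> 0 < e -> exists s : seq (nat * nat),
      (forall l, l \in s -> (l.2 < bheight q c l.1)%N) /\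
      pr mu (A `+` \bigcup_(l in [set` s]) (iter l.2 Ti @^-1` B l.1)) <= e].

Hypothesis mu1 : mu setT = 1%E.

(** The relations defining rank one, countably many and valid modulo null sets, become exact on the
    invariant set of [exactify], which also avoids a null set N chosen by the user of the lemma. The
    spacer levels are eliminated: a point of [Bi n i.+1] was in [Bi n i] exactly [h n + a n i] steps
    earlier, and going back to [Bi n 1] leads to [B n.+1]. *)
Lemma rank_one_exact (T : aut mu) q a (N : set X) : cutting q ->
  rank_one_with T q a -> mu.-negligible N ->
  exists (T' Ti' : X -> X) (X0 : set X),
    [/\ [/\ cancel T' Ti', cancel Ti' T', mp mu mu T' & mp mu mu Ti'],
      [/\ mu.-negligible (~` X0), forall x, X0 x -> X0 (T' x) /\ X0 (Ti' x),
        forall x, X0 x -> T' x = T x, forall x, X0 x -> Ti' x = aut_inv T x &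
        forall x, X0 x -> ~ N x] &
      exists B, towers T' Ti' q (spacer q a) B].
Proof.
move=> q1 [_ [B [Bi [C [[mB mBi mC dens] ax]]]]] nN.
set c := spacer q a; pose h := height q a.
have hE n : h n = bheight q c n by apply: height_bheight.
have h0 n : (0 < h n)%N by rewrite hE.
pose E1 := [set x | exists n, ((\bigcup_(i in [set i | (0 < i <= q n)%N]) Bi n i) `+` B n) x].
pose E2 := [set x | exists n, exists k, (0 < k < h n)%N /\
  (aut_image T k (B n) `&` aut_image T 0 (B n)) x].
pose E3 := [set x | exists n, exists i, (0 < i < q n)%N /\
  (aut_image T (h n) (Bi n i) `+` (if a n i == 0%N then Bi n i.+1 else C n i 1%N)) x].
pose E4 := [set x | exists n, exists i, exists j, ((0 < i < q n)%N /\ (0 < j < a n i)%N) /\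
  (aut_image T 1 (C n i j) `+` C n i j.+1) x].
pose E5 := [set x | exists n, exists i, ((0 < i < q n)%N /\ a n i != 0%N) /\
  (aut_image T 1 (C n i (a n i)) `+` Bi n i.+1) x].
pose E6 := [set x | exists n, (B n.+1 `+` Bi n 1%N) x].
pose N1 := N `|` E1 `|` E2 `|` E3 `|` E4 `|` E5 `|` E6.
have nN1 : mu.-negligible N1.
  do !apply: negligibleU => //.
  - by apply: negligible_ex => n; case: (ax n).
  - apply: negligible_ex => n; apply: negligible_ex => k; apply: negligible_if => /andP[k0 kh].
    by case: (ax n) => _ _ hd _ _; apply: hd => //; rewrite -?lt0n.
  - apply: negligible_ex => n; apply: negligible_ex => i; apply: negligible_if => hi.
    by case: (ax n) => _ _ _ hd _; apply: hd.
  - apply: negligible_ex => n; apply: negligible_ex => i; apply: negligible_ex => j.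
    by apply: negligible_if => -[hi hj]; case: (ax n) => _ _ _ _ [hd _ _]; apply: hd.
  - apply: negligible_ex => n; apply: negligible_ex => i; apply: negligible_if => -[hi hj].
    by case: (ax n) => _ _ _ _ [_ hd _]; apply: hd.
  - by apply: negligible_ex => n; case: (ax n) => _ _ _ _ [_ _ hd].
have [T' [Ti' [X0 [[TK TiK mT mTi] [nX0 X0T ET ETi X0N]]]]] := exactify mu1 T nN1.
exists T', Ti', X0; split=> //.
  by split=> // x X0x Nx; apply: (X0N x X0x); do 6 left.
have X0iT k x : X0 x -> X0 (iter k T' x).
  by move=> hx; elim: k => [|k IH] //=; case: (X0T _ IH).
have X0iTi k x : X0 x -> X0 (iter k Ti' x).
  by move=> hx; elim: k => [|k IH] //=; case: (X0T _ IH).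
have EiTi k x : X0 x -> iter k Ti' x = iter k (aut_inv T) x.
  by move=> hx; elim: k => [|k IH] //=; rewrite ETi ?IH // -IH; apply: X0iTi.
have iTK k x : iter k Ti' (iter k T' x) = x.
  by elim: k x => [|k IH] x //; rewrite iterSr iterS TK IH.
have iTiK k x : iter k T' (iter k Ti' x) = x.
  by elim: k x => [|k IH] x //; rewrite iterSr iterS TiK IH.
have X0null A x : X0 x -> (A x -> N1 x) -> ~ A x by move=> hx + Ax => /(_ Ax) /X0N; apply.
have e1 n x : X0 x -> (exists2 i, (0 < i <= q n)%N & Bi n i x) <-> B n x.
  move=> hx; have := X0null E1 x hx; move/(_ (fun e => or_introl (or_introl (or_introl (or_introl (or_introl (or_intror e))))))) => nE.
  split=> [[i hi Bx]|Bx]; apply: contrapT => nBx; apply: nE; exists n.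
    by left; split=> //; exists i.
  by right; split=> // -[i hi Bix]; apply: nBx; exists i.
have e2 n k x : X0 x -> (0 < k < h n)%N -> B n x -> ~ B n (iter k T' x).
  move=> hx hk Bx BTx; have := X0null E2 (iter k T' x) (X0iT k x hx).
  move/(_ (fun e => or_introl (or_introl (or_introl (or_introl (or_intror e)))))); apply.
  by exists n, k; split=> //; split=> //; rewrite /aut_image /= -EiTi ?iTK //; apply: X0iT.
have e3 n i x : X0 x -> (0 < i < q n)%N ->
    Bi n i (iter (h n) Ti' x) <-> (if a n i == 0%N then Bi n i.+1 else C n i 1%N) x.
  move=> hx hi; have := X0null E3 x hx.
  move/(_ (fun e => or_introl (or_introl (or_introl (or_intror e))))) => nE.
  rewrite EiTi //; split=> Bx; apply: contrapT => nBx; apply: nE; exists n, i; split=> //.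
    by left.
  by right.
have e4 n i j x : X0 x -> (0 < i < q n)%N -> (0 < j < a n i)%N ->
    C n i j (Ti' x) <-> C n i j.+1 x.
  move=> hx hi hj; have := X0null E4 x hx.
  move/(_ (fun e => or_introl (or_introl (or_intror e)))) => nE.
  rewrite ETi //; split=> Bx; apply: contrapT => nBx; apply: nE; exists n, i, j; split=> //.
    by left.
  by right.
have e5 n i x : X0 x -> (0 < i < q n)%N -> a n i != 0%N ->
    C n i (a n i) (Ti' x) <-> Bi n i.+1 x.
  move=> hx hi hj; have := X0null E5 x hx.
  move/(_ (fun e => or_introl (or_intror e))) => nE.
  rewrite ETi //; split=> Bx; apply: contrapT => nBx; apply: nE; exists n, i; split=> //.
    by left.
  by right.
have e6 n x : X0 x -> B n.+1 x <-> Bi n 1%N x.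
  move=> hx; have := X0null E6 x hx; move/(_ (fun e => or_intror e)) => nE.
  split=> Bx; apply: contrapT => nBx; apply: nE; exists n; first by left.
  by right.
have chain n i j x : X0 x -> (0 < i < q n)%N -> a n i != 0%N -> (j < a n i)%N ->
    C n i j.+1 x <-> Bi n i (iter (h n + j) Ti' x).
  move=> hx hi ha; elim: j x hx => [|j IH] x hx hj.
    by rewrite addn0 e3 // (negbTE ha).
  rewrite -e4 // IH; [by rewrite addnS iterSr | by case: (X0T x hx) | exact: ltnW].
have step n i x : X0 x -> (0 < i < q n)%N ->
    Bi n i.+1 x <-> Bi n i (iter (h n + a n i) Ti' x).
  move=> hx hi; case: (eqVneq (a n i) 0%N) => ha.
    by have := e3 n i x hx hi; rewrite ha eqxx addn0 => <-.
  rewrite -e5 //; have XTi : X0 (Ti' x) by case: (X0T x hx).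
  have := @chain n i (a n i).-1 (Ti' x) XTi hi ha; rewrite prednK ?lt0n // leqnn => /(_ isT) ->.
  by rewrite -iterSr -addnS prednK // lt0n.
have base n i x : X0 x -> (i < q n)%N ->
    Bi n i.+1 x <-> B n.+1 (iter (block_start q c n i) Ti' x).
  elim: i x => [|i IH] x hx hi; first by rewrite blk0 e6.
  rewrite step // IH; [|exact: X0iTi|exact: ltnW].
  rewrite blkS //; last by move=> m k; apply: spacer_toeplitz.
  have -> : c (Qn q n * i.+1)%N = a n i.+1 by apply: spacer_Qn.
  by rewrite -iterD -hE -addnA.
exists (fun n => B n `&` X0); split.
- move=> n; apply: nmI; first exact/nm_measurable.
  by rewrite -[X0]setCK; apply/nmC/nm_null.
- by move=> n x k [Bx hx]; rewrite -hE => hk [/(e2 n k x hx hk Bx)].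
- move=> n x i hi [Bx hx]; split; last exact: X0iT.
  apply/e1; first exact: X0iT.
  exists i.+1 => //; apply/base => //; first exact: X0iT.
  by rewrite iTK.
- move=> n x [Bx hx]; have [[|i] hi Bix] := (e1 n x hx).2 Bx; first by [].
  exists i => //; split; last exact: X0iTi.
  exact/base.
move=> A e mA e0; have [s [hs [M [mM Me AM]]]] := dens A e mA e0.
exists s; split=> [l ls|]; first by rewrite -hE; apply: hs.
apply: (@le_trans _ _ (pr mu (M `|` ~` X0))).
  apply: le_pr => // x hx; case: (pselect (X0 x)) => X0x; last by right.
  left; apply: AM; have E l : (iter l.2 Ti' @^-1` (B l.1 `&` X0)) x <->
      aut_image T l.2 (B l.1) x.
    rewrite /aut_image /= -EiTi //; split=> [[]//|Bx]; split=> //; exact: X0iTi.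
  case: hx => [[Ax nU]|[[l ls Bl] nA]]; [left|right]; split=> //.
    by move=> [l ls Bl]; apply: nU; exists l => //; apply/E.
  by exists l => //; apply/E.
apply: le_trans (pr_leU mu1 _ _) _; rewrite ((pr_null mu1 _).1 nX0) addr0 prE //.
by rewrite -lee_fin fineK ?mu_fin_num // ltW.
Qed.

End ExactTowers.

(** * Commuting maps and rigidity *)

Section TowerFacts.
Local Open Scope classical_set_scope.
Local Open Scope ring_scope.

Context d (X : measurableType d) (R : realType) (mu : {measure set X -> \bar R}).
Hypothesis mu1 : mu setT = 1%E.
Variables (T Ti : X -> X).
Hypotheses (TK : cancel T Ti) (TiK : cancel Ti T).
Hypotheses (mT : mp mu mu T) (mTi : mp mu mu Ti).
Variables (q : nat -> nat) (c : nat -> nat).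
Hypothesis q_gt1 : cutting q.
Hypothesis c_mod : forall n i, ~~ (Qn q n %| i)%N -> c i = c (i %% Qn q n)%N.
Variable B : nat -> set X.
Hypothesis tB : towers mu T Ti q c B.

Local Notation blk := (block_start q c).
Local Notation h := (bheight q c).
Local Notation Q := (Qn q).
Local Notation pr := (pr mu).
Local Notation z := (ziter T Ti).

Lemma iterK k : cancel (iter k T) (iter k Ti).
Proof. by elim: k => [|k IH] x //; rewrite iterSr iterS TK IH. Qed.

Lemma iterVK k : cancel (iter k Ti) (iter k T).
Proof. by elim: k => [|k IH] x //; rewrite iterSr iterS TiK IH. Qed.

Lemma iter_subT j k x : (k <= j)%N -> iter (j - k) T x = iter k Ti (iter j T x).
Proof. by move=> kj; rewrite -[in RHS](subnKC kj) iterD iterK. Qed.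

Definition level n k : set X := iter k Ti @^-1` B n.

Definition tower n := \bigcup_(k in [set k | (k < h n)%N]) level n k.

Lemma nm_base n : nm mu (B n).
Proof. by case: tB. Qed.

Lemma nm_level n k : nm mu (level n k).
Proof. by have [] := @mp_iter _ _ _ mu Ti k mTi _ (nm_base n). Qed.

Lemma pr_level n k : pr (level n k) = pr (B n).
Proof. by have [] := @mp_iter _ _ _ mu Ti k mTi _ (nm_base n). Qed.

Lemma base_disjoint n x k : B n x -> (0 < k < h n)%N -> ~ B n (iter k T x).
Proof. by case: tB => _ + _ _ _; apply. Qed.

Lemma level_inj n j k x : (j < h n)%N -> (k < h n)%N -> level n j x -> level n k x -> j = k.
Proof.
wlog jk : j k / (j <= k)%N.
  move=> H lj lk hj hk; case: (leqP j k) => [jk|/ltnW kj]; first exact: H.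
  by apply/esym; apply: H.
move=> lj lk hj hk; apply/eqP; rewrite eqn_leq jk leqNgt; apply/negP => jk'.
have hkj : (0 < k - j < h n)%N by lia.
apply: (base_disjoint hk hkj); move: hj; rewrite /level /=.
by rewrite iter_subT ?iterVK.
Qed.

Lemma blk_ltnP n L s : (n <= L)%N -> (blk n s < h L)%N = (s < Q L %/ Q n)%N.
Proof.
move=> nL; have k0 := Qn_div_gt0 q_gt1 nL; rewrite (bheight_blk q_gt1 c_mod nL).
case: (ltnP s (Q L %/ Q n)) => ls.
  have : (blk n s <= blk n (Q L %/ Q n).-1)%N by rewrite leq_blkE //; lia.
  by have := bheight_gt0 q c n; lia.
have : (blk n (Q L %/ Q n).-1.+1 <= blk n s)%N by rewrite leq_blkE // prednK.
rewrite blkS //; move=> l; apply/negbTE; rewrite -leqNgt; lia.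
Qed.

Lemma blk_height_le n L s : (n <= L)%N -> (blk n s < h L)%N -> (blk n s + h n <= h L)%N.
Proof.
move=> nL; rewrite blk_ltnP // => ls; rewrite (bheight_blk q_gt1 c_mod nL) leq_add2r leq_blkE //.
by have := Qn_div_gt0 q_gt1 nL; lia.
Qed.

Lemma base_sub n L s x : (n <= L)%N -> (blk n s < h L)%N -> B L x -> B n (iter (blk n s) T x).
Proof.
elim: L s x => [|L IH] s x.
  rewrite leqn0 => /eqP ->; rewrite blk_ltnP // divnn Qn_gt0 // ltnS leqn0 => /eqP ->.
  by rewrite blk0.
rewrite leq_eqVlt ltnS => /predU1P [->|nL].
  by rewrite blk_ltnP // divnn Qn_gt0 // ltnS leqn0 => /eqP ->; rewrite blk0.
rewrite blk_ltnP; last exact: leqW.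
have k0 := Qn_div_gt0 q_gt1 nL; set K := (Q L %/ Q n)%N in k0 *.
have -> : (Q L.+1 %/ Q n = q L * K)%N by rewrite QnS mulnC muln_divA ?dvdn_Qn // mulnC.
move=> ls Bx; have ls' : (s %/ K < q L)%N by rewrite ltn_divLR.
have lr : (s %% K < K)%N by rewrite ltn_mod.
rewrite (divn_eq s K) -(blk_mul q_gt1 c_mod) // addnC iterD.
apply: IH => //; first by rewrite blk_ltnP.
by case: tB => _ _ + _ _; apply.
Qed.

Lemma base_up n L x : (n <= L)%N -> B n x ->
  exists2 s, (blk n s < h L)%N & B L (iter (blk n s) Ti x).
Proof.
elim: L x => [|L IH] x.
  by rewrite leqn0 => /eqP -> Bx; exists 0%N; rewrite blk0.
rewrite leq_eqVlt ltnS => /predU1P [->|nL] Bx; first by exists 0%N; rewrite blk0.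
have [s ls Bs] := IH x nL Bx.
have [i li Bi] : exists2 i, (i < q L)%N & B L.+1 (iter (blk L i) Ti (iter (blk n s) Ti x)).
  by case: tB => _ _ _ + _; apply.
have ls' : (s < Q L %/ Q n)%N by rewrite -blk_ltnP.
exists (i * (Q L %/ Q n) + s)%N; last by rewrite -(blk_mul q_gt1 c_mod) // iterD.
rewrite -(blk_mul q_gt1 c_mod) //.
have : (blk L i + h L <= h L.+1)%N by apply: blk_height_le => //; rewrite blk_ltnP // QnS mulKn ?Qn_gt0.
lia.
Qed.

(** A visit at any other time would place the point on two levels of the tower over [B L]. *)
Lemma baseP n L k x : (n <= L)%N -> (k < h L)%N -> B L x ->
  B n (iter k T x) <-> exists s, k = blk n s.
Proof.
move=> nL lk Bx; split=> [Bk|[s es]]; last by rewrite es; apply: (@base_sub n L); rewrite -?es.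
have [s ls Bs] := base_up nL Bk; exists s.
apply: (@level_inj L _ _ (iter k T x)) => //.
by rewrite /level /= iterK.
Qed.

Lemma level_up n L k x : (n <= L)%N -> (k < h n)%N -> level n k x ->
  exists s, (blk n s + k < h L)%N /\ level L (blk n s + k) x.
Proof.
move=> nL lk Bx; have [s ls Bs] := base_up nL Bx; exists s; split.
  by have := blk_height_le nL ls; lia.
by rewrite /level /= iterD.
Qed.

Lemma level_down n L k s x : (n <= L)%N -> (blk n s + k < h L)%N ->
  level L (blk n s + k) x -> level n k x.
Proof.
rewrite /level /= => nL lt Bx; have ls : (blk n s < h L)%N by lia.
by have := base_sub nL ls Bx; rewrite iterD iterVK.
Qed.

Lemma pr_tower n : pr (tower n) = (h n)%:R * pr (B n).
Proof.
rewrite pr_bigU //; first by rewrite (eq_bigr (fun=> pr (B n))) => [|i _];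
  rewrite ?pr_level // sumr_const card_ord mulr_natl.
- by move=> i _; apply: nm_level.
- by move=> i j x li lj; apply: level_inj.
Qed.

Lemma pr_base_le n : pr (B n) * (h n)%:R <= 1.
Proof. by rewrite mulrC -pr_tower pr_le1. Qed.

Lemma pr_base_sub n L : (n <= L)%N -> pr (B n) = (Q L %/ Q n)%:R * pr (B L).
Proof.
move=> nL.
have E : B n = \bigcup_(s in [set s | (s < Q L %/ Q n)%N]) level L (blk n s).
  apply/seteqP; split=> x.
    by move=> /(base_up nL) [s ls Bs]; exists s => //=; rewrite -blk_ltnP.
  move=> [s /=]; rewrite -blk_ltnP // => ls Bs.
  by have := base_sub nL ls Bs; rewrite iterVK.
rewrite {1}E pr_bigU //.
- by rewrite (eq_bigr (fun=> pr (B L))) => [|i _]; rewrite ?pr_level // sumr_const card_ord mulr_natl.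
- by move=> i _; apply: nm_level.
move=> i j x; rewrite -!blk_ltnP // => li lj Li Lj; have := level_inj li lj Li Lj.
by move/eqP; rewrite /block_start (inj_eq (@tau_inj c)) eqn_pmul2l ?Qn_gt0 // => /eqP.
Qed.

Definition level_union n (W : nat -> bool) :=
  \bigcup_(k in [set k | (k < h n)%N]) (if W k then level n k else set0).

Lemma nm_level_union n W : nm mu (level_union n W).
Proof.
apply: nm_bigcup_cond => k _; case: (W k); first exact: nm_level.
exact/nm_measurable.
Qed.

(** A level of an earlier tower is a union of levels of each later one, so a single tower is enough,
    and any sufficiently late tower will do. *)
Lemma dense_level_union (A : set X) (e : R) : measurable A -> 0 < e ->
  exists N, forall n, (N <= n)%N -> exists W, pr (A `+` level_union n W) <= e.
Proof.
move=> mA e0; have [s [hs le]] : exists s : seq (nat * nat),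
      (forall l, l \in s -> (l.2 < bheight q c l.1)%N) /\
      pr (A `+` \bigcup_(l in [set` s]) (iter l.2 Ti @^-1` B l.1)) <= e.
  by case: tB => _ _ _ _; apply.
exists (\max_(l <- s) l.1)%N => n ln.
exists (fun k => has (fun l => `[< exists t, k = blk l.1 t + l.2 >]%N) s).
apply: le_trans le; apply: le_pr => // x.
have ln' l : l \in s -> (l.1 <= n)%N.
  by move=> ls; apply: leq_trans ln; apply: (leq_bigmax_seq (F := fun l => l.1)).
suff <- : (\bigcup_(l in [set` s]) (iter l.2 Ti @^-1` B l.1)) =
  level_union n (fun k => has (fun l => `[< exists t, k = blk l.1 t + l.2 >]%N) s) by [].
apply/seteqP; split=> {}x.
  move=> [l /= ls Bx]; have [t [lt Lt]] := level_up (ln' l ls) (hs l ls) Bx.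
  exists (blk l.1 t + l.2)%N => //=; case: ifPn => // /hasPn /(_ l ls) /asboolPn; case.
  by exists t.
move=> [k /= lk]; case: ifP => // /hasP [l ls /asboolP [t et]] Lx.
by exists l => //=; apply: (level_down (ln' l ls) (s := t)); rewrite -et.
Qed.

Lemma tower_full (e : R) : 0 < e -> exists N, forall n, (N <= n)%N -> 1 - e <= pr (tower n).
Proof.
move=> e0; have [N hN] := dense_level_union measurableT e0.
exists N => n ln; have [W hW] := hN n ln.
have h1 : pr (~` level_union n W) <= e by move: hW; rewrite setTYC.
have h2 : pr (level_union n W) <= pr (tower n).
  by apply: le_pr => // x [k lk Lk]; exists k => //; case: (W k) Lk.
by rewrite (prC mu1 (nm_level_union _ _)) in h1; lra.
Qed.

Lemma pr_base_ge : exists N, forall n, (N <= n)%N -> 1 <= 2 * (h n)%:R * pr (B n).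
Proof.
have [|N hN] := @tower_full (1 / 2); first by lra.
by exists N => n /hN; rewrite pr_tower -mulrA; lra.
Qed.

(* Almost every point is followed by [w] further levels of some tower. *)
Lemma deep_level w m : mu.-negligible [set x | ~ exists L j,
  [/\ (m <= L)%N, (j + w <= h L)%N & level L j x]].
Proof.
apply/(pr_null mu1); apply/eqP; rewrite eq_le pr_ge0 // andbT.
apply/ler_addgt0Pr => e e0; rewrite add0r.
have [|N hN] := @tower_full (e / 2); first by rewrite divr_gt0.
have w0 : (0 : R) < w%:R + 1 by rewrite ltr_wpDl.
have e1 : 0 < e / (2 * (w%:R + 1)) by rewrite divr_gt0 // mulr_gt0.
have [k hk] := ltr_add_invr e1; rewrite add0r in hk.
pose L := (m + N + k.+1 + w)%N.
have lhL : (L < h L)%N := ltn_bheight q_gt1 c_mod L.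
pose F i := level L (h L - w + i)%N.
apply: (@le_trans _ _ (pr (~` tower L `|` \bigcup_(i in [set i | (i < w)%N]) F i))).
  apply: le_pr => // x nx; case: (pselect (tower L x)) => [[j /= lj Lj]|]; last by left.
  have lj' : (h L - w <= j)%N.
    rewrite leqNgt; apply/negP => lj'; apply: nx; exists L, j; split=> //; last by lia.
    by rewrite /L -!addnA leq_addr.
  right; exists (j - (h L - w))%N => /=; first by lia.
  by rewrite /F subnKC.
apply: le_trans (pr_leU mu1 _ _) _.
have h1 : pr (~` tower L) <= e / 2.
  rewrite prC //; last by apply: nm_bigcup_cond => i _; apply: nm_level.
  have := hN L; rewrite /L => /(_ ltac:(lia)); lra.
have h2 : pr (\bigcup_(i in [set i | (i < w)%N]) F i) <= w%:R * pr (B L).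
  apply: le_trans (pr_le_bigU mu1 _ _) _; rewrite (eq_bigr (fun=> pr (B L))) => [|i _].
    by rewrite sumr_const card_ord mulr_natl.
  by rewrite pr_level.
have h3 : pr (B L) <= k.+1%:R^-1.
  rewrite -[leRHS]mul1r ler_pdivlMr // ; apply: le_trans (pr_base_le L).
  by apply: ler_wpM2l; rewrite ?pr_ge0 // ler_nat; lia.
have h4 : w%:R * pr (B L) <= e / 2.
  apply: (@le_trans _ _ ((w%:R + 1) * (e / (2 * (w%:R + 1))))); last first.
    have wn : w%:R + 1 != 0 :> R by rewrite gt_eqF.
    by rewrite (_ : _ * _ = e / 2) //; field.
  apply: ler_pM; rewrite ?pr_ge0 //; first by rewrite lerDl.
  exact/ltW/(le_lt_trans h3).
lra.
Qed.

Lemma offset_eq m x (i j : int) : (`|i| + `|j| < h m)%N -> B m (z i x) -> B m (z j x) -> i = j.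
Proof.
wlog ij : i j / i <= j.
  move=> H l hi hj; case: (leP i j) => [ij|/ltW ji]; first exact: H.
  by apply/esym; apply: H; rewrite // addnC.
move=> l hi hj; apply/eqP; rewrite eq_le ij leNgt; apply/negP => lt.
have hk : (0 < `|j - i| < h m)%N by lia.
apply: (base_disjoint hi hk); rewrite -(@ziter_pos _ T Ti) -(ziterD TK TiK).
by have -> : `|j - i|%N%:Z + i = j by lia.
Qed.

(** * Offsets of a map commuting with T *)

Section Commuting.

Variables (qM M : nat).
Hypothesis q_le : forall n, (q n <= qM)%N.
Hypothesis c_le : forall i, (c i <= M)%N.
Hypothesis M_gt0 : (0 < M)%N.
Variable K : nat.
Hypothesis K_gt0 : (0 < K)%N.
Hypothesis pf : power_free K (limit_word c).
Variable S : X -> X.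
Hypothesis mS : mp mu mu S.
Hypothesis ST : mu.-negligible [set x | S (T x) <> T (S x)].

Local Notation V := (limit_word c).

Definition commuting_orbit := [set x | forall k, S (iter k T x) = iter k T (S x)].

Lemma commuting_orbit_full : mu.-negligible (~` commuting_orbit).
Proof.
apply: (@negligibleS _ _ _ _ [set x | exists k, (iter k T @^-1` [set x | S (T x) <> T (S x)]) x]).
  move=> x /= h; apply: contrapT => nex; apply: h => k; elim: k => [|k IH] //=.
  by rewrite -IH; apply: contrapT => ne; apply: nex; exists k.
by apply: negligible_ex => k; apply: (mp_null mu1 mu1) ST; apply: mp_iter.
Qed.

(* The name of the orbit of [S x] with respect to [B 0], whose points carry the
   letter [0]. *)
Definition image_name x : nat -> bool := fun k => ~~ `[< B 0 (S (iter k T x)) >].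

(** W is one reference word for all points of the base, and 1 / Y is the tolerated proportion of
    wrong letters. *)
Definition miscoded n Y W := [set x | B n x /\ (h n %/ Y < mism (h n) (image_name x) W)%N].

Lemma nm_preimage_iter k A : nm mu A -> nm mu [set x | A (S (iter k T x))].
Proof.
move=> nA; have [n1 _] := mS nA.
by have [] := mp_iter k mT n1.
Qed.

(** A union of levels approximating the preimage of [B 0] under S prescribes the zeros of W. The
    error of the approximation bounds the sum over k of the measures of the points of [B n] with a
    wrong k-th letter; [pr_markov] then bounds the miscoded part by Y e' / [h n], and [pr_base_ge]
    compares this with [pr (B n)]. *)
Lemma coding Y (e : R) : (0 < Y)%N -> 0 < e -> exists N, forall n, (N <= n)%N ->
  exists W, pr (miscoded n Y W) <= e * pr (B n).
Proof.
move=> Y0 e0; have Yp : 0 < Y%:R :> R by rewrite ltr0n.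
have [A mA nA] : nm mu (S @^-1` B 0) by have [] := mS (nm_base 0).
have [N1 hN1] := pr_base_ge.
pose e' := e / (2 * Y%:R).
have e'0 : 0 < e' by rewrite divr_gt0 // mulr_gt0.
have [N2 hN2] := dense_level_union mA e'0.
exists (maxn N1 N2) => n; rewrite geq_max => /andP[ln1 ln2].
have [W0 hW0] := hN2 n ln2; pose W k := ~~ W0 k; exists W.
pose F k := [set x | image_name x k != W k].
have nF k : nm mu (F k).
  have nB := nm_preimage_iter k (nm_base 0).
  rewrite /F /W /image_name; case: (W0 k).
    rewrite (_ : [set x | _] = ~` [set x | B 0 (S (iter k T x))]); first exact: nmC.
    by apply/seteqP; split=> x /=; case: asboolP.
  rewrite (_ : [set x | _] = [set x | B 0 (S (iter k T x))]) //.
  by apply/seteqP; split=> x /=; case: asboolP.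
pose G k := iter k Ti @^-1` (F k `&` B n).
have nFB k : nm mu (F k `&` B n) by apply: nmI => //; apply: nm_base.
have h1 : \sum_(k < h n) pr (F k `&` B n) <= e'.
  apply: (@le_trans _ _ (pr ((S @^-1` B 0) `+` level_union n W0))); last first.
    apply: (@le_trans _ _ (pr ((S @^-1` B 0 `+` A) `|` (A `+` level_union n W0)))).
      by apply: le_pr => // x; rewrite /setY /=; case: (pselect (A x)); tauto.
    by apply: le_trans (pr_leU mu1 _ _) _; rewrite ((pr_null mu1 _).1 nA) add0r.
  have E k : pr (F k `&` B n) = pr (G k).
    by have [_ ->] := mp_iter k mTi (nFB k).
  rewrite (eq_bigr (fun k : 'I_(h n) => pr (G k))) // -pr_bigU //.
  - apply: le_pr => // x [k /= lk [Fx Bx]]; move: Fx.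
    rewrite /F /W /image_name /= iterVK //; case: asboolP => Sx /= wk.
      left; split=> //; move=> [k' /= lk' Lk'].
      case wk': (W0 k') Lk' => // Lk'.
      by rewrite (level_inj lk lk' Bx Lk') wk' in wk.
    right; split=> //; exists k => //; move: wk; case: (W0 k) => //.
  - by move=> k _; have [] := mp_iter k mTi (nFB k).
  - by move=> i j x li lj [_ Bi] [_ Bj]; apply: (level_inj li lj Bi Bj).
have h2 : (h n %/ Y).+1%:R * pr (miscoded n Y W) <= e'.
  apply: le_trans h1; apply: (@le_trans _ _ (\sum_(k < h n) pr (F k `&` miscoded n Y W))).
    2: by apply: ler_sum => k _; apply: le_pr => // x [Fx [Bx _]].
  apply: pr_markov => // x [Bx]; rewrite /mism => lt; apply: leq_trans lt _.
  apply: eq_leq; apply: eq_bigr => k _; congr nat_of_bool.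
  by rewrite /F /=; case: asboolP => [->|/negP/negbTE ->].
have h3 : (h n)%:R <= (h n %/ Y).+1%:R * Y%:R :> R.
  by rewrite -natrM ler_nat ltnW // ltn_ceil.
have h4 := hN1 n ln1; have h0 : 0 < (h n)%:R :> R by rewrite ltr0n.
have h5 : (h n)%:R * pr (miscoded n Y W) <= e / 2.
  apply: (@le_trans _ _ (Y%:R * e')); last first.
    have Yn : Y%:R != 0 :> R by rewrite gt_eqF.
    by rewrite (_ : _ * _ = e / 2) // /e'; field.
  apply: le_trans (ler_wpM2r (pr_ge0 mu1 _) h3) _.
  by rewrite mulrAC mulrC ler_wpM2l.
rewrite -(ler_pM2l h0); apply: le_trans h5 _.
have := ler_wpM2l (ltW e0) h4; rewrite mulr1; lra.
Qed.

Lemma image_name_iter p x k : image_name (iter p T x) k = image_name x (p + k).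
Proof. by rewrite /image_name -iterD addnC. Qed.

Lemma base_limit_word m w k : (k < h m)%N -> B m w -> ~~ `[< B 0 (iter k T w) >] = V k.
Proof.
move=> lk Bw; apply: negb_inj; rewrite negbK; apply/asboolP/limit_wordP => [|[s es]].
  by move=> /(baseP (leq0n m) lk Bw) [s es]; exists s; rewrite es /block_start Qn0 mul1n.
by apply/(baseP (leq0n m) lk Bw); exists s; rewrite es /block_start Qn0 mul1n.
Qed.

Lemma image_name_base m x (j : int) k k' : commuting_orbit x -> B m (z j (S x)) ->
  (k' < h m)%N -> k%:Z = k'%:Z + j -> image_name x k = V k'.
Proof.
move=> cx Bx lk e; rewrite /image_name cx -(@ziter_pos _ T Ti) e ziterD // (@ziter_pos _ T Ti).
exact: (base_limit_word lk Bx).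
Qed.

(** S x lies on some level j of a higher tower with room for three N-blocks above it, so its name is
    V read from j. Near j, [align] finds a copy of v_N that starts with an m-block; its spacers
    agree with those along the orbit of x, so one offset serves all m-blocks. *)
Lemma good_block n m N W x : (n <= m <= N)%N -> (12 * K * M <= h n)%N ->
  (K.+1 * h m <= h N)%N -> B N x -> commuting_orbit x ->
  (exists L j, [/\ (N <= L)%N, (j + 3 * h N <= h L)%N & level L j (S x)]) ->
  (forall t, (t < Q N %/ Q n)%N -> ~ miscoded n (12 * K * M) W (iter (blk n t) T x)) ->
  exists j : int, (`|j| <= h n)%N /\
    forall t, (t < Q N %/ Q m)%N -> B m (z j (S (iter (blk m t) T x))).
Proof.
move=> nmN hY hK Bx cx [L [j [NL lj Lj]]] good.
have [nm mN] := andP nmN; have nN := leq_trans nm mN.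
have [nL mL] := (leq_trans nN NL, leq_trans mN NL).
set y0 := iter j Ti (S x); have By0 : B L y0 by exact: Lj.
have Sx : S x = iter j T y0 by rewrite iterVK.
have hm t : (t < Q N %/ Q n)%N ->
    (mism (h n) (wshift V (j + blk n t)) W <= h n %/ (12 * K * M))%N.
  move=> lt; have lb : (blk n t < h N)%N by rewrite blk_ltnP.
  have Bt : B n (iter (blk n t) T x) by exact: base_sub lb Bx.
  rewrite leqNgt; apply/negP => lt'; apply: (good t lt); split=> //.
  apply: leq_trans lt' _; apply: eq_leq; apply: eq_mism => // k lk.
  rewrite image_name_iter (@image_name_base L x (- j%:Z) _ (j + blk n t + k)) //.
  - by rewrite -iter_ziterN.
  - by have := blk_height_le nN lb; lia.
  - lia.
have [u [l1 l2 ag]] := align q_gt1 c_mod c_le M_gt0 K_gt0 pf nmN hY hK hm.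
exists ((blk m u)%:Z - j%:Z); split; first by lia.
move=> t lt; have lb : (blk m t < h N)%N by rewrite blk_ltnP.
rewrite cx Sx -!(@ziter_pos _ T Ti) -!ziterD //.
have -> : (blk m u)%:Z - j%:Z + (blk m t)%:Z + j%:Z = (blk m u + blk m t)%N%:Z by lia.
have lQ : (Q m * t < Q N)%N.
  by rewrite mulnC -ltn_divRL // dvdn_Qn.
have := tau_agree ag lQ; rewrite add0n tau0 addn0 -mulnDr => e.
have hnN := leq_bheight c q_gt1 nN.
rewrite (@ziter_pos _ T Ti); apply/(baseP mL) => //; first by lia.
by exists (u + t)%N; rewrite /block_start -e addnC.
Qed.

Variable Cd : nat.
Hypothesis shift_mism : forall a s L : nat, (0 < s)%N -> (Cd * s <= L)%N ->
  (L <= Cd * mism L (wshift V a) (wshift V (a + s)))%N.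

(** The names of S x1 and S x2, read from time [h n] on, are V read from [h n - j1] and [h n - j2],
    and both resemble W. Different offsets would bring V close to a shift of itself on [h m - 2 h n]
    letters, a length for which both readings stay inside a block; since 8 Cd <= Y, two errors of
    size [h m / Y] are too few for [shift_mism]. *)
Lemma offset_unique n m Y W x1 x2 (j1 j2 : int) : (8 * Cd <= Y)%N ->
  ((4 * Cd + 4) * h n <= h m)%N ->
  commuting_orbit x1 -> commuting_orbit x2 -> B m x1 -> B m x2 ->
  ~ miscoded m Y W x1 -> ~ miscoded m Y W x2 ->
  (`|j1| <= h n)%N -> (`|j2| <= h n)%N ->
  B m (z j1 (S x1)) -> B m (z j2 (S x2)) -> j1 = j2.
Proof.
wlog jj : x1 x2 j1 j2 / j2 <= j1.
  move=> H; case: (leP j2 j1) => [jj|/ltW jj]; first exact: H.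
  by move=> *; apply/esym; apply: (H x2 x1).
move=> hY hm c1 c2 B1 B2 g1 g2 l1 l2 Bj1 Bj2.
have hm4 : (4 * h n <= h m)%N by apply: leq_trans hm; rewrite leq_mul2r leq_addl orbT.
have hm1 : (4 * (Cd * h n) <= h m)%N.
  by apply: leq_trans hm; rewrite mulnA leq_mul2r leq_addr orbT.
pose s1 := `|(h n)%:Z - j1|%N; pose s2 := `|(h n)%:Z - j2|%N.
pose Lw := (h m - 2 * h n)%N.
have mis x (j : int) : commuting_orbit x -> B m x -> ~ miscoded m Y W x ->
    (`|j| <= h n)%N -> B m (z j (S x)) ->
    (mism Lw (wshift V `|(h n)%:Z - j|) (wshift W (h n)) <= h m %/ Y)%N.
  move=> cx Bx gx lj Bj; rewrite leqNgt; apply/negP => lt; apply: gx; split=> //.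
  have sub : (h n + Lw <= h m)%N by rewrite /Lw; lia.
  apply: leq_trans lt _; apply: leq_trans (mism_sub _ _ sub).
  apply: eq_leq; apply: eq_mism => // k lk; rewrite /wshift.
  apply/esym; apply: (image_name_base cx Bj); first by move: lk; rewrite /Lw; lia.
  by lia.
have m1 := mis x1 j1 c1 B1 g1 l1 Bj1; have m2 := mis x2 j2 c2 B2 g2 l2 Bj2.
apply/eqP; rewrite eq_le jj andbT leNgt; apply/negP => lt.
have e2 : (s2 = s1 + `|j1 - j2|)%N by rewrite /s1 /s2; lia.
have := shift_mism s1 (s := `|j1 - j2|%N) (L := Lw); rewrite -e2.
have -> : (0 < `|j1 - j2|)%N by lia.
have -> : (Cd * `|j1 - j2| <= Lw)%N.
  have : (Cd * `|j1 - j2| <= Cd * (2 * h n))%N by rewrite leq_mul2l; lia.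
  by rewrite mulnCA /Lw; have := bheight_gt0 q c n; lia.
move=> /(_ isT isT).
have tr : (mism Lw (wshift V s1) (wshift V s2) <=
    mism Lw (wshift V s1) (wshift W (h n)) + mism Lw (wshift V s2) (wshift W (h n)))%N.
  by rewrite [mism _ (wshift V s2) (wshift W _)]mismC; apply: mism_triangle.
move=> le; have : (Lw <= Cd * (2 * (h m %/ Y)))%N.
  apply: leq_trans le _; rewrite leq_mul2l; apply/orP; right.
  by apply: leq_trans tr _; rewrite mul2n -addnn leq_add.
have : (8 * Cd * (h m %/ Y) <= h m)%N.
  by apply: leq_trans (leq_trunc_div (h m) Y); rewrite mulnC leq_mul2l hY orbT.
rewrite mulnCA -mulnA; move: (Cd * (h m %/ Y))%N => w.
by rewrite /Lw; have := bheight_gt0 q c n; have := bheight_gt0 q c m; lia.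
Qed.

(** Inside an N-block whose n-blocks are all well coded, [good_block] supplies an offset for every
    m-block, and [offset_unique] shows that it is the same for all good points. The bound by
    [h m.-1] rather than [h m] lets [common_offset] compare consecutive stages. *)
Lemma aligned_mostly (e : R) : 0 < e -> exists m0, forall m, (m0 <= m)%N ->
  exists j : int, (4 * `|j| <= h m.-1)%N /\
    pr [set x | B m x /\ ~ B m (z j (S x))] <= e * pr (B m).
Proof.
(* As heights at least double, r0 gives [K.+1 * h m <= h N] and r1 gives
   [(4 * Cd + 4) * h n <= h m.-1]; Y serves [align] and [offset_unique] at once. An N-block has at
   most k n-blocks, and k ^ 2 arises from counting them and from comparing [pr (B n)] with
   [pr (B N)]. The cap 1 / 2 on e1 guarantees that a good point exists. *)
move=> e0; pose r0 := K.+1; pose r1 := (4 * Cd + 5)%N.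
pose Y := (12 * K * M + 8 * Cd)%N.
have Y1 : (0 < 12 * K * M)%N by rewrite !muln_gt0 K_gt0 M_gt0.
have Y0 : (0 < Y)%N by rewrite addn_gt0 Y1.
pose k := (qM ^ (r0 + r1))%N; pose e1 := Num.min e (1 / 2).
have e10 : 0 < e1 by rewrite lt_min e0 divr_gt0.
pose e2 := e1 / (k%:R ^+ 2 + 1).
have k2 : 0 < k%:R ^+ 2 + 1 :> R by rewrite ltr_wpDl // exprn_ge0.
have e20 : 0 < e2 by rewrite divr_gt0.
have [N1 hN1] := coding Y0 e20.
have [N2 hN2] := pr_base_ge.
exists (N1 + N2 + 12 * K * M + r1)%N => m lm.
pose n := (m - r1)%N; pose N := (m + r0)%N.
have nm' : (n <= m)%N by exact: leq_subr.
have mN : (m <= N)%N by exact: leq_addr.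
have nN := leq_trans nm' mN.
have En : m = (n + r1)%N by rewrite subnK //; lia.
have hY : (12 * K * M <= h n)%N.
  by apply: leq_trans (ltnW (ltn_bheight q_gt1 c_mod n)); lia.
have hK : (K.+1 * h m <= h N)%N.
  apply: leq_trans (leq_bheight_add q_gt1 c_mod m r0); rewrite mulnC leq_mul2l.
  by rewrite (ltnW (ltn_expl _ _)) ?orbT.
have hC' : ((4 * Cd + 4) * h n <= h m.-1)%N.
  have -> : m.-1 = (n + (4 * Cd + 4))%N by rewrite En /r1; lia.
  apply: leq_trans (leq_bheight_add q_gt1 c_mod n _).
  by rewrite mulnC leq_mul2l (ltnW (ltn_expl _ _)) ?orbT.
have hC : ((4 * Cd + 4) * h n <= h m)%N.
  by apply: leq_trans hC' _; apply: leq_bheight; rewrite // leq_pred.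
have [Wn hWn] := hN1 n ltac:(lia); have [Wm hWm] := hN1 m ltac:(lia).
have hk a b : (n <= a)%N -> (a <= b)%N -> (b <= N)%N -> (Q b %/ Q a <= k)%N.
  move=> na ab bN; rewrite leq_divLR ?dvdn_Qn //.
  rewrite -[in leqLHS](subnKC ab); apply: leq_trans (Qn_add_le q_le a (b - a)) _.
  rewrite leq_mul2r /k leq_pexp2l ?orbT //; first by have := qM_gt1 q_gt1 q_le; lia.
  by rewrite /N in bN; lia.
pose deep := [set y | ~ exists L i, [/\ (N <= L)%N, (i + 3 * h N <= h L)%N & level L i y]].
have ndeep : mu.-negligible (S @^-1` deep) by apply: (mp_null mu1 mu1 mS); apply: deep_level.
pose bad := (\bigcup_(t in [set t | (t < Q N %/ Q n)%N])
  iter (blk n t) T @^-1` miscoded n Y Wn) `|` (~` commuting_orbit `|` S @^-1` deep).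
have prbad : pr bad <= k%:R ^+ 2 * e2 * pr (B N).
  apply: le_trans (pr_leU mu1 _ _) _.
  rewrite [X in _ + X]((pr_null mu1 _).1 _) ?addr0; last first.
    by apply: negligibleU => //; apply: commuting_orbit_full.
  apply: le_trans (pr_le_bigU mu1 _ _) _.
  apply: (@le_trans _ _ (\sum_(t < Q N %/ Q n) (e2 * pr (B n)))).
    apply: ler_sum => t _; apply: le_trans (mp_le mu1 mu1 _ (mp_iter _ mT)) _.
    exact: hWn.
  rewrite sumr_const card_ord -[leLHS]mulr_natl (pr_base_sub nN).
  have kk : (Q N %/ Q n)%:R <= k%:R :> R by rewrite ler_nat hk.
  have := pr_ge0 mu1 (B N) => p0.
  rewrite [leRHS](_ : _ = (k%:R * (e2 * (k%:R * pr (B N))))); last by ring.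
  apply: ler_pM => //; first by rewrite mulr_ge0 ?(ltW e20) // mulr_ge0.
  by rewrite ler_wpM2l ?(ltW e20) // ler_wpM2r.
pose good := [set x | [/\ B m x, commuting_orbit x, ~ miscoded m Y Wm x &
  exists j : int, (`|j| <= h n)%N /\ B m (z j (S x))]].
have prgood : pr (B m `\` good) <= e1 * pr (B m).
  apply: (@le_trans _ _ (pr ((~` commuting_orbit `|` miscoded m Y Wm) `|`
      \bigcup_(t in [set t | (t < Q N %/ Q m)%N]) iter (blk m t) Ti @^-1` bad))).
    apply: le_pr => // x [Bx ng]; apply: contrapT => nc; apply: ng.
    have [s ls Bs] := base_up mN Bx.
    have nb : ~ bad (iter (blk m s) Ti x).
      by move=> hb; apply: nc; right; exists s => //=; rewrite -blk_ltnP.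
    have cb : commuting_orbit (iter (blk m s) Ti x).
      by apply: contrapT => h; apply: nb; right; left.
    have db : ~ deep (S (iter (blk m s) Ti x)) by move=> h; apply: nb; right; right.
    have [||j [lj Bj]] := @good_block n m N Wn _ _ hY hK Bs cb (contrapT db).
    - by rewrite nm'.
    - move=> t lt [Bt mt]; apply: nb; left; exists t => //; split=> //.
      by apply: leq_ltn_trans mt; apply: leq_div2l; rewrite // leq_addr.
    split=> //.
    - by apply: contrapT => h; apply: nc; left; left.
    - by move=> h; apply: nc; left; right.
    - exists j; split=> //; have := Bj s; rewrite -blk_ltnP // => /(_ ls).
      by rewrite iterVK.
  apply: le_trans (pr_leU mu1 _ _) _.
  apply: (@le_trans _ _ (e2 * pr (B m) + k%:R ^+ 2 * e2 * pr (B m))).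
    apply: lerD.
      apply: le_trans (pr_leU mu1 _ _) _.
      by rewrite ((pr_null mu1 _).1 commuting_orbit_full) add0r.
    apply: le_trans (pr_le_bigU mu1 _ _) _.
    apply: (@le_trans _ _ (\sum_(t < Q N %/ Q m) (k%:R ^+ 2 * e2 * pr (B N)))).
      by apply: ler_sum => t _; apply: le_trans (mp_le mu1 mu1 _ (mp_iter _ mTi)) _.
    by rewrite sumr_const card_ord -[leLHS]mulr_natl (pr_base_sub mN) mulrCA.
  rewrite [leLHS](_ : _ = e1 * pr (B m)) // /e2; field.
  by rewrite gt_eqF.
have B0 : 0 < pr (B m).
  have := hN2 m ltac:(lia); case: (ltrP 0 (pr (B m))) => // p0.
  have -> : pr (B m) = 0 by apply/eqP; rewrite eq_le p0 pr_ge0.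
  by rewrite mulr0 ler10.
have [x [Bx cx gx [j [lj Bj]]]] : exists x, good x.
  apply: contrapT => ng; have : pr (B m) <= e1 * pr (B m).
    by apply: le_trans prgood; apply: le_pr => // x Bx; split=> // gx; apply: ng; exists x.
  have : e1 <= 1 / 2 by rewrite ge_min lexx orbT.
  nra.
exists j; split.
  by apply: leq_trans hC'; rewrite leq_mul // leq_addl.
apply: (@le_trans _ _ (e1 * pr (B m))); last first.
  by rewrite ler_wpM2r ?pr_ge0 // ge_min lexx.
apply: le_trans prgood; apply: le_pr => // y [By nBy]; split=> // -[_ cy gy [j' [lj' Bj']]].
apply: nBy; have <- // : j' = j.
by apply: (@offset_unique n m Y Wm y x) => //; rewrite leq_addl.
Qed.

(** [B m.+1] fills at least a fraction 1 / qM of [B m], so exceptional sets of relative size 1 / (4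
    qM) at two consecutive stages cannot cover it. Some S x is then moved into [B m] by both
    offsets, which are equal by [offset_eq]. The same comparison within one stage identifies the
    offsets obtained for smaller e. *)
Lemma common_offset : exists j : int, forall e : R, 0 < e -> exists m0, forall m,
  (m0 <= m)%N -> pr [set x | B m x /\ ~ B m (z j (S x))] <= e * pr (B m).
Proof.
have q0 : 0 < qM%:R :> R by rewrite ltr0n; have := qM_gt1 q_gt1 q_le; lia.
pose e0 : R := 1 / (4 * qM%:R).
have e00 : 0 < e0 by rewrite divr_gt0 // mulr_gt0.
have q2 : 2 <= qM%:R :> R by rewrite ler_nat; apply: (qM_gt1 q_gt1 q_le).
have e0q : e0 * qM%:R = 1 / 4 by rewrite /e0; field; rewrite gt_eqF.
have [N hN] := pr_base_ge.
have pB m : (N <= m)%N -> 0 < pr (B m).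
  move=> lm; have := hN m lm; case: (ltrP 0 (pr (B m))) => // p0.
  have -> : pr (B m) = 0 by apply/eqP; rewrite eq_le p0 pr_ge0.
  by rewrite mulr0 ler10.
have meet m m' (i j : int) : (N <= m)%N -> m' = m \/ m' = m.+1 ->
    pr [set x | B m x /\ ~ B m (z i (S x))] <= e0 * pr (B m) ->
    pr [set x | B m' x /\ ~ B m' (z j (S x))] <= e0 * pr (B m') ->
    exists x, B m (z i x) /\ B m (z j x).
  move=> lm hm' h1 h2; apply: contrapT => nex.
  have mm' : (m <= m')%N by case: hm' => ->.
  have sub y : B m' y -> B m y.
    by move=> By; have := @base_sub m m' 0 y mm'; rewrite blk0; apply.
  have p0 := pB m lm.
  have up : pr (B m) <= qM%:R * pr (B m').
    rewrite (pr_base_sub mm') ler_wpM2r ?pr_ge0 // ler_nat.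
    case: hm' => ->; last by rewrite QnS mulKn ?Qn_gt0.
    by rewrite divnn Qn_gt0 //; have := qM_gt1 q_gt1 q_le; lia.
  have : pr (B m') <= e0 * pr (B m) + e0 * pr (B m').
    apply: le_trans (lerD h1 h2); apply: le_trans (pr_leU mu1 _ _).
    apply: le_pr => // x Bx; apply: contrapT => nU; apply: nex; exists (S x); split.
      by apply: contrapT => nB; apply: nU; left; split=> //; apply: sub.
    by apply: sub; apply: contrapT => nB; apply: nU; right.
  have p1 := pr_ge0 mu1 (B m').
  have := ler_wpM2l (ltW e00) up; rewrite mulrA e0q => l1 l2.
  have : e0 <= 1 / 4 by rewrite -e0q ler_peMr ?(ltW e00) //; lra.
  have : 0 < pr (B m') by nra.
  nra.
have [m0 hm0] := aligned_mostly e00.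
pose m1 := (m0 + N)%N.
have same m m' (i j : int) : (m1 <= m)%N -> m' = m \/ m' = m.+1 ->
    (4 * `|i| <= h m)%N -> (4 * `|j| <= h m)%N ->
    pr [set x | B m x /\ ~ B m (z i (S x))] <= e0 * pr (B m) ->
    pr [set x | B m' x /\ ~ B m' (z j (S x))] <= e0 * pr (B m') -> i = j.
  move=> lm hm' li lj h1 h2.
  have [x [Bi Bj]] := meet m m' i j ltac:(lia) hm' h1 h2.
  by apply: (offset_eq _ Bi Bj); have := bheight_gt0 q c m; lia.
have pred_le m i : (4 * i <= h m.-1)%N -> (4 * i <= h m)%N.
  by move=> l; apply: leq_trans l _; apply: leq_bheight; rewrite // leq_pred.
have [j0 [lj0 hj0]] := hm0 m1 ltac:(lia).
have const m : (m1 <= m)%N -> (4 * `|j0| <= h m)%N /\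
    pr [set x | B m x /\ ~ B m (z j0 (S x))] <= e0 * pr (B m).
  move/subnKC <-; elim: (m - m1)%N => [|k [l1 h1]].
    by rewrite addn0; split=> //; apply: pred_le.
  rewrite addnS; have [j [lj hj]] := hm0 (m1 + k).+1 ltac:(lia).
  have e : j0 = j by apply: (same (m1 + k)%N (m1 + k).+1) => //; [lia | right].
  by rewrite e; split=> //; apply: pred_le.
exists j0 => e ep; pose e1 := Num.min e e0.
have e1p : 0 < e1 by rewrite lt_min ep.
have [m2 hm2] := aligned_mostly e1p; exists (m1 + m2)%N => m lm.
have [j [lj hj]] := hm2 m ltac:(lia); have [l0 h0] := const m ltac:(lia).
have pm := pr_ge0 mu1 (B m).
have -> : j0 = j.
  apply: (same m m) => //; [by lia | by left | exact: pred_le |].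
  by apply: le_trans hj _; rewrite ler_wpM2r // ge_min lexx orbT.
by apply: le_trans hj _; rewrite ler_wpM2r // ge_min lexx.
Qed.

(** Commutation carries the near invariance of [B m] to all its levels, so every union of levels is
    nearly invariant, and these approximate A. One inclusion suffices, as complements give the
    other. *)
Theorem commuting_power : exists j : int, forall A, measurable A ->
  pr (A `\` (z j \o S) @^-1` A) = 0.
Proof.
have [j hj] := common_offset; exists j => A mA; set U := z j \o S.
have mU : mp mu mu U by apply: mp_comp mS _; apply: mp_ziter.
apply/eqP; rewrite eq_le pr_ge0 // andbT; apply/ler_addgt0Pr => e e0; rewrite add0r.
have e3 : 0 < e / 3 by rewrite divr_gt0.
have [N1 hN1] := dense_level_union mA e3; have [N2 hN2] := hj _ e3.
pose m := maxn N1 N2; have [W hW] := hN1 m (leq_maxl _ _).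
have hB := hN2 m (leq_maxr _ _); set D := [set x | _] in hB.
pose L := level_union m W.
have nAL : nm mu (A `+` L) by apply: nmY; [exact: nm_measurable | exact: nm_level_union].
have hL : pr (L `\` U @^-1` L) <= e / 3.
  apply: (@le_trans _ _ (pr ((\bigcup_(k in [set k | (k < h m)%N]) iter k Ti @^-1` D) `|`
      [set x | exists k, (iter k Ti @^-1` (~` commuting_orbit)) x]))).
    apply: le_pr => // x [[k /= lk]]; case Wk: (W k) => // Lx nUx.
    case: (pselect (commuting_orbit (iter k Ti x))) => cx; last by right; exists k.
    left; exists k => //=; split; first exact: Lx.
    move=> hB'; apply: nUx; exists k => //=; rewrite Wk /level /= /U /=.
    have -> : S x = iter k T (S (iter k Ti x)) by rewrite -cx iterVK.
    have -> : z j (iter k T (S (iter k Ti x))) = iter k T (z j (S (iter k Ti x))).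
      by rewrite -!(@ziter_pos _ T Ti) -!ziterD // addrC.
    by rewrite iterK.
  apply: le_trans (pr_leU mu1 _ _) _.
  rewrite [X in _ + X]((pr_null mu1 _).1 _) ?addr0; last first.
    apply: negligible_ex => k; apply: (mp_null mu1 mu1 (mp_iter k mTi)).
    exact: commuting_orbit_full.
  apply: le_trans (pr_le_bigU mu1 _ _) _.
  apply: (@le_trans _ _ (\sum_(k < h m) pr D)).
    by apply: ler_sum => k _; apply: (mp_le mu1 mu1 _ (mp_iter k mTi)).
  rewrite sumr_const card_ord -[leLHS]mulr_natl.
  apply: (@le_trans _ _ ((h m)%:R * (e / 3 * pr (B m)))); first by rewrite ler_wpM2l.
  have := ler_wpM2l (ltW e3) (pr_base_le m); rewrite mulr1; lra.
have hUA : pr (U @^-1` (A `+` L)) <= e / 3 by have [_ ->] := mU _ nAL.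
apply: (@le_trans _ _ (pr (((A `+` L) `|` (L `\` U @^-1` L)) `|` U @^-1` (A `+` L)))).
  apply: le_pr => // x; rewrite /setY /=.
  by case: (pselect (L x)); case: (pselect (L (U x))); case: (pselect (A (U x))); tauto.
apply: le_trans (pr_leU mu1 _ _) _.
have := pr_leU mu1 (A `+` L) (L `\` U @^-1` L); lra.
Qed.

End Commuting.

(** * Rigid times and limits of powers *)

Section Rigid.

Hypothesis stretches : forall n0 m, exists2 n, (n0 <= n)%N &
  simple_stretch c (Q n) (Q (n + m)).

Definition same_level n g := [set x | exists k,
  [/\ (k < h n)%N, level n k x & level n k (iter g T x)]].

(** When the n-blocks of a tower are equally spaced by g, the g-th power of T moves each level of an
    n-block to the same level of the next. Apart from points outside the n-th tower, only the last
    n-block fails, and its measure [h n * pr (B L)] is at most [h n / h L]. *)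
Lemma rigid_time (e : R) n0 : 0 < e -> exists n g,
  [/\ (n0 <= n)%N, (0 < g)%N & pr (~` same_level n g) <= e].
Proof.
move=> e0; have e2 : 0 < e / 2 by rewrite divr_gt0.
have [N hN] := tower_full e2.
have [k] := ltr_add_invr e2; rewrite add0r => hk.
have [n ln st] := stretches (n0 + N) k.+1.
have nL : (n <= n + k.+1)%N by exact: leq_addr.
set L := (n + k.+1)%N in nL st; set w := (Q L %/ Q n)%N in st.
have w2 : (1 < w)%N.
  rewrite leq_divRL ?Qn_gt0 //; apply: leq_trans (leq_Qn_add q_gt1 n k.+1).
  by rewrite mulnC leq_mul2l expnS leq_pmulr ?orbT // expn_gt0.
pose g := (h n + c (Q n * 1))%N.
have step t : (t.+1 < w)%N -> blk n t.+1 = (blk n t + g)%N.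
  by move=> lt; rewrite blkS // (st t.+1 1%N) // addnA.
have g0 : (0 < g)%N by rewrite addn_gt0.
move: g g0 step => g g0 step; exists n, g; split=> //; first by lia.
apply: (@le_trans _ _ (pr ((~` tower n) `|`
    \bigcup_(i in [set i | (i < h n)%N]) level L (blk n w.-1 + i)))).
  apply: le_pr => // x nx; case: (pselect (tower n x)) => [[i /= li Li]|]; last by left.
  right; have [t [lt Lt]] := level_up nL li Li; exists i => //.
  have -> : w.-1 = t; last by [].
  have tw : (t < w)%N by rewrite -blk_ltnP //; lia.
  apply/eqP; rewrite eqn_leq; apply/andP; split; last by lia.
  rewrite leqNgt; apply/negP => tw'; apply: nx; exists i; split=> //.
  have tw1 : (t.+1 < w)%N by lia.
  have := @base_sub n L t.+1 (iter (blk n t + i) Ti x) nL.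
  rewrite blk_ltnP // => /(_ tw1 Lt); rewrite step // /level /= => Bg.
  rewrite (_ : iter i Ti _ = iter (blk n t + g) T (iter (blk n t + i) Ti x)) //.
  rewrite !(@iter_ziterN _ T Ti) -!(@ziter_pos _ T Ti) -!(ziterD TK TiK); congr (z _ x); lia.
apply: le_trans (pr_leU mu1 _ _) _.
have h1 : pr (~` tower n) <= e / 2.
  have := hN n ltac:(lia); rewrite prC //; first by lra.
  by apply: nm_bigcup_cond => i _; apply: nm_level.
have h2 : pr (\bigcup_(i in [set i | (i < h n)%N]) level L (blk n w.-1 + i)) <= (h n)%:R * pr (B L).
  apply: le_trans (pr_le_bigU mu1 _ _) _; rewrite (eq_bigr (fun=> pr (B L))) => [|i _].
    by rewrite sumr_const card_ord -[leLHS]mulr_natl.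
  by rewrite pr_level.
have h3 : (h n)%:R * pr (B L) <= k.+1%:R^-1.
  rewrite -[leRHS]mul1r ler_pdivlMr //; apply: le_trans (pr_base_le L).
  rewrite mulrAC mulrC ler_wpM2l ?pr_ge0 // -natrM ler_nat.
  apply: leq_trans (leq_bheight_add q_gt1 c_mod n k.+1).
  by rewrite leq_mul2l (ltnW (ltn_expl _ _)) ?orbT.
have h4 := le_trans h3 (ltW hk); lra.
Qed.

(** The bound [m k + k <= n k] keeps the accumulated exponent small compared with the tower of the
    next rigid time. The exponent [k.+2] is chosen so that two approximation errors and one change
    of level stay below (1/2) ^ k. *)
Lemma rigid_sequence (A : nat -> set X) : (forall i, measurable (A i)) ->
  exists n g m : nat -> nat,
    [/\ m 0%N = 0%N, forall k, m k.+1 = (m k + g k)%N /\ (0 < g k)%N,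
      forall k, (n k <= n k.+1)%N /\ (m k + k <= n k)%N,
      forall k, pr (~` same_level (n k) (g k)) <= (1 / 2) ^+ k.+2 &
      forall i k, (i <= k)%N -> pr (iter (g k) T @^-1` A i `+` A i) <= (1 / 2) ^+ k].
Proof.
move=> mA; pose ok b k n g := [/\ (b <= n)%N, (0 < g)%N,
  pr (~` same_level n g) <= (1 / 2) ^+ k.+2 &
  forall i, (i <= k)%N -> pr (iter g T @^-1` A i `+` A i) <= (1 / 2) ^+ k].
have half k : 0 < (1 / 2) ^+ k :> R by rewrite exprn_gt0 // divr_gt0.
have ex b k : exists n, exists g, ok b k n g.
  have /choice [N hN] i : exists N, forall n, (N <= n)%N ->
      exists W, pr (A i `+` level_union n W) <= (1 / 2) ^+ k.+2.
    exact: dense_level_union.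
  have [n [g [ln g0 hg]]] := rigid_time (b + \sum_(i < k.+1) N i) (half k.+2).
  exists n, g; split=> // [|i ik]; first by lia.
  have Ni : (N i <= n)%N.
    apply: leq_trans ln; apply: leq_trans (leq_addl _ _).
    have lk : (i < k.+1)%N by rewrite ltnS.
    by rewrite (bigD1 (Ordinal lk)) //= leq_addr.
  have [W hW] := hN i n Ni; set L := level_union n W in hW.
  have nL : nm mu (A i `+` L) by apply: nmY; [exact: nm_measurable | exact: nm_level_union].
  have hg2 : pr (iter g T @^-1` (A i `+` L)) <= (1 / 2) ^+ k.+2.
    by have [_ ->] := mp_iter g mT nL.
  apply: (@le_trans _ _ (pr ((iter g T @^-1` (A i `+` L) `|` (A i `+` L)) `|` ~` same_level n g))).
    apply: le_pr => // x hx; case: (pselect (same_level n g x)) => [[j [lj Lj Ljg]]|]; last by right.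
    have E : L x <-> L (iter g T x).
      split=> -[j' /= lj']; case Wj: (W j') => // Lj'; exists j' => //=; rewrite Wj.
        by rewrite (level_inj lj' lj Lj' Lj).
      by rewrite (level_inj lj' lj Lj' Ljg).
    left; move: hx; rewrite /setY /=.
    by case: (pselect (L x)); case: (pselect (A i x)); case: (pselect (A i (iter g T x))); tauto.
  apply: le_trans (pr_leU mu1 _ _) _.
  apply: le_trans (lerD (pr_leU mu1 _ _) (lexx _)) _.
  have := half k; move: hW hg hg2; rewrite !exprS; lra.
have /choice [F hF] (p : nat * nat) : exists r : nat * nat, ok p.1 p.2 r.1 r.2.
  by have [n [g hng]] := ex p.1 p.2; exists (n, g).
(* The state consists of m k and of a lower bound for n k; passing their sum to F makes n k exceed m
   k + k. *)
pose st := fix st k : nat * nat := if k is k'.+1 then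
    let r := F ((st k').2 + (st k').1, k') in
    ((st k').1 + r.2, r.1 + k'.+1 + r.2)%N else (0, 0)%N.
pose r k := F ((st k).2 + (st k).1, k)%N.
have hr k := hF ((st k).2 + (st k).1, k)%N; rewrite -/(r _) /= in hr.
have hl k : ((st k).2 + (st k).1 <= (r k).1)%N by have [] := hr k.
have E1 k : st k.+1 = ((st k).1 + (r k).2, (r k).1 + k.+1 + (r k).2)%N by [].
exists (fun k => (r k).1), (fun k => (r k).2), (fun k => (st k).1); split=> //.
- by move=> k; split=> //; have [] := hr k.
- move=> k; split; first by have := hl k.+1; rewrite E1 /=; clear; lia.
  by case: k => [|k] //; have := hl k.+1; rewrite E1 /=; clear; lia.
- by move=> k; have [] := hr k.
- by move=> i k; have [_ _ _] := hr k; apply.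
Qed.

Lemma same_level_coarser n n' g k x : (n <= n')%N -> (k < h n)%N ->
  same_level n' g x -> level n k x -> level n k (iter g T x).
Proof.
move=> nn' lk [k' [lk' L1 L2]] Lx; have [s [ls Ls]] := level_up nn' lk Lx.
by apply: (level_down nn' ls); rewrite (level_inj ls lk' Ls L1).
Qed.

(** If S were the l-th power and |l| <= k, then for some x the point reached at time m k lies on a
    level of the tower n k that the later rigid times preserve, so S x lies on that level too.
    Visits to one level at times l and m k, with |l| + m k below the height, force l = m k. This
    cannot hold for both k = |l| and k = |l| + 1, since m increases. *)
Lemma rigid_limit_not_power (n g m : nat -> nat) (S : X -> X) (l : int) :
  (forall k, m k.+1 = (m k + g k)%N /\ (0 < g k)%N) ->
  (forall k, (n k <= n k.+1)%N /\ (m k + k <= n k)%N) ->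
  (forall k, pr (~` same_level (n k) (g k)) <= (1 / 2) ^+ k.+2) ->
  (forall A, nm mu A -> forall e : R, 0 < e -> exists j0, forall j, (j0 <= j)%N ->
     pr (S @^-1` A `+` iter (m j) T @^-1` A) <= e) ->
  ~ mu.-negligible [set x | S x <> z l x].
Proof.
move=> hm hn hs hS nl.
have nmono i j : (i <= j)%N -> (n i <= n j)%N.
  by move/subnKC <-; elim: (j - i)%N => [|p IH]; rewrite ?addn0 // addnS (leq_trans IH) //; case: (hn (i + p)%N).
suff main k : (`|l| <= k)%N -> l = (m k)%:Z.
  have e1 := main `|l|%N (leqnn _); have e2 := main `|l|.+1 (leqnSn _).
  by have [] := hm `|l|%N; lia.
move=> lk; set N := n k.
have [j0 hj0] : exists j0, forall j, (j0 <= j)%N -> forall i, (i < h N)%N ->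
    pr (S @^-1` level N i `+` iter (m j) T @^-1` level N i) <= 1 / (8 * (h N)%:R).
  have hp : 0 < 1 / (8 * (h N)%:R) :> R by rewrite divr_gt0 // mulr_gt0 // ltr0n.
  have /choice [f hf] i := hS _ (nm_level N i) _ hp.
  exists (\sum_(i < h N) f i)%N => j lj i li; apply: hf; apply: leq_trans lj.
  by rewrite (bigD1 (Ordinal li)) //= leq_addr.
pose j := (k + j0)%N.
(* The three sets collect failures of later rigid times, poor convergence on the levels at time m j,
   and failure at time m k itself. Their measures are at most 1/2, 1/8 and 1/4, so some point avoids
   all of them. *)
pose bad1 := \bigcup_(i in [set i | (i < j0)%N]) (iter (m (k + i)%N) T @^-1` ~` same_level (n (k + i)%N) (g (k + i)%N)).
pose bad2 := \bigcup_(i in [set i | (i < h N)%N]) (S @^-1` level N i `+` iter (m j) T @^-1` level N i).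
pose bad3 := iter (m k) T @^-1` (~` same_level N (g k)).
have b1 : pr bad1 <= (1 / 2) ^+ k.+1.
  apply: le_trans (pr_le_bigU mu1 _ _) _.
  apply: (@le_trans _ _ (\sum_(i < j0) (1 / 2) ^+ (k.+2 + i))).
    by apply: ler_sum => i _; apply: le_trans (mp_le mu1 mu1 _ (mp_iter _ mT)) _; apply: hs.
  apply: le_trans (sum_half_le R _ _) _; rewrite exprS; lra.
have b2 : pr bad2 <= 1 / 8.
  apply: le_trans (pr_le_bigU mu1 _ _) _.
  apply: (@le_trans _ _ (\sum_(i < h N) (1 / (8 * (h N)%:R)))).
    by apply: ler_sum => i _; apply: hj0 => //; apply: leq_addl.
  rewrite sumr_const card_ord -[leLHS]mulr_natl.
  have hh : (h N)%:R != 0 :> R by rewrite pnatr_eq0.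
  by rewrite (_ : _ * _ = 1 / 8) //; field.
have b3 : pr bad3 <= (1 / 2) ^+ k.+2.
  by apply: le_trans (mp_le mu1 mu1 _ (mp_iter _ mT)) _; apply: hs.
have small p : (1 / 2) ^+ p <= 1 :> R by rewrite exprn_ile1 // ?divr_ge0 //; lra.
have [x [nx1 nx2 nx3 nx4]] : exists x, [/\ ~ bad1 x, ~ bad2 x, ~ bad3 x & S x = z l x].
  apply: contrapT => nex.
  have : pr setT <= pr (((bad1 `|` bad2) `|` bad3) `|` [set x | S x <> z l x]).
    apply: le_pr => // x _; apply: contrapT => nU; apply: nex; exists x; split.
    - by move=> b; apply: nU; left; left; left.
    - by move=> b; apply: nU; left; left; right.
    - by move=> b; apply: nU; left; right.
    - by apply: contrapT => b; apply: nU; right.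
  have u1 := pr_leU mu1 ((bad1 `|` bad2) `|` bad3) [set x | S x <> z l x].
  have u2 := pr_leU mu1 (bad1 `|` bad2) bad3; have u3 := pr_leU mu1 bad1 bad2.
  rewrite pr_setT // => u4; move: u1; rewrite ((pr_null mu1 _).1 nl) addr0 => u1.
  have := small k; move: b1 b3; rewrite !exprS; lra.
have [r [lr Lr _]] : same_level N (g k) (iter (m k) T x).
  by apply: contrapT => ns; apply: nx3.
have Lj i : (i <= j0)%N -> level N r (iter (m (k + i)%N) T x).
  elim: i => [|i IH] li; first by rewrite addn0.
  have si : same_level (n (k + i)%N) (g (k + i)%N) (iter (m (k + i)%N) T x).
    by apply: contrapT => ns; apply: nx1; exists i.
  have [e _] := hm (k + i)%N; rewrite addnS e addnC iterD.
  by apply: same_level_coarser si (IH (ltnW li)) => //; apply: nmono; apply: leq_addr.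
have Sr : level N r (S x).
  apply: contrapT => ns; apply: nx2; exists r => //; right; split=> //.
  exact: Lj.
move: Lr Sr; rewrite nx4 /level /= !(@iter_ziterN _ T Ti) -!(@ziter_pos _ T Ti) -!(ziterD TK TiK) ![- _ + _]addrC !(ziterD TK TiK).
move=> B1 B2; apply: (@offset_eq N (z (- r%:Z) x)) => //.
have [_ lnk] := hn k; have := ltn_bheight q_gt1 c_mod N; rewrite /N; lia.
Qed.

End Rigid.

End TowerFacts.

(** * Limits of measure preserving maps of the unit interval *)

Section UnitInterval.
Local Open Scope classical_set_scope.
Local Open Scope ring_scope.

Variable R : realType.

Local Notation Y := (measurableTypeR R).
Local Notation nu := (unit_lebesgue R).
Local Notation pr := (pr nu).

Definition halfline (r : R) : set Y := [set x | (x : R) <= r].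

Lemma halflineE r : halfline r = `]-oo, r]%classic.
Proof. by apply/seteqP; split=> x; rewrite /halfline /= in_itv. Qed.

Lemma measurable_halfline r : measurable (halfline r).
Proof. by rewrite halflineE; exact: measurable_itv. Qed.

Lemma unit_lebesgueE (A : set Y) : nu A = @lebesgue_measure R (A `&` `[0%R, 1%R]%classic).
Proof. by []. Qed.

Lemma unit_lebesgue_setT : nu setT = 1%E.
Proof.
rewrite unit_lebesgueE setTI lebesgue_measure_itv /= lte_fin ltr01.
by rewrite sube0.
Qed.

Local Notation nu1 := unit_lebesgue_setT.

Lemma unit_lebesgue_full : nu.-negligible (~` [set x : Y | 0 <= (x : R) <= 1]).
Proof.
have mI : measurable ([set x : Y | 0 <= (x : R) <= 1]).
  rewrite (_ : [set x | _] = `[0%R, 1%R]%classic); first exact: measurable_itv.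
  by apply/seteqP; split=> x /=; rewrite in_itv.
apply/negligibleP; first exact: measurableC.
apply: etrans (unit_lebesgueE _) _; rewrite (_ : _ `&` _ = set0) ?measure0 //.
by apply/seteqP; split=> x //= [h]; rewrite in_itv /= => h'; apply: h.
Qed.

Lemma pr_halflineD r s : r <= s -> pr (halfline s `\` halfline r) <= s - r.
Proof.
move=> rs.
have mD : measurable (halfline s `\` halfline r).
  by apply: measurableD; exact: measurable_halfline.
rewrite (prE nu1) // -lee_fin fineK ?(mu_fin_num nu1) //.
have E : halfline s `\` halfline r = `]r, s]%classic.
  apply/seteqP; split=> x; rewrite /halfline /= in_itv /=.
    by move=> [-> /negP]; rewrite -ltNge => ->.
  by move=> /andP[rx ->]; split=> //; apply/negP; rewrite -ltNge.
rewrite E unit_lebesgueE.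
apply: le_trans (_ : _ <= @lebesgue_measure R `]r, s]%classic)%E _.
  apply: le_measure; rewrite ?inE; [| exact: measurable_itv | exact: subIsetl].
  by apply: measurableI; exact: measurable_itv.
rewrite lebesgue_measure_itv /= lte_fin; case: ifP => _; first by rewrite -EFinB.
by rewrite lee_fin subr_ge0.
Qed.

Lemma ae_eq_halflines d (X : measurableType d) (mu : {measure set X -> \bar R}) (f g : X -> Y) :
  (forall r : rat, mu.-negligible (f @^-1` halfline (ratr r) `+` g @^-1` halfline (ratr r))) ->
  mu.-negligible [set x | f x <> g x].
Proof.
move=> h; apply: (@negligibleS _ _ _ _ [set x | exists r : rat,
    (f @^-1` halfline (ratr r) `+` g @^-1` halfline (ratr r)) x]); last exact: negligible_ex.
move=> x /= /eqP; rewrite neq_lt => /orP [] lt; have [r] := rat_in_itvoo lt;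
  rewrite in_itv /= => /andP[l1 l2]; exists r; rewrite /setY /halfline /=.
  by left; split; [exact: ltW | apply/negP; rewrite -ltNge].
by right; split; [exact: ltW | apply/negP; rewrite -ltNge].
Qed.

Lemma half_small (e : R) : 0 < e -> exists k0, forall k, (k0 <= k)%N -> (1 / 2 : R) ^+ k <= e.
Proof.
move=> e0; have [k] := ltr_add_invr e0; rewrite add0r => hk.
exists k.+1 => p lp; apply: le_trans (ltW hk).
apply: (@le_trans _ _ ((1 / 2) ^+ k.+1)); first by apply: ler_wiXn2l; rewrite ?divr_ge0 //; lra.
rewrite div1r exprVn lef_pV2 ?posrE ?exprn_gt0 ?ltr0n // -natrX ler_nat.
exact: ltnW (ltn_expl _ _).
Qed.

Section Limit.

Variable f : nat -> Y -> Y.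
Hypothesis mf : forall k, mp nu nu (f k).
Hypothesis cauchy : forall r : rat, exists k0, forall k, (k0 <= k)%N ->
  pr (f k.+1 @^-1` halfline (ratr r) `+` f k @^-1` halfline (ratr r)) <= (1 / 2) ^+ k.

Definition eventually_below r := [set x | exists k0, forall k, (k0 <= k)%N -> f k x <= ratr r].

(** For a bounded sequence [f k x], the infimum of its eventual rational upper bounds is its upper
    limit. *)
Definition limit_map : Y -> Y := fun x => inf [set ratr r | r in [set r | eventually_below r x]].

Definition converges_on A := nm nu (limit_map @^-1` A) /\ forall e : R, 0 < e ->
  exists k0, forall k, (k0 <= k)%N -> pr (limit_map @^-1` A `+` f k @^-1` A) <= e.

Lemma nm_preimage k A : nm nu A -> nm nu (f k @^-1` A).
Proof. by move=> nA; have [] := mf k nA. Qed.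

Lemma nm_eventually_below r : nm nu (eventually_below r).
Proof.
rewrite (_ : eventually_below r = \bigcup_k0 ~` \bigcup_k
    (if (k0 <= k)%N then ~` (f k @^-1` halfline (ratr r)) else set0)).
  apply: nm_bigcup => k0; apply: nmC; apply: nm_bigcup => k; case: ifP => _.
    apply: nmC; exact: (nm_preimage k (nm_measurable nu (measurable_halfline _))).
  exact/nm_measurable.
apply/seteqP; split=> x.
  by move=> [k0 h]; exists k0 => // -[k _]; case: ifP => // /h.
move=> [k0 _ h]; exists k0 => k lk; apply: contrapT => nf; apply: h; exists k => //.
by rewrite lk.
Qed.

Lemma eventually_below_close r : exists k0, forall k, (k0 <= k)%N ->
  pr (eventually_below r `+` f k @^-1` halfline (ratr r)) <= (1 / 2) ^+ k *+ 2.
Proof.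
have [k0 h] := cauchy r; exists k0 => k lk.
pose D i := f (k + i).+1 @^-1` halfline (ratr r) `+` f (k + i)%N @^-1` halfline (ratr r).
apply: (@le_trans _ _ (pr (\bigcup_i D i))); last first.
  apply: (pr_le_bigcup nu1) => n; apply: le_trans (sum_half_le R k n).
  by apply: ler_sum => i _; apply: h; apply: leq_trans lk (leq_addr _ _).
apply: (le_pr nu1) => x; apply: contraPP => nD.
have E i : (f (k + i)%N x <= ratr r) <-> (f k x <= ratr r).
  elim: i => [|i IH]; first by rewrite addn0.
  rewrite -IH addnS; split=> hx; apply: contrapT => nx; apply: nD; exists i => //.
    by left.
  by right.
move=> [[[k1 h1] nf]|[hf ne]].
  by apply: nf; apply/(E k1); apply: h1; apply: leq_addl.
by apply: ne; exists k => p lp; rewrite -(subnKC lp); apply/E.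
Qed.

Lemma eventually_below_mono r s x : ratr r <= ratr s :> R ->
  eventually_below r x -> eventually_below s x.
Proof. by move=> rs [k0 h]; exists k0 => k /h lk; apply: le_trans rs. Qed.

(** Where all [f k x] lie in [0,1], the limit is at most r exactly when every rational s > r is
    eventually an upper bound. Requiring r itself to be one changes only a null set, because the
    [f k] preserve measure and the half-lines at r and s differ by measure at most s - r. *)
Lemma limit_map_below r :
  nu.-negligible (limit_map @^-1` halfline (ratr r) `+` eventually_below r).
Proof.
pose X1 := [set x | forall k, 0 <= (f k x : R) <= 1].
have nX1 : nu.-negligible (~` X1).
  apply: (@negligibleS _ _ _ _ [set x | exists k, (f k @^-1` (~` [set x : Y | 0 <= (x : R) <= 1])) x]).
    by move=> x /= h; apply: contrapT => nex; apply: h => k; apply: contrapT => nf; apply: nex; exists k.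
  by apply: negligible_ex => k; apply: (mp_null nu1 nu1 (mf k)); apply: unit_lebesgue_full.
pose E := [set x | (forall s, ratr r < ratr s :> R -> eventually_below s x) /\ ~ eventually_below r x].
have nE : nu.-negligible E.
  apply/(pr_null nu1); apply/eqP; rewrite eq_le pr_ge0 ?nu1 // andbT.
  apply/ler_addgt0Pr => e e0; rewrite add0r.
  have e2 : 0 < e / 2 by rewrite divr_gt0.
  have e8 : 0 < e / 8 by rewrite divr_gt0.
  have [s] := @rat_in_itvoo R (ratr r) (ratr r + e / 2) ltac:(by rewrite ltrDl).
  rewrite in_itv /= => /andP[rs se].
  have [k1 h1] := eventually_below_close r; have [k2 h2] := eventually_below_close s.
  have [k3 h3] := half_small e8; pose k := (k1 + k2 + k3)%N.
  have := h1 k ltac:(lia); have := h2 k ltac:(lia); have := h3 k ltac:(lia).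
  set F1 := _ `+` f k @^-1` halfline (ratr s); set F2 := _ `+` f k @^-1` halfline (ratr r).
  move=> l3 l2 l1.
  have l4 : pr (f k @^-1` (halfline (ratr s) `\` halfline (ratr r))) <= ratr s - ratr r.
    by apply: le_trans (mp_le nu1 nu1 _ (mf k)) (pr_halflineD (ltW rs)).
  apply: (@le_trans _ _ (pr ((F1 `|` F2) `|` f k @^-1` (halfline (ratr s) `\` halfline (ratr r))))).
    apply: (le_pr nu1) => x [hs nr]; have := hs s rs => es; rewrite /F1 /F2 /setY /=.
    case: (pselect (halfline (ratr s) (f k x))); case: (pselect (halfline (ratr r) (f k x))); tauto.
  apply: le_trans (pr_leU nu1 _ _) _.
  have := pr_leU nu1 F1 F2; move: l1 l2; rewrite !mulr2n; lra.
apply: (@negligibleS _ _ _ _ (~` X1 `|` E)); last exact: negligibleU.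
move=> x hx; case: (pselect (X1 x)) => X1x; last by left.
right; have lb s : eventually_below s x -> 0 <= ratr s :> R.
  by move=> [k0 h]; apply: le_trans (h k0 (leqnn _)); case/andP: (X1x k0).
have hi : has_inf [set (ratr s : R) | s in [set s | eventually_below s x]].
  split; first by exists (ratr 1), 1 => //; exists 0%N => k _; rewrite rmorph1; case/andP: (X1x k).
  by exists 0 => _ [s hs <-]; apply: lb.
case: hx => [[hL ne]|[he nL]]; last first.
  by exfalso; apply: nL; apply: inf_lbound; [case: hi | exists r].
split=> // s rs.
have [|_ [s' es' <-] ls'] := @inf_adherent R _ (ratr s - ratr r) _ hi; first by rewrite subr_gt0.
apply: eventually_below_mono es'; apply: ltW; apply: lt_le_trans ls' _.
by rewrite -lerBrDr opprB addrC subrK.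
Qed.

Lemma converges_halfline r : converges_on (halfline (ratr r)).
Proof.
have nr := limit_map_below r; split.
  have [B mB nB] := nm_eventually_below r; exists B => //.
  apply: (@negligibleS _ _ _ _ ((limit_map @^-1` halfline (ratr r) `+` eventually_below r) `|`
      (eventually_below r `+` B))); last exact: negligibleU.
  by move=> x; rewrite /setY /=; case: (pselect (eventually_below r x)); tauto.
move=> e e0; have e2 : 0 < e / 2 by rewrite divr_gt0.
have [k1 h1] := half_small e2; have [k2 h2] := eventually_below_close r.
exists (k1 + k2)%N => k lk.
apply: (@le_trans _ _ (pr ((limit_map @^-1` halfline (ratr r) `+` eventually_below r) `|`
    (eventually_below r `+` f k @^-1` halfline (ratr r))))).
  by apply: (le_pr nu1) => x; rewrite /setY /=; case: (pselect (eventually_below r x)); tauto.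
apply: le_trans (pr_leU nu1 _ _) _; rewrite ((pr_null nu1 _).1 nr) add0r.
have := h1 k ltac:(lia); have := h2 k ltac:(lia); rewrite mulr2n; lra.
Qed.

Lemma converges_pr A : nm nu A -> converges_on A -> pr (limit_map @^-1` A) = pr A.
Proof.
move=> nA [nL hA].
have half B C : pr B <= pr C + pr (B `+` C).
  apply: le_trans (pr_leU nu1 _ _); apply: (le_pr nu1) => x Bx; rewrite /setY /=.
  by case: (pselect (C x)); tauto.
apply/eqP; rewrite eq_le; apply/andP; split; apply/ler_addgt0Pr => e e0;
  have [k h] := hA e e0; have := h k (leqnn _); have [_ <-] := mf k nA => l.
  by apply: le_trans (half _ _) (lerD (lexx _) l).
apply: le_trans (half _ (limit_map @^-1` A)) _.
by rewrite setYC lerD2l.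
Qed.

Lemma convergesC A : converges_on A -> converges_on (~` A).
Proof.
move=> [nL hA]; split; first exact: nmC.
move=> e e0; have [k0 h] := hA e e0; exists k0 => k lk; apply: le_trans (h k lk).
apply: (le_pr nu1) => x; rewrite /setY /=.
by case: (pselect (A (limit_map x))); case: (pselect (A (f k x))); tauto.
Qed.

Lemma convergesU A B : converges_on A -> converges_on B -> converges_on (A `|` B).
Proof.
move=> [nA hA] [nB hB]; split; first exact: nmU.
move=> e e0; have e2 : 0 < e / 2 by rewrite divr_gt0.
have [k1 h1] := hA _ e2; have [k2 h2] := hB _ e2; exists (k1 + k2)%N => k lk.
have := h1 k ltac:(lia); have := h2 k ltac:(lia).
set F1 := _ `+` _; set F2 := _ `+` _ => l1 l2.
apply: (@le_trans _ _ (pr (F1 `|` F2))); last by have := pr_leU nu1 F1 F2; lra.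
apply: (le_pr nu1) => x; rewrite /F1 /F2 /setY /=.
by case: (pselect (A (limit_map x))); case: (pselect (B (limit_map x))); tauto.
Qed.

Lemma converges0 : converges_on set0.
Proof.
split; first by rewrite preimage_set0; exact: nm_measurable.
by move=> e e0; exists 0%N => k _; rewrite !preimage_set0 setYK (pr_set0 nu1) ltW.
Qed.

Lemma convergesD A B : converges_on A -> converges_on B -> converges_on (A `\` B).
Proof.
move=> hA hB; rewrite setDE -[A `&` _]setCK setCI setCK; apply: convergesC.
by apply: convergesU => //; apply: convergesC.
Qed.

Lemma converges_bigU n (F : nat -> set Y) : (forall i, converges_on (F i)) ->
  converges_on (\bigcup_(i in [set i | (i < n)%N]) F i).
Proof.
move=> hF; elim: n => [|n IH].
  by rewrite (_ : bigcup _ _ = set0) -?subset0 => [|x []//]; exact: converges0.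
rewrite (_ : bigcup _ _ = (\bigcup_(i in [set i | (i < n)%N]) F i) `|` F n); first exact: convergesU.
apply/seteqP; split=> x [].
- move=> i /=; rewrite ltnS leq_eqVlt => /predU1P [->|li] Fx; [by right | by left; exists i].
- by move=> [i /= li Fx]; exists i => //=; apply: ltnW.
- by move=> Fx; exists n => /=.
Qed.

(** The tail of the union is small, hence small after pulling back by [f k]. That [limit_map]
    preserves measure is not yet known for the tail, so the tail is cut into disjoint pieces, on
    each of which [converges_pr] applies. *)
Lemma converges_bigcup (F : nat -> set Y) :
  (forall i, measurable (F i)) -> (forall i, converges_on (F i)) ->
  converges_on (\bigcup_i F i).
Proof.
move=> mF hF; split.
  by rewrite preimage_bigcup; apply: nm_bigcup => i; case: (hF i).
move=> e e0; have e3 : 0 < e / 3 by rewrite divr_gt0.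
have [n hn] := pr_bigcup_tail nu1 mF e3.
pose G p := \bigcup_(i in [set i | (i < p)%N]) F i.
rewrite -/(G n) in hn; set A := \bigcup_i F i in hn *.
have mG p : measurable (G p).
  by rewrite /G bigcup_mkcond; apply: bigcupT_measurable => k; case: ifP.
have hG p : converges_on (G p) by exact: converges_bigU.
have mA : measurable A by exact: bigcupT_measurable.
pose P i := F (n + i)%N `\` G (n + i)%N.
have mP i : measurable (P i) by exact: measurableD.
have hP i : converges_on (P i) by exact: convergesD.
have cover : A `\` G n `<=` \bigcup_i P i.
  move=> x [[i _ Fi] nG].
  have ex : exists i, `[< F i x >] by exists i; apply/asboolP.
  case: (ex_minnP ex) => p /asboolP Fp mp.
  have np : (n <= p)%N by rewrite leqNgt; apply/negP => lp; apply: nG; exists p.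
  exists (p - n)%N => //; rewrite /P subnKC //; split=> // -[r /= lr Fr].
  by have := mp r (asboolT Fr); rewrite leqNgt lr.
have tail : pr (limit_map @^-1` (A `\` G n)) <= e / 3.
  apply: (@le_trans _ _ (pr (\bigcup_i limit_map @^-1` P i))).
    by rewrite -preimage_bigcup; apply: (le_pr nu1) => x; apply: cover.
  apply: (pr_le_bigcup nu1) => p.
  rewrite (eq_bigr (fun i : 'I_p => pr (P i))); last first.
    by move=> i _; apply: converges_pr => //; apply: nm_measurable.
  rewrite -(pr_bigU nu1).
  - apply: le_trans hn; apply: (le_pr nu1) => x [i _ [Fx nGx]]; split; first by exists (n + i)%N.
    by move=> [r /= lr Fr]; apply: nGx; exists r => //=; apply: leq_trans lr (leq_addr _ _).
  - by move=> i _; apply: nm_measurable.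
  - move=> i j x _ _ [Fi nGi] [Fj nGj]; case: (ltngtP i j) => // l; exfalso.
      by apply: nGj; exists (n + i)%N; rewrite /= ?ltn_add2l.
    by apply: nGi; exists (n + j)%N; rewrite /= ?ltn_add2l.
have [_ /(_ _ e3) [k0 hk0]] := hG n; exists k0 => k /hk0.
have tailf : pr (f k @^-1` (A `\` G n)) <= e / 3.
  by apply: le_trans (mp_le nu1 nu1 _ (mf k)) hn.
set D := _ `+` _ => l.
apply: (@le_trans _ _ (pr ((D `|` limit_map @^-1` (A `\` G n)) `|` f k @^-1` (A `\` G n)))).
  apply: (le_pr nu1) => x.
  have GA y : G n y -> A y by move=> [i _ Fi]; exists i.
  have := GA (limit_map x); have := GA (f k x); rewrite /D /setY /=.
  by case: (pselect (G n (limit_map x))); case: (pselect (G n (f k x))); tauto.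
apply: le_trans (pr_leU nu1 _ _) _.
have := pr_leU nu1 D (limit_map @^-1` (A `\` G n)); lra.
Qed.

Lemma converges_measurable A : measurable A -> converges_on A.
Proof.
(* Measurability is carried along because [converges_bigcup] asks for it. The generating open rays
   are countable unions of complements of rational half-lines. *)
have sub : <<s @RGenOInfty.G R >> `<=` [set A : set Y | measurable A /\ converges_on A].
  apply: smallest_sub.
    split; first by split=> //; exact: converges0.
      by move=> B [mB hB]; rewrite setTD; split; [exact: measurableC | exact: convergesC].
    move=> F hF; split; first by apply: bigcupT_measurable => i; case: (hF i).
    by apply: converges_bigcup => i; case: (hF i).
  move=> B [x ->]; split; first exact: measurable_itv.
  rewrite (_ : [set` _] = \bigcup_n (if unpickle n is Some r then
      (if x < ratr r then ~` halfline (ratr r) else set0) else set0)).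
    apply: converges_bigcup => n; case: (unpickle n) => [r|]; try case: ifP => _.
    - by apply: measurableC; exact: measurable_halfline.
    - exact: measurable0.
    - exact: measurable0.
    - by apply: convergesC; exact: converges_halfline.
    - exact: converges0.
    - exact: converges0.
  apply/seteqP; split=> y.
    rewrite /= in_itv /= andbT => /rat_in_itvoo [r]; rewrite in_itv /= => /andP[l1 l2].
    exists (pickle r); first exact: I.
    by rewrite pickleK l1; apply/negP; rewrite -ltNge.
  move=> [n _]; case: (unpickle n) => // r; case: ifP => // xr.
  rewrite /halfline /= in_itv /= andbT => /negP; rewrite -ltNge; exact: lt_trans.
move=> mA; have [] // := sub A _.
by move: mA; rewrite -[X in _ -> X]/((@RGenOInfty.G R).-sigma.-measurable A) -RGenOInfty.measurableE.
Qed.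

Lemma limit_map_mp : mp nu nu limit_map.
Proof.
have null N : nu.-negligible N -> nu.-negligible (limit_map @^-1` N).
  move=> [M [mM M0 NM]]; apply/(pr_null nu1); apply/eqP; rewrite eq_le pr_ge0 ?nu1 // andbT.
  apply: (@le_trans _ _ (pr (limit_map @^-1` M))); first by apply: (le_pr nu1) => x; apply: NM.
  rewrite converges_pr; [|exact: nm_measurable|exact: converges_measurable].
  by rewrite (prE nu1) // M0.
move=> A [B mB nB]; have [[C mC nC] _] := converges_measurable mB.
split.
  exists C => //; apply: (@negligibleS _ _ _ _ (limit_map @^-1` (A `+` B) `|` (limit_map @^-1` B `+` C))).
    by move=> x; rewrite /setY /=; case: (pselect (B (limit_map x))); tauto.
  by apply: negligibleU => //; apply: null.
rewrite (pr_eq nu1 nB) -(converges_pr (nm_measurable _ mB) (converges_measurable mB)).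
by apply: (pr_eq nu1); apply: null nB.
Qed.

Lemma limit_map_converges A : nm nu A -> forall e : R, 0 < e -> exists k0, forall k,
  (k0 <= k)%N -> pr (limit_map @^-1` A `+` f k @^-1` A) <= e.
Proof.
move=> [B mB nB] e e0; have [_ /(_ e e0) [k0 h]] := converges_measurable mB.
exists k0 => k lk; apply: le_trans (h k lk); rewrite -[leRHS]add0r -[in leRHS](addr0 0).
have n1 := mp_null nu1 nu1 limit_map_mp nB; have n2 := mp_null nu1 nu1 (mf k) nB.
rewrite -{1}((pr_null nu1 _).1 n1) -((pr_null nu1 _).1 n2).
apply: le_trans (lerD (pr_leU nu1 _ _) (lexx _)); apply: le_trans (pr_leU nu1 _ _).
apply: (le_pr nu1) => x; rewrite /setY /=.
by case: (pselect (B (limit_map x))); case: (pselect (B (f k x))); tauto.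
Qed.

End Limit.

End UnitInterval.

(** * Trivial centralizers *)

Section Centralizer.
Local Open Scope classical_set_scope.
Local Open Scope ring_scope.

Context d (X : measurableType d) (R : realType) (mu : {measure set X -> \bar R}).
Hypothesis mu1 : mu setT = 1%E.

Lemma exact_power (T : aut mu) (T' Ti' : X -> X) (X0 : set X) n x :
  (forall x, X0 x -> X0 (T' x) /\ X0 (Ti' x)) -> (forall x, X0 x -> T' x = T x) ->
  (forall x, X0 x -> Ti' x = aut_inv T x) -> X0 x ->
  ziter T' Ti' n x = aut_pow T n x /\ X0 (ziter T' Ti' n x).
Proof.
move=> inv ET ETi hx.
have pos k : iter k T' x = iter k T x /\ X0 (iter k T' x).
  by elim: k => [|k [e h]] //; rewrite !iterS -e ET //; split=> //; rewrite -ET //; case: (inv _ h).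
have neg k : iter k Ti' x = iter k (aut_inv T) x /\ X0 (iter k Ti' x).
  by elim: k => [|k [e h]] //; rewrite !iterS -e ETi //; split=> //; rewrite -ETi //; case: (inv _ h).
by case: n => k; [exact: pos | exact: neg].
Qed.

(** Powers of T always lie in the centralizer. As T is invertible only almost everywhere, this is
    checked on an exact version of T. *)
Lemma trivial_centralizerP (T : aut mu) : trivial_centralizer T <->
  forall S, centralizer T S -> exists n : int, {ae mu, forall x, S x = aut_pow T n x}.
Proof.
split=> [h S|h]; first by rewrite h.
apply/seteqP; split=> S; first exact: h.
move=> [n hn]; have [T' [Ti' [X0 [[TK TiK _ _] [nX0 inv ET ETi X0N]]]]] := exactify mu1 T hn.
apply: negligibleS nX0 => x /= hx X0x; apply: hx.
have SE y : X0 y -> S y = ziter T' Ti' n y.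
  move=> X0y; have [-> _] := exact_power n inv ET ETi X0y.
  by apply: contrapT => ne; apply: (X0N y X0y).
have [X0Tx _] := inv x X0x; have [_ X0z] := exact_power n inv ET ETi X0x.
rewrite (SE x X0x) -(ET _ X0z) -(ET x X0x) (SE _ X0Tx) -(ziterS TiK).
by rewrite (ziterD TK TiK).
Qed.

End Centralizer.

Section AlmostEverywhere.
Local Open Scope classical_set_scope.
Local Open Scope ring_scope.

Context d1 d2 (X : measurableType d1) (Y : measurableType d2) (R : realType)
  (mu : {measure set X -> \bar R}) (nu : {measure set Y -> \bar R}).
Hypotheses (mu1 : mu setT = 1%E) (nu1 : nu setT = 1%E).

Lemma ae_mp f P : mp mu nu f -> {ae nu, forall y, P y} -> {ae mu, forall x, P (f x)}.
Proof. by move=> mf; apply: (mp_null mu1 nu1 mf). Qed.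

End AlmostEverywhere.

(** * Invariance under isomorphism *)

Section Transfer.
Local Open Scope classical_set_scope.
Local Open Scope ring_scope.

Context d1 d2 (X : measurableType d1) (Y : measurableType d2) (R : realType)
  (mu : {measure set X -> \bar R}) (nu : {measure set Y -> \bar R}).
Hypotheses (mu1 : mu setT = 1%E) (nu1 : nu setT = 1%E).

Lemma intertwine_sym (T : aut mu) (S : aut nu) f g : mod0_inverses mu nu f g ->
  {ae mu, forall x, f (T x) = S (f x)} -> {ae nu, forall y, g (S y) = T (g y)}.
Proof.
move=> [_ /(measure_preserving_mp nu1 mu1) mg gf fg] eq.
have [/(measure_preserving_mp mu1 mu1) mT _ _ _] := autP T.
have h1 : {ae nu, forall y, f (T (g y)) = S (f (g y))} := ae_mp nu1 mu1 mg eq.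
have h2 : {ae nu, forall y, g (f (T (g y))) = T (g y)} := ae_mp nu1 mu1 (mp_comp mg mT) gf.
by apply: filterS3 fg h1 h2 => y e1 e2 e3; rewrite -e3 e2 e1.
Qed.

Lemma semiconjugate_iter (f : X -> Y) (T : X -> X) (S : Y -> Y) k : mp mu mu T ->
  {ae mu, forall x, f (T x) = S (f x)} -> {ae mu, forall x, f (iter k T x) = iter k S (f x)}.
Proof.
move=> mT eq; elim: k => [|k IH]; first exact: aeW.
have h : {ae mu, forall x, f (T (iter k T x)) = S (f (iter k T x))}.
  exact: (mp_null mu1 mu1 (mp_iter k mT) eq).
by apply: filterS2 IH h => x e1 /= ->; rewrite e1.
Qed.

Lemma isomorphic_sym (T : aut mu) (S : aut nu) : isomorphic T S -> isomorphic S T.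
Proof.
move=> [f [g [fg eq]]]; exists g, f; split; last exact: intertwine_sym eq.
by case: fg.
Qed.

(** A map U commuting with S is conjugated to a map commuting with T; the power of T found there is
    carried back. *)
Lemma isomorphic_trivial_centralizer (T : aut mu) (S : aut nu) :
  isomorphic T S -> trivial_centralizer T -> trivial_centralizer S.
Proof.
move=> iso /(trivial_centralizerP mu1) triv; apply/(trivial_centralizerP nu1) => U US.
have [f [g [fg eq]]] := iso.
have [pf pg gf fg'] := fg.
have mf := (measure_preserving_mp mu1 nu1 f).1 pf.
have mg := (measure_preserving_mp nu1 mu1 g).1 pg.
have [pT pTi TiK TK] := autP T; have mT := (measure_preserving_mp mu1 mu1 _).1 pT.
have mTi := (measure_preserving_mp mu1 mu1 _).1 pTi.
have [pS pSi SiK SK] := autP S; have mS := (measure_preserving_mp nu1 nu1 _).1 pS.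
have mSi := (measure_preserving_mp nu1 nu1 _).1 pSi.
have [pU pUi UiK UK] := autP U; have mU := (measure_preserving_mp nu1 nu1 _).1 pU.
have mUi := (measure_preserving_mp nu1 nu1 _).1 pUi.
have mUf := mp_comp mf mU; have mUif := mp_comp mf mUi.
have inv : mod0_inverses mu mu (fun x => g (U (f x))) (fun x => g (aut_inv U (f x))).
  split.
  - apply/(measure_preserving_mp mu1 mu1); exact: (mp_comp mUf mg).
  - apply/(measure_preserving_mp mu1 mu1); exact: (mp_comp mUif mg).
  - have h1 : {ae mu, forall x, f (g (U (f x))) = U (f x)} := mp_null mu1 nu1 mUf fg'.
    have h2 : {ae mu, forall x, aut_inv U (U (f x)) = f x} := mp_null mu1 nu1 mf UiK.
    by apply: filterS3 gf h1 h2 => x e1 e2 e3; rewrite e2 e3 e1.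
  - have h1 : {ae mu, forall x, f (g (aut_inv U (f x))) = aut_inv U (f x)} :=
      mp_null mu1 nu1 mUif fg'.
    have h2 : {ae mu, forall x, U (aut_inv U (f x)) = f x} := mp_null mu1 nu1 mf UK.
    by apply: filterS3 gf h1 h2 => x e1 e2 e3; rewrite e2 e3 e1.
have eqg := intertwine_sym fg eq.
have [n hn] : exists n : int, {ae mu, forall x, g (U (f x)) = aut_pow T n x}.
  apply: (triv (Aut inv)) => /=.
  have h1 : {ae mu, forall x, g (S (U (f x))) = T (g (U (f x)))} := mp_null mu1 nu1 mUf eqg.
  have h2 : {ae mu, forall x, S (U (f x)) = U (S (f x))} := mp_null mu1 nu1 mf US.
  by apply: filterS3 eq h1 h2 => x e1 e2 e3; rewrite /= -e2 e3 e1.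
exists n.
have eqinv : {ae mu, forall x, f (aut_inv T x) = aut_inv S (f x)}.
  have mTif := mp_comp mTi mf.
  have h1 : {ae mu, forall x, f (T (aut_inv T x)) = S (f (aut_inv T x))} := mp_null mu1 mu1 mTi eq.
  have h2 : {ae mu, forall x, aut_inv S (S (f (aut_inv T x))) = f (aut_inv T x)} :=
    mp_null mu1 nu1 mTif SiK.
  by apply: filterS3 TK h1 h2 => x e1 e2 e3; rewrite -e3 -e2 e1.
have hpow : {ae mu, forall x, f (aut_pow T n x) = aut_pow S n (f x)}.
  by case: n {hn} => k; exact: semiconjugate_iter.
have h1 : {ae nu, forall y, f (g (U (f (g y)))) = U (f (g y))}.
  exact: (mp_null nu1 mu1 mg (mp_null mu1 nu1 mUf fg')).
have h2 : {ae nu, forall y, g (U (f (g y))) = aut_pow T n (g y)} := mp_null nu1 mu1 mg hn.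
have h3 : {ae nu, forall y, f (aut_pow T n (g y)) = aut_pow S n (f (g y))} := mp_null nu1 mu1 mg hpow.
have h4 : {ae nu, forall y, U y = f (aut_pow T n (g y))}.
  by apply: filterS3 fg' h1 h2 => y e1 e2 e3; rewrite -e3 e2 e1.
by apply: filterS3 fg' h3 h4 => y e1 e2 ->; rewrite e2 e1.
Qed.

End Transfer.

(** * The two implications on the unit interval *)

Section UnitIntervalCentralizer.
Local Open Scope classical_set_scope.
Local Open Scope ring_scope.

Variable R : realType.

Local Notation Y := (measurableTypeR R).
Local Notation nu := (unit_lebesgue R).
Local Notation pr := (pr nu).
Local Notation nu1 := (unit_lebesgue_setT R).

Variables (T : aut nu) (q : nat -> nat) (a : nat -> nat -> nat).
Hypothesis q_gt1 : cutting q.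
Hypothesis bounded : bounded_parameters q a.
Hypothesis rank1 : rank_one_with T q a.

Local Notation c := (spacer q a).

Lemma spacer_mod_all n i : ~~ (Qn q n %| i)%N -> c i = c (i %% Qn q n)%N.
Proof. exact: spacer_toeplitz. Qed.

Lemma no_long_stretch_trivial_centralizer : no_long_stretch q c -> trivial_centralizer T.
Proof.
move=> ns; have [[qM hq] [M hM]] := bounded.
have cle i : (c i <= (M + c 0).+1)%N by apply: leqW; apply: spacer_le.
have M0 : (0 < (M + c 0).+1)%N by [].
have [K K0 pf] := no_long_stretch_power_free q_gt1 spacer_mod_all hq cle M0 ns.
have [Cd _ hCd] := mism_shift q_gt1 spacer_mod_all hq cle M0 K0 pf.
apply/(trivial_centralizerP nu1) => S ST.
have [T' [Ti' [X0 [[TK TiK mT mTi] [nX0 inv ET ETi X0N] [B tB]]]]] :=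
  rank_one_exact nu1 q_gt1 rank1 ST.
have [pS _ _ _] := autP S; have mS := (measure_preserving_mp nu1 nu1 _).1 pS.
have nSX0 : nu.-negligible (S @^-1` ~` X0) := mp_null nu1 nu1 mS nX0.
have ST' : nu.-negligible [set x | S (T' x) <> T' (S x)].
  apply: (@negligibleS _ _ _ _ (~` X0 `|` S @^-1` ~` X0)); last exact: negligibleU.
  move=> x /= ne; apply: contrapT => nU; apply: ne.
  have X0x : X0 x by apply: contrapT => h; apply: nU; left.
  have X0Sx : X0 (S x) by apply: contrapT => h; apply: nU; right.
  rewrite ET // ET //; apply: esym; apply: contrapT => h; exact: (X0N x X0x).
have [j hj] := commuting_power nu1 TK TiK mT mTi q_gt1 spacer_mod_all tB hq cle M0 K0 pf mS ST' hCd.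
exists (- j).
have eqid : nu.-negligible [set x | (ziter T' Ti' j \o S) x <> id x].
  apply: ae_eq_halflines => r; apply/(pr_null nu1).
  have mA := measurable_halfline (ratr r : R).
  apply/eqP; rewrite eq_le pr_ge0 ?nu1 // andbT /setY; apply: le_trans (pr_leU nu1 _ _) _.
  (* The half-line gives one half of the symmetric difference with its preimage, and its complement
     gives the other. *)
  have h1 := hj _ mA; have h2 := hj _ (measurableC mA).
  rewrite [X in _ + X](_ : _ = 0) ?addr0; last by rewrite preimage_id.
  rewrite -h2; apply: (le_pr nu1) => x /= [h nh]; split=> //.
apply: (@negligibleS _ _ _ _ (([set x | (ziter T' Ti' j \o S) x <> id x] `|` ~` X0))); last exact: negligibleU.
move=> x /= ne; apply: contrapT => nU; apply: ne.
have X0x : X0 x by apply: contrapT => h; apply: nU; right.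
have e : ziter T' Ti' j (S x) = x by apply: contrapT => h; apply: nU; left.
by have [<- _] := exact_power (- j) inv ET ETi X0x; rewrite -[in RHS]e (ziterK TK TiK).
Qed.

Lemma trivial_centralizer_no_long_stretch : trivial_centralizer T -> no_long_stretch q c.
Proof.
move=> /(trivial_centralizerP nu1) triv; apply: contrapT => nns.
have stretches n0 m : exists2 n, (n0 <= n)%N & simple_stretch c (Qn q n) (Qn q (n + m)).
  apply: contrapT => nex; apply: nns; exists n0, m => n ln st.
  by apply: nex; exists n.
have [T' [Ti' [X0 [[TK TiK mT mTi] [nX0 inv ET ETi _] [B tB]]]]] :=
  rank_one_exact nu1 q_gt1 rank1 (negligible_set0 nu).
(* An enumeration of the rational half-lines, on which successive powers must become summably close
   for the limit map to exist. *)
pose A i : set Y := if unpickle i is Some r then halfline (ratr (r : rat)) else set0.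
have mA i : measurable (A i).
  by rewrite /A; case: unpickle => [r|]; [exact: measurable_halfline | exact: measurable0].
have [n [g [m [m0 hm hn hs hA]]]] :=
  rigid_sequence nu1 TK TiK mT mTi q_gt1 spacer_mod_all tB stretches mA.
have AE r : A (pickle (r : rat)) = halfline (ratr r) by rewrite /A pickleK.
have mf k : mp nu nu (iter (m k) T') := mp_iter (m k) mT.
have mfi k : mp nu nu (iter (m k) Ti') := mp_iter (m k) mTi.
have itK k := iterK TK k; have itVK k := iterVK TiK k.
have cf (r : rat) : exists k0, forall k, (k0 <= k)%N ->
    pr (iter (m k.+1) T' @^-1` halfline (ratr r) `+` iter (m k) T' @^-1` halfline (ratr r)) <= (1 / 2) ^+ k.
  exists (pickle r) => k lk; have := hA _ _ lk; rewrite AE => hAk.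
  apply: le_trans hAk; have [em _] := hm k; rewrite em.
  have -> : iter (m k + g k) T' = iter (g k) T' \o iter (m k) T'.
    by apply/funext => x /=; rewrite addnC iterD.
  exact: (mp_le nu1 nu1 (_ `+` _) (mf k)).
have cfi (r : rat) : exists k0, forall k, (k0 <= k)%N ->
    pr (iter (m k.+1) Ti' @^-1` halfline (ratr r) `+` iter (m k) Ti' @^-1` halfline (ratr r)) <= (1 / 2) ^+ k.
  exists (pickle r) => k lk; have := hA _ _ lk; rewrite AE => hAk.
  apply: le_trans hAk; have [em _] := hm k; rewrite em.
  (* The estimate for the power g k is pulled back by the power -m (k+1), and their product is the
     power -m k. *)
  apply: le_trans (mp_le nu1 nu1 _ (mfi k.+1)); apply: (le_pr nu1) => x; rewrite em /setY /=.
  have -> : iter (g k) T' (iter (m k + g k) Ti' x) = iter (m k) Ti' x.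
    by rewrite addnC iterD itVK.
  by tauto.
pose S := limit_map (fun k => iter (m k) T'); pose Si := limit_map (fun k => iter (m k) Ti').
have mS : mp nu nu S := limit_map_mp mf cf.
have mSi : mp nu nu Si := limit_map_mp mfi cfi.
have hS := limit_map_converges mf cf; have hSi := limit_map_converges mfi cfi.
rewrite -/S in hS; rewrite -/Si in hSi.
have small E : (forall e : R, 0 < e -> pr E <= e) -> nu.-negligible E.
  move=> h; apply/(pr_null nu1); apply/eqP; rewrite eq_le pr_ge0 ?nu1 // andbT.
  by apply/ler_addgt0Pr => e e0; rewrite add0r; apply: h.
(* F is compared with [f k] on a half-line and G with [h k] on the preimage of that half-line under
   F, so F (G x) is compared with [f k (h k x)], which is x. *)
have inverse (F G : Y -> Y) (f h : nat -> Y -> Y) : mp nu nu F -> (forall k, mp nu nu (h k)) ->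
    (forall k, cancel (h k) (f k)) ->
    (forall A, nm nu A -> forall e : R, 0 < e -> exists k0, forall k, (k0 <= k)%N ->
      pr (F @^-1` A `+` f k @^-1` A) <= e) ->
    (forall A, nm nu A -> forall e : R, 0 < e -> exists k0, forall k, (k0 <= k)%N ->
      pr (G @^-1` A `+` h k @^-1` A) <= e) ->
    nu.-negligible [set x | F (G x) <> x].
  move=> mF mh hK cF cG; apply: (@ae_eq_halflines R _ _ nu (F \o G) id) => r; apply: small => e e0.
  have e2 : 0 < e / 2 by rewrite divr_gt0.
  have nH : nm nu (halfline (ratr r)) := nm_measurable nu (measurable_halfline _).
  have [nFH _] := mF _ nH.
  have [k1 h1] := cF _ nH _ e2; have [k2 h2] := cG _ nFH _ e2.
  pose k := (k1 + k2)%N; have := h1 k (leq_addr _ _); have := h2 k (leq_addl _ _).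
  set D2 := _ `+` _; set D1 := _ `+` _ => l2 l1.
  apply: (@le_trans _ _ (pr (D2 `|` h k @^-1` D1))).
    apply: (le_pr nu1) => x; rewrite /D1 /D2 /setY /= hK.
    by case: (pselect (halfline (ratr r) (F (h k x)))); tauto.
  apply: le_trans (pr_leU nu1 _ _) _.
  have := mp_le nu1 nu1 D1 (mh k); lra.
have SSi : nu.-negligible [set x | S (Si x) <> x].
  exact: (inverse S Si _ _ mS mfi (fun k => itVK (m k)) hS hSi).
have SiS : nu.-negligible [set x | Si (S x) <> x].
  exact: (inverse Si S _ _ mSi mf (fun k => itK (m k)) hSi hS).
have comm : nu.-negligible [set x | S (T' x) <> T' (S x)].
  apply: (@ae_eq_halflines R _ _ nu (S \o T') (T' \o S)) => r; apply: small => e e0.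
  have e2 : 0 < e / 2 by rewrite divr_gt0.
  have nH : nm nu (halfline (ratr r)) := nm_measurable nu (measurable_halfline _).
  have [nTH _] := mT _ nH.
  have [k1 h1] := hS _ nH _ e2; have [k2 h2] := hS _ nTH _ e2.
  pose k := (k1 + k2)%N; have := h1 k (leq_addr _ _); have := h2 k (leq_addl _ _).
  set D2 := _ `+` _; set D1 := _ `+` _ => l2 l1.
  apply: (@le_trans _ _ (pr (T' @^-1` D1 `|` D2))).
    apply: (le_pr nu1) => x; rewrite /D1 /D2 /setY /= -iterSr iterS.
    by case: (pselect (halfline (ratr r) (T' (iter (m k) T' x)))); tauto.
  apply: le_trans (pr_leU nu1 _ _) _.
  have := mp_le nu1 nu1 D1 mT; lra.
have invS : mod0_inverses nu nu S Si.
  by split; [exact/(measure_preserving_mp nu1 nu1) | exact/(measure_preserving_mp nu1 nu1) | exact: SiS | exact: SSi].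
have nSX0 : nu.-negligible (S @^-1` ~` X0) := mp_null nu1 nu1 mS nX0.
have [l hl] : exists l : int, {ae nu, forall x, S x = aut_pow T l x}.
  apply: (triv (Aut invS)) => /=.
  apply: (@negligibleS _ _ _ _ ((~` X0 `|` S @^-1` ~` X0) `|` [set x | S (T' x) <> T' (S x)])).
    move=> x /= ne; apply: contrapT => nU; apply: ne.
    have X0x : X0 x by apply: contrapT => h; apply: nU; left; left.
    have X0Sx : X0 (S x) by apply: contrapT => h; apply: nU; left; right.
    by rewrite -ET // -ET //; apply/esym; apply: contrapT => h; apply: nU; right.
  by apply: negligibleU => //; apply: negligibleU.
apply: (rigid_limit_not_power nu1 TK TiK mT mTi q_gt1 spacer_mod_all tB (l := l) hm hn hs hS).
apply: (@negligibleS _ _ _ _ ((~` X0) `|` [set x | S x <> aut_pow T l x])); last exact: negligibleU.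
move=> x /= ne; case: (pselect (X0 x)) => X0x; last by left.
by right; have [<- _] := exact_power l inv ET ETi X0x.
Qed.

End UnitIntervalCentralizer.

Theorem theorem1p1 (R : realType) (d : measure_display) (X : measurableType d)
    (mu : probability X R) (T : aut mu)
    (q : nat -> nat) (a : nat -> nat -> nat)
    (hX : lebesgue_space mu)
    (hq : cutting q)
    (hT : rank_one_described T q a)
    (hb : bounded_parameters q a) :
  trivial_centralizer T <-> canonically_bounded q a.
Proof.
have [S [rank1 iso]] := hT.
have mu1 : mu setT = 1%E by exact: probability_setT.
have nu1 := unit_lebesgue_setT R.
split=> [triv|cb].
  apply: no_long_stretch_canonically_bounded => //.
  apply: (trivial_centralizer_no_long_stretch hq rank1).
  exact: (isomorphic_trivial_centralizer mu1 nu1 iso).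
apply: (isomorphic_trivial_centralizer nu1 mu1 (isomorphic_sym mu1 nu1 iso)).
apply: (no_long_stretch_trivial_centralizer hq hb rank1).
exact: canonically_bounded_no_long_stretch.
Qed.
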